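(* There is no orientable one-cusped, mixed-platonic orbifold $O=\mathbb{H}^3/\Gamma$ with peripheral tiling $\mathcal{S}$, such that the peripheral subgroup of $\Gamma$ is the full orientation-preserving symmetry group $\mathrm{Sym}^{OP}(\mathcal{S})$ of $\mathcal{S}$ or its index-two $(3,3,3)$-rotation subgroup.
   Context: A connected, complete, finite-volume hyperbolic $3$-orbifold $O=\mathbb{H}^3/\Gamma$ is mixed-platonic if there is a $\Gamma$-invariant (face-to-face) tiling $\mathcal{P}$ of $\mathbb{H}^3$ with $n_1\geq 1$ $\Gamma$-orbits of regular ideal tetrahedra, $n_2\ge 1$ of regular ideal octahedra, and no other tiles. Standard position (upper half-space model): a regular ideal tetrahedron is in standard position if its ideal vertices are $0,1,\infty,\frac12(1+i\sqrt3)$; a regular ideal octahedron is in standard position if its ideal vertices are $0,1,\infty,1+i,i,\frac12(1+i)$. $\Gamma$ is represented in standard position if it leaves invariant a face-to-face tiling $\mathcal{P}$ of $\mathbb{H}^3$ by regular ideal tetrahedra and regular ideal octahedra (at least one $\Gamma$-orbit of each, and no other tiles) that has a tile in standard position; this can always be arranged by conjugating $\Gamma$. In that case let $B_\infty=\{(z,t): z\in\mathbb{C},\,t\ge1\}$. A tiling $\mathcal{T}$ of $\mathbb{C}$ is a peripheral tiling of $O$ if $\Gamma$ can be represented in standard position, with $\Gamma$-invariant tiling $\mathcal{P}$, so that $\mathcal{T}=\mathcal{P}\cap\partial B_\infty$, where $\partial B_\infty=\mathbb{C}\times\{1\}$ is identified with $\mathbb{C}$; it is a tiling by unit-sidelength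 squares and equilateral triangles. The peripheral subgroup is the stabilizer $\Lambda$ of $\infty$ in $\Gamma$, identified with the group of isometries of $\partial B_\infty\cong\mathbb{C}$ by which it acts; it preserves the peripheral tiling. The tiling $\mathcal{S}$ (defined up to isometry of the plane): let $L$ be a hexagonal lattice with minimal distance $2+\sqrt3$. Around each point of $L$ place a regular hexagon of side $1$, so that each segment from its center to one of the six nearest points of $L$ passes through a vertex of the hexagon. For each pair of nearest points of $L$, the two facing hexagon vertices (at distance $\sqrt3$) are the endpoints of the long diagonal of a rhombus that is a union of two unit equilateral triangles sharing an edge (the short diagonal). Each remaining complementary region, centered at the centroid of a triangle formed by three mutually nearest points of $L$, is the union of a unit equilateral triangle, whose vertices are endpoints of short diagonals of three such rhombi, with a unit square on each of its three sides. $\mathcal{S}$ is the resulting tiling, with each hexagon divided into six equilateral triangles meeting at its center. Its orientation-preserving symmetry group is a $(2,3,6)$-rotation group (wallpaper group $p6$), which has a unique index-two subgroup that is a $(3,3,3)$-rotation group (wallpaper group $p3$). *)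

(* Defs.v *)
From HB Require Import structures.
From mathcomp Require Import all_boot all_order all_algebra.
From mathcomp Require Import all_classical all_reals all_analysis.
From mathcomp Require Import complex.

Set Implicit Arguments.
Unset Strict Implicit.
Unset Printing Implicit Defensive.

Import Order.TTheory GRing.Theory Num.Theory.
Import numFieldNormedType.Exports.

Local Open Scope classical_set_scope.
Local Open Scope ring_scope.
Local Open Scope complex_scope.

Local Notation normc := ComplexField.Normc.normc.

(** * Groups of transformations *)

Definition transformation_group (X : Type) (G : set (X -> X)) : Prop :=
  [/\ G id,
      (forall f g, G f -> G g -> G (f \o g)) &
      (forall f, G f -> exists2 g, G g & cancel f g /\ cancel g f)].

Definition generated_group (X : Type) (A : set (X -> X)) : set (X -> X) :=
  [set f | forall G, transformation_group G -> A `<=` G -> G f].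

Definition index_two_subgroup (X : Type) (H G : set (X -> X)) : Prop :=
  [/\ transformation_group H, H `<=` G &
      exists2 g, G g /\ ~ H g & forall f, G f -> H f \/ H (g \o f)].

(** * Hyperbolic 3-space

   Points of the one-point compactification of C x R.  The upper half-space
   [H3] is [0 < t]; its ideal boundary consists of [Some (z, 0)] and of
   [None], the point at infinity. *)

Definition mpoint (R : realType) : Type := option (R[i] * R).

Definition H3 (R : realType) : set (mpoint R) :=
  [set p | exists z t, 0 < t /\ p = Some (z, t)].

Definition ideal (R : realType) : set (mpoint R) :=
  [set p | p = None \/ exists z, p = Some (z, 0)].

Definition coord3 (R : realType) (x : R * R * R) : mpoint R :=
  Some (x.1.1 +i* x.1.2, x.2).

Definition upper (R : realType) : set (R * R * R) := [set x | 0 < x.2].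

(* Poincare extension of z |-> (a z + b) / (c z + d), for a matrix of
   determinant 1.  The same formula gives the action on H3 (t > 0) and on the
   ideal boundary (t = 0); the denominator vanishes only at the ideal point
   sent to infinity. *)
Definition poincare (R : realType) (A : 'M[R[i]]_2) (p : mpoint R) : mpoint R :=
  let a := A 0 0 in let b := A 0 1 in let c := A 1 0 in let d := A 1 1 in
  match p with
  | None => if c == 0 then None else Some (a / c, 0)
  | Some (z, t) =>
      let N := normc (c * z + d) ^+ 2 + normc c ^+ 2 * t ^+ 2 in
      if N == 0 then None
      else Some (((a * z + b) * conjc (c * z + d)
                  + a * conjc c * (t ^+ 2)%:C) / N%:C,
                 t / N)
  end.

Definition reflection (R : realType) (p : mpoint R) : mpoint R :=
  if p is Some (z, t) then Some (conjc z, t) else None.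

(* Isom^+(H^3) = PSL_2(C).  An isometry of H^3 is identified with its unique
   extension to a Moebius transformation of the compactification. *)
Definition hyp_op_isometry (R : realType) (f : mpoint R -> mpoint R) : Prop :=
  exists2 A : 'M[R[i]]_2, \det A = 1 & f = poincare A.

Definition hyp_isometry (R : realType) (f : mpoint R -> mpoint R) : Prop :=
  hyp_op_isometry f \/ exists2 g, hyp_op_isometry g & f = g \o @reflection R.

(** * Hyperbolic 3-orbifolds H^3 / Gamma *)

Definition properly_discontinuous (R : realType)
    (Gamma : set (mpoint R -> mpoint R)) : Prop :=
  forall K : set (R * R * R), compact K -> K `<=` @upper R ->
    finite_set [set f | Gamma f /\
      (f @` (@coord3 R @` K)) `&` (@coord3 R @` K) !=set0].

Local Notation lebesgue3 R :=
  ((@lebesgue_measure R \x @lebesgue_measure R) \x @lebesgue_measure R)%E.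

Definition hyperbolic_volume (R : realType) (F : set (R * R * R)) : \bar R :=
  (\int[lebesgue3 R]_(x in F) (x.2 ^- 3)%:E)%E.

Definition fundamental_domain (R : realType)
    (Gamma : set (mpoint R -> mpoint R)) (F : set (R * R * R)) : Prop :=
  [/\ measurable F, F `<=` @upper R,
      (forall p, @H3 R p -> exists2 f, Gamma f & (f @` (@coord3 R @` F)) p) &
      (forall f, Gamma f -> f <> id ->
        (lebesgue3 R).-negligible
          [set x | F x /\ (f @` (@coord3 R @` F)) (coord3 x)])].

Definition finite_covolume (R : realType)
    (Gamma : set (mpoint R -> mpoint R)) : Prop :=
  exists2 F, fundamental_domain Gamma F & (hyperbolic_volume F < +oo)%E.

(* The quotient of H^3 by such a group is automatically connected and
   complete. *)
Definition hyperbolic_orbifold (R : realType)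
    (Gamma : set (mpoint R -> mpoint R)) : Prop :=
  [/\ transformation_group Gamma, Gamma `<=` @hyp_isometry R,
      properly_discontinuous Gamma & finite_covolume Gamma].

Definition orientable (R : realType)
    (Gamma : set (mpoint R -> mpoint R)) : Prop :=
  Gamma `<=` @hyp_op_isometry R.

Definition parabolic (R : realType) (f : mpoint R -> mpoint R) : Prop :=
  (forall p, @H3 R p -> f p <> p) /\
  (exists! v, @ideal R v /\ f v = v).

Definition parabolic_fixed_point (R : realType)
    (Gamma : set (mpoint R -> mpoint R)) (v : mpoint R) : Prop :=
  ideal v /\ exists2 f, Gamma f & parabolic f /\ f v = v.

(* The cusps of a finite-volume quotient correspond to the orbits of parabolic
   fixed points. *)
Definition one_cusped (R : realType)
    (Gamma : set (mpoint R -> mpoint R)) : Prop :=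
  (exists v, parabolic_fixed_point Gamma v) /\
  (forall v w, parabolic_fixed_point Gamma v ->
     parabolic_fixed_point Gamma w -> exists2 f, Gamma f & f v = w).

(** * Ideal polyhedra

   When [circle_disc alpha beta delta > 0], the set
   [0 <= side alpha beta delta p] is a closed half-space of H^3 together with
   its ideal points, and [side alpha beta delta p = 0] is its bounding plane
   (a hemisphere if [alpha != 0], a vertical half-plane otherwise); every
   closed half-space arises in this way. *)

Definition circle_disc (R : realType) (alpha : R) (beta : R[i]) (delta : R) :
    R :=
  normc beta ^+ 2 - alpha * delta.

Definition side (R : realType) (alpha : R) (beta : R[i]) (delta : R)
    (p : mpoint R) : R :=
  if p is Some (z, t) then
    alpha * (normc z ^+ 2 + t ^+ 2)
    + 2 * complex.Re (conjc beta * z) + delta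
  else alpha.

(* Convex hull in H^3 of a set of ideal points *)
Definition ideal_hull (R : realType) (V : set (mpoint R)) : set (mpoint R) :=
  [set p | @H3 R p /\ forall alpha beta delta,
     0 < circle_disc alpha beta delta ->
     (forall v, V v -> 0 <= side alpha beta delta v) ->
     0 <= side alpha beta delta p].

(* The empty set counts as a face; T itself does not, when T has interior. *)
Definition face (R : realType) (F T : set (mpoint R)) : Prop :=
  exists alpha beta delta,
    [/\ 0 < circle_disc alpha beta delta,
        (forall p, T p -> 0 <= side alpha beta delta p) &
        F = T `&` [set p | side alpha beta delta p = 0]].

(* exp (i pi / 3) *)
Definition omega (R : realType) : R[i] := 2^-1 +i* (Num.sqrt 3 / 2).

Definition standard_tetrahedron (R : realType) : set (mpoint R) :=
  ideal_hull [set Some (0, 0); Some (1, 0); None; Some (omega R, 0)].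

Definition standard_octahedron (R : realType) : set (mpoint R) :=
  ideal_hull [set Some (0, 0); Some (1, 0); None; Some (1 +i* 1, 0);
                  Some (0 +i* 1, 0); Some (2^-1 +i* 2^-1, 0)].

(* All regular ideal polyhedra of a given combinatorial type are isometric. *)
Definition regular_ideal_tetrahedron (R : realType)
    (T : set (mpoint R)) : Prop :=
  exists2 g, @hyp_isometry R g & T = g @` @standard_tetrahedron R.

Definition regular_ideal_octahedron (R : realType)
    (T : set (mpoint R)) : Prop :=
  exists2 g, @hyp_isometry R g & T = g @` @standard_octahedron R.

(** * Tilings and mixed-platonic orbifolds *)

Definition locally_finite (R : realType) (P : set (set (mpoint R))) : Prop :=
  forall K : set (R * R * R), compact K -> K `<=` @upper R ->
    finite_set [set T | P T /\ T `&` (@coord3 R @` K) !=set0].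

(* The last clause also makes the interiors of distinct tiles disjoint. *)
Definition face_to_face_tiling (R : realType)
    (P : set (set (mpoint R))) : Prop :=
  [/\ (forall T, P T -> T `<=` @H3 R),
      (forall p, @H3 R p -> exists2 T, P T & T p),
      locally_finite P &
      (forall T1 T2, P T1 -> P T2 -> T1 <> T2 ->
         face (T1 `&` T2) T1 /\ face (T1 `&` T2) T2)].

Definition invariant_tiling (X : Type) (G : set (X -> X))
    (P : set (set X)) : Prop :=
  forall f T, G f -> P T -> P (f @` T).

Definition tetra_octahedral_tiling (R : realType)
    (Gamma : set (mpoint R -> mpoint R)) (P : set (set (mpoint R))) : Prop :=
  [/\ face_to_face_tiling P, invariant_tiling Gamma P,
      (forall T, P T ->
         regular_ideal_tetrahedron T \/ regular_ideal_octahedron T),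
      (exists T, P T /\ regular_ideal_tetrahedron T) &
      (exists T, P T /\ regular_ideal_octahedron T)].

Definition orbits (X : Type) (G : set (X -> X)) (P : set (set X)) :
    set (set (set X)) :=
  [set [set f @` T | f in G] | T in P].

Definition mixed_platonic (R : realType)
    (Gamma : set (mpoint R -> mpoint R)) : Prop :=
  exists P, [/\ tetra_octahedral_tiling Gamma P,
    finite_set (orbits Gamma (P `&` @regular_ideal_tetrahedron R)) &
    finite_set (orbits Gamma (P `&` @regular_ideal_octahedron R))].

(** * Peripheral tilings and peripheral subgroups *)

Definition standard_position (R : realType)
    (Gamma : set (mpoint R -> mpoint R)) (P : set (set (mpoint R))) : Prop :=
  tetra_octahedral_tiling Gamma P /\
  (P (@standard_tetrahedron R) \/ P (@standard_octahedron R)).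

Definition conjugate_by (X : Type) (g : X -> X) (G : set (X -> X)) :
    set (X -> X) :=
  [set h : X -> X | exists2 f, G f & h \o g = g \o f].

Definition horosphere_slice (R : realType) (P : set (set (mpoint R))) :
    set (set R[i]) :=
  [set Q | Q !=set0 /\ exists2 T, P T & Q = [set z | T (Some (z, 1))]].

(* The stabilizer of infinity, acting on the horosphere C x {1} *)
Definition peripheral_subgroup (R : realType)
    (Gamma : set (mpoint R -> mpoint R)) : set (R[i] -> R[i]) :=
  [set g | exists f, [/\ Gamma f, f None = None &
                         forall z, f (Some (z, 1)) = Some (g z, 1)]].

(* [T] is a peripheral tiling of H^3 / Gamma, and [Lambda] is the peripheral
   subgroup in a representation of Gamma in standard position giving [T]. *)
Definition peripheral_pair (R : realType) (Gamma : set (mpoint R -> mpoint R))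
    (T : set (set R[i])) (Lambda : set (R[i] -> R[i])) : Prop :=
  exists g P,
    [/\ @hyp_isometry R g, standard_position (conjugate_by g Gamma) P,
        T = horosphere_slice P &
        Lambda = peripheral_subgroup (conjugate_by g Gamma)].

(** * Plane geometry and the tiling S *)

Definition plane_isometry (R : realType) (f : R[i] -> R[i]) : Prop :=
  forall z w, `|f z - f w| = `|z - w|.

Definition op_plane_isometry (R : realType) (f : R[i] -> R[i]) : Prop :=
  exists u v : R[i], `|u| = 1 /\ f = (fun z => u * z + v).

Definition tiling_image (X Y : Type) (f : X -> Y) (T : set (set X)) :
    set (set Y) := [set f @` Q | Q in T].

Definition sym_op (R : realType) (T : set (set R[i])) : set (R[i] -> R[i]) :=
  [set f | op_plane_isometry f /\ tiling_image f T = T].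

(* Rotation by 2 pi / 3 about a *)
Definition rotation3 (R : realType) (a z : R[i]) : R[i] :=
  a + omega R ^+ 2 * (z - a).

(* Generated by the rotations of order three about the vertices of a triangle
   with all angles pi / 3 *)
Definition rotation_group_333 (R : realType) (G : set (R[i] -> R[i])) : Prop :=
  exists a b c : R[i],
    [/\ a != b, `|b - c| = `|a - b|, `|c - a| = `|a - b| &
        G = generated_group [set rotation3 a; rotation3 b; rotation3 c]].

Definition convex_hull (R : realType) (s : seq R[i]) : set R[i] :=
  [set z | exists a : 'I_(size s) -> R,
     [/\ (forall i, 0 <= a i), \sum_i a i = 1 & z = \sum_i (a i)%:C * s`_i]].

Definition spacing (R : realType) : R := 2 + Num.sqrt 3.

(* The lattice L *)
Definition hex_lattice (R : realType) : set R[i] :=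
  [set l | exists m n : int,
     l = (spacing R)%:C * (m%:~R + n%:~R * omega R)].

(* The vertex in direction k (mod 6) of the hexagon centered at l; the nearest
   point of L in that direction is l + spacing * omega ^+ k. *)
Definition hex_vertex (R : realType) (l : R[i]) (k : nat) : R[i] :=
  l + omega R ^+ k.

Definition neighbor (R : realType) (l : R[i]) (k : nat) : R[i] :=
  l + (spacing R)%:C * omega R ^+ k.

(* End points of the short diagonal of the rhombus between l and its neighbor
   in direction k, to the left and to the right when facing that neighbor.
   The short diagonal has length 1 and is centered at the midpoint of l and
   that neighbor. *)
Definition diag_left (R : realType) (l : R[i]) (k : nat) : R[i] :=
  l + ((spacing R / 2) +i* (1 / 2)) * omega R ^+ k.

Definition diag_right (R : realType) (l : R[i]) (k : nat) : R[i] :=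
  l + ((spacing R / 2) -i* (1 / 2)) * omega R ^+ k.

(* For each center l and direction k: a sixth of the hexagon at l, the half of
   a rhombus nearest to l, the triangle around the centroid of l and its
   neighbors in directions k and k + 1, and the square on the side of that
   triangle facing l, whose opposite side is a side of the hexagon. *)
Definition tiling_S (R : realType) : set (set R[i]) :=
  [set Q | exists l k, @hex_lattice R l /\
     [\/ Q = convex_hull [:: l; hex_vertex l k; hex_vertex l k.+1],
         Q = convex_hull [:: hex_vertex l k; diag_left l k; diag_right l k],
         Q = convex_hull [:: diag_left l k; diag_right l k.+1;
                             diag_left (neighbor l k) k.+2] |
         Q = convex_hull [:: hex_vertex l k; hex_vertex l k.+1;
                             diag_right l k.+1; diag_left l k]]].

(* Main.v *)
(** The vertices of tiles are parabolic fixed points, so in the one-cusped case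
    they are all equivalent to infinity and all have a link congruent to S.
    The peripheral subgroup contains all rotations of order three of S, since
    a subgroup of index two contains every element of odd order.  Label the
    edges of the tiling by the position of their end points in S, which are
    centres of hexagons, vertices of hexagons, and ends of short diagonals.
    An edge from infinity to the centre of a hexagon looks the same from both
    ends.  An edge from infinity to a vertex of a hexagon has, at its other
    end, the label of the end of a short diagonal.  Hence a rotation of order
    three about one of the remaining triangles of S, conjugated to that other
    end, permutes the vertices of a triangle cyclically in a way that does not
    respect these labels.

    The existence of elements moving the vertices 0 and 1 to infinity uses
    discreteness: infinitely many tiles have a vertex in common, finitely many
    orbits of tiles give infinitely many elements fixing it, and these
    generate a parabolic.  The tiling that witnesses the finiteness of the
    number of orbits need not be the one with peripheral tiling S, but its
    cusps bound the position of the tiles of the other one. *)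

Require Import Defs.
From mathcomp Require Import all_boot all_order all_algebra.
From mathcomp Require Import all_classical all_reals all_analysis.
From mathcomp Require Import complex.
From mathcomp Require Import ring lra.

Set Implicit Arguments.
Unset Strict Implicit.
Unset Printing Implicit Defensive.

Import Order.TTheory GRing.Theory Num.Theory.
Import numFieldNormedType.Exports.
Local Open Scope classical_set_scope.
Local Open Scope ring_scope.
Local Open Scope complex_scope.

Local Notation normc := ComplexField.Normc.normc.

(** * Isometries of hyperbolic space *)

Section Moebius.
Variable R : realType.
Local Notation C := R[i].

(** The obstacle is that [horosphere_slice] shows only the shape of a tile at height 1, whereas the
    group acts on ideal vertices. A polygon of the slice could belong to a tile that ends below
    infinity; the neighbours across its edges are used to exclude this. Vertices are then read off
    from tiles as bare sets, since nothing else is given about them. An element taking an ideal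
    point [p] to infinity acts on the other ideal points as [y] to [a + u / (y - p)], so it is
    determined by [a] and [u]. The tiles around the edge from infinity to [p] restrict this pair to
    one or two families, described by a centre [l] and a direction [W], a power of [omega]. What
    remains is arithmetic with a twelfth root of unity. The final contradictions all have one form:
    a tetrahedron and an octahedron stand on the same side of the same directed edge. The peripheral
    group is only known to contain rotations by multiples of 2 pi / 3, while [W] may be any sixth
    root of unity; this forces the split into two parities at the end. *)

Definition nsq (z : C) : R := complex.Re z ^+ 2 + complex.Im z ^+ 2.

Lemma normc_sqr z : normc z ^+ 2 = nsq z.
Proof. by case: z => x y; rewrite /nsq /= sqr_sqrtr // addr_ge0 ?sqr_ge0. Qed.

Lemma nsq_ge0 z : 0 <= nsq z.
Proof. by rewrite addr_ge0 ?sqr_ge0. Qed.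

Lemma nsq_eq0 z : (nsq z == 0) = (z == 0).
Proof.
case: z => x y; rewrite /nsq /= paddr_eq0 ?sqr_ge0 // !sqrf_eq0.
by apply/andP/eqP => [[/eqP -> /eqP ->]|[-> ->]].
Qed.

Lemma nsq_gt0 z : (0 < nsq z) = (z != 0).
Proof. by rewrite lt_neqAle nsq_ge0 andbT eq_sym nsq_eq0. Qed.

Lemma nsqM z w : nsq (z * w) = nsq z * nsq w.
Proof. case: z w => [x y] [u v]; rewrite /nsq /=; ring. Qed.

Lemma nsqN z : nsq (- z) = nsq z.
Proof. by case: z => x y; rewrite /nsq /= !sqrrN. Qed.

Lemma nsqX z n : nsq (z ^+ n) = nsq z ^+ n.
Proof.
elim: n => [|n IH]; last by rewrite !exprS nsqM IH.
by rewrite !expr0 /nsq /=; ring.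
Qed.

Lemma nsq_conj z : nsq (conjc z) = nsq z.
Proof. by case: z => x y; rewrite /nsq /= sqrrN. Qed.

Lemma nsq1 : nsq 1 = 1.
Proof. by rewrite /nsq /=; ring. Qed.

Lemma nsqV z : nsq z^-1 = (nsq z)^-1.
Proof.
have [->|z0] := eqVneq z 0.
  by rewrite invr0 /nsq /= expr0n /= addr0 invr0.
have h : nsq z != 0 by rewrite nsq_eq0.
by apply: (mulfI h); rewrite -nsqM !divff // nsq1.
Qed.

Lemma complexE2 (z w : C) :
  complex.Re z = complex.Re w -> complex.Im z = complex.Im w -> z = w.
Proof. by case: z w => [x y] [u v] /= -> ->. Qed.

Definition aff (q p : C) (x : mpoint R) : mpoint R :=
  if x is Some (z, t) then Some (q * z + p, normc q * t) else None.

(** Inversion in the unit sphere, which exchanges 0 and infinity. *)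
Definition invs (x : mpoint R) : mpoint R :=
  if x is Some (z, t) then
    if nsq z + t ^+ 2 == 0 then None
    else Some (((nsq z + t ^+ 2)^-1)%:C * z, t / (nsq z + t ^+ 2))
  else Some (0, 0).

(** The boolean is true for orientation-preserving maps. With generators instead of matrices, each
    invariant below needs only four short checks, and reflections are treated on the same
    footing. *)
Inductive iso : bool -> (mpoint R -> mpoint R) -> Prop :=
| iso_aff q p : q != 0 -> iso true (aff q p)
| iso_refl : iso false (@reflection R)
| iso_invs : iso false invs
| iso_comp b c f g : iso b f -> iso c g -> iso (b == c) (f \o g).

Lemma normc_gt0 (q : C) : q != 0 -> 0 < normc q.
Proof.
move=> q0; rewrite lt_neqAle; apply/andP; split; last by case: q q0 => x y _; rewrite /= sqrtr_ge0.
apply/eqP => h; move: (normc_sqr q); rewrite -h expr0n /= => /esym/eqP.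
by rewrite nsq_eq0 (negPf q0).
Qed.

Lemma normcM (z w : C) : normc (z * w) = normc z * normc w.
Proof. exact: ComplexField.Normc.normcM. Qed.

Lemma normc1 : normc (1 : C) = 1.
Proof. by rewrite /= expr1n expr0n /= addr0 sqrtr1. Qed.

Lemma normcV (q : C) : normc q^-1 = (normc q)^-1.
Proof.
have [->|q0] := eqVneq q 0.
  by rewrite invr0 /= expr0n /= addr0 sqrtr0 invr0.
have h := lt0r_neq0 (normc_gt0 q0); apply: (mulfI h).
by rewrite -normcM divff // divff // normc1.
Qed.

Lemma affK q p : q != 0 -> cancel (aff q p) (aff q^-1 (- (q^-1 * p))).
Proof.
move=> q0 [[z t]|] //=; have h := normc_gt0 q0.
rewrite normcV; congr (Some (_, _)); first by field.
by rewrite mulrA mulVf ?mul1r // lt0r_neq0.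
Qed.

Lemma affVK q p : q != 0 -> cancel (aff q^-1 (- (q^-1 * p))) (aff q p).
Proof.
move=> q0 x; have := @affK q^-1 (- (q^-1 * p)) (invr_neq0 q0) x.
by rewrite invrK mulrN opprK mulrA divff // mul1r.
Qed.

Lemma reflK : involutive (@reflection R).
Proof. by case=> [[[x y] t]|] //=; rewrite opprK. Qed.

Lemma sumsq_eq0 (z : C) (t : R) : (nsq z + t ^+ 2 == 0) = (z == 0) && (t == 0).
Proof. by rewrite paddr_eq0 ?nsq_ge0 ?sqr_ge0 // nsq_eq0 sqrf_eq0. Qed.

Lemma nsqC (a : R) : nsq a%:C = a ^+ 2.
Proof. by rewrite /nsq /=; ring. Qed.

Lemma invsK : involutive invs.
Proof.
case=> [[z t]|] /=; last by rewrite /nsq /= !expr0n /= !addr0 eqxx.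
have [/eqP|h] := ifPn; first by move/eqP; rewrite sumsq_eq0 => /andP[/eqP -> /eqP ->].
rewrite /= nsqM nsqC; set N := nsq z + t ^+ 2 in h *.
have E : N^-1 ^+ 2 * nsq z + (t / N) ^+ 2 = N^-1.
  rewrite -[RHS]mul1r -(divff h) {3}/N; field.
  exact: h.
rewrite E invr_eq0 (negPf h) invrK; congr (Some (_, _)).
  by rewrite mulrA -rmorphM /= divff // mul1r.
by rewrite divfK.
Qed.

Lemma iso_inv b f : iso b f ->
  exists g, [/\ iso b g, cancel f g & cancel g f].
Proof.
elim=> {b f} [q p q0|||b c f g _ [f' [f1 f2 f3]] _ [g' [g1 g2 g3]]].
- exists (aff q^-1 (- (q^-1 * p))); split; [|exact: affK|exact: affVK].
  by apply: iso_aff; rewrite invr_neq0.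
- by exists (@reflection R); split; [exact: iso_refl|exact: reflK|exact: reflK].
- by exists invs; split; [exact: iso_invs|exact: invsK|exact: invsK].
- exists (g' \o f'); split; last 2 first.
  + exact: can_comp.
  + exact: can_comp.
  by rewrite eq_sym; apply: iso_comp.
Qed.

Lemma affid : aff 1 0 = id.
Proof. by apply/funext => -[[z t]|] //=; rewrite !mul1r addr0 expr1n expr0n addr0 sqrtr1 mul1r. Qed.

Lemma iso_id : iso true (@id (mpoint R)).
Proof. by rewrite -affid; apply: iso_aff; rewrite oner_neq0. Qed.

Lemma complex_conj_nsq (z : C) : z * conjc z = (nsq z)%:C.
Proof. by case: z => x y; apply: complexE2; rewrite /nsq /=; ring. Qed.

Lemma hyp_op_isometry_iso f : hyp_op_isometry f -> iso true f.
Proof.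
case=> A detA ->.
have dE : A 0 0 * A 1 1 - A 0 1 * A 1 0 = 1.
  rewrite -detA (expand_det_row _ 0) big_ord_recl big_ord1 /cofactor !det_mx11 !mxE /=.
  rewrite !expr0 expr1 mul1r mulN1r mulrN.
  by congr (A _ _ * A _ _ - A _ _ * A _ _); apply: val_inj.
set a := A 0 0 in dE *; set b := A 0 1 in dE *.
set c := A 1 0 in dE *; set d := A 1 1 in dE *.
have [c0|c0] := eqVneq c 0.
  rewrite c0 mulr0 subr0 in dE.
  have a0 : a != 0 by apply/eqP => a0; move: dE; rewrite a0 mul0r => /esym/eqP; rewrite oner_eq0.
  have dV : d = a^-1 by rewrite -[RHS]mulr1 -dE mulKf.
  suff -> : poincare A = aff (a ^+ 2) (a * b).
    by apply: iso_aff; rewrite expf_neq0.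
  apply/funext => -[[z t]|]; rewrite /poincare -/a -/b -/c -/d /aff; last by rewrite c0 eqxx.
  rewrite c0 mul0r add0r dV !normc_sqr nsqV conjc0 mulr0 mul0r addr0.
  have -> : nsq 0 = 0 by rewrite /nsq /= expr0n addr0.
  have n0 : (nsq a)^-1 != 0 by rewrite invr_eq0 nsq_eq0.
  rewrite mul0r addr0 (negPf n0); congr (Some (_, _)).
    have -> : conjc a^-1 = a * ((nsq a)^-1)%:C.
      by rewrite -nsqV -complex_conj_nsq mulVKf.
    have : ((nsq a)^-1)%:C != 0 :> C by rewrite -(rmorph0 (real_complex R)) (inj_eq (@complexI R)).
    by move: ((nsq a)^-1)%:C => K K0; field.
  by rewrite invrK mulrC -normc_sqr !expr2 normcM.
(* This is [(a w + b) / (c w + d) = a / c - 1 / (c ^ 2 (w + d / c))]; inversion followed by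
   reflection is [w] to [1 / w]. *)
suff -> : poincare A =
    aff (- (c ^+ 2)^-1) (a / c) \o (@reflection R \o (invs \o aff 1 (d / c))).
  apply: (@iso_comp true true); last first.
    apply: (@iso_comp false false); first exact: iso_refl.
    apply: (@iso_comp false true); first exact: iso_invs.
    by apply: iso_aff; rewrite oner_neq0.
  by apply: iso_aff; rewrite oppr_eq0 invr_eq0 expf_neq0.
have c2 : normc (- (c ^+ 2)^-1) = (nsq c)^-1.
  by rewrite -mulN1r normcM normcV expr2 normcM -expr2 normc_sqr -[in RHS](mul1r (_^-1)); congr (_ * _); rewrite /= sqrrN expr1n oppr0 expr0n addr0 sqrtr1.
have nc0 : nsq c != 0 by rewrite nsq_eq0.
apply/funext => -[[z t]|]; rewrite /poincare -/a -/b -/c -/d; last first.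
  rewrite (negPf c0) /comp /aff /invs /reflection; congr (Some (_, _)); last by rewrite mulr0.
  by rewrite conjc0 mulr0 add0r.
rewrite /comp /aff normc1 !mul1r !normc_sqr.
have -> : c * z + d = c * (z + d / c) by field.
set w := z + d / c.
rewrite nsqM -mulrDr mulf_eq0 (negPf nc0) /= /invs.
have [//|h] := boolP (nsq w + t ^+ 2 == 0); set N := nsq w + t ^+ 2 in h *.
rewrite /reflection; congr (Some (_, _)); last by rewrite c2; field; rewrite h nc0.
have -> : a * z + b = a * w - c^-1.
  have -> : b = (a * d - 1) / c by rewrite -dE; field.
  by rewrite /w; field.
have N0 : N%:C != 0 :> C by rewrite -(rmorph0 (real_complex R)) (inj_eq (@complexI R)).
have -> : conjc (((N^-1)%:C) * w) = conjc w / N%:C.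
  by rewrite rmorphM mulrC; congr (_ * _); rewrite -fmorphV; exact: conjc_real.
rewrite [in LHS]rmorphM [((nsq c * N)%:C)]rmorphM /= -complex_conj_nsq.
have cc0 : conjc c != 0 by rewrite -nsq_eq0 nsq_conj.
have -> : (t ^+ 2)%:C = N%:C - w * conjc w by rewrite complex_conj_nsq -rmorphB; congr (_%:C); rewrite /N; ring.
by field; rewrite N0 c0 cc0.
Qed.

Lemma hyp_isometry_iso f : hyp_isometry f -> exists b, iso b f.
Proof.
case=> [/hyp_op_isometry_iso|[g /hyp_op_isometry_iso h ->]]; first by exists true.
by exists false; apply: (@iso_comp true false) => //; exact: iso_refl.
Qed.

(** Half-spaces pull back to half-spaces. The factor [k] depends on the point: inversion divides by
    the squared norm, and the value at infinity is scaled differently from the finite ones. *)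
Lemma iso_side b f : iso b f -> forall al be de, 0 < circle_disc al be de ->
  exists al' be' de', 0 < @circle_disc R al' be' de' /\
    forall p, exists2 k, 0 < k & side al be de (f p) = k * side al' be' de' p.
Proof.
elim=> {b f} [q p q0|||b c f g _ IHf _ IHg] al be de.
- have n0 := normc_gt0 q0; have n1 : 0 < nsq q by rewrite nsq_gt0.
  rewrite /circle_disc normc_sqr => h.
  exists (al * nsq q), (conjc q * (al%:C * p + be)), (al * nsq p + 2 * complex.Re (conjc be * p) + de).
  rewrite normc_sqr nsqM nsq_conj; split.
    suff -> : nsq q * nsq (al%:C * p + be) - al * nsq q * (al * nsq p + 2 * complex.Re (conjc be * p) + de) = nsq q * (nsq be - al * de) by rewrite mulr_gt0.
    case: p be {h} => [x y] [u v]; rewrite /nsq /=; ring.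
  case=> [[z t]|] /=; last by exists (nsq q)^-1; rewrite ?invr_gt0 // mulrC mulfK ?lt0r_neq0.
  exists 1 => //; rewrite mul1r !normc_sqr exprMn normc_sqr.
  case: q p z be {h q0 n0 n1} => [q1 q2] [x y] [z1 z2] [u v]; rewrite /nsq /=; ring.
- move=> h; exists al, (conjc be), de; split; first by rewrite /circle_disc normc_sqr nsq_conj -normc_sqr.
  case=> [[z t]|] /=; last by exists 1; rewrite ?mul1r.
  exists 1 => //; rewrite mul1r !normc_sqr.
  case: z be {h} => [x y] [u v]; rewrite /nsq /=; ring.
- move=> h; exists de, be, al; split; first by move: h; rewrite /circle_disc mulrC.
  case=> [[z t]|]; last first.
    exists 1 => //; rewrite mul1r /invs /side normc_sqr mulr0 /nsq /=; ring.
  rewrite /invs /side.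
  case: ifPn => [|N0]; first by rewrite sumsq_eq0 => /andP[/eqP -> /eqP ->]; exists 1 => //; rewrite mul1r normc_sqr mulr0 /nsq /=; ring.
  have Np : 0 < nsq z + t ^+ 2 by rewrite lt_neqAle eq_sym N0 addr_ge0 ?nsq_ge0 ?sqr_ge0.
  exists (nsq z + t ^+ 2)^-1; first by rewrite invr_gt0.
  rewrite !normc_sqr nsqM nsqC.
  case: z be N0 {h Np} => [x y] [u v]; rewrite /nsq /= => N0; field; exact: N0.
- move=> h; have [a1 [b1 [d1 [h1 E1]]]] := IHf _ _ _ h.
  have [a2 [b2 [d2 [h2 E2]]]] := IHg _ _ _ h1.
  exists a2, b2, d2; split=> // p.
  have [k k0 Ek] := E1 (g p); have [l l0 El] := E2 p.
  by exists (k * l); rewrite ?mulr_gt0 //= Ek El mulrA.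
Qed.

Lemma iso_H3 b f : iso b f -> forall p, H3 p -> H3 (f p).
Proof.
elim=> {b f} [q p q0|||b c f g _ IHf _ IHg] x.
- by case=> z [t [t0 ->]]; do 2 eexists; split; last by []; rewrite mulr_gt0 ?normc_gt0.
- by case=> z [t [t0 ->]]; do 2 eexists; split; last by [].
- case=> z [t [t0 ->]] /=; rewrite sumsq_eq0 (gt_eqF t0) andbF.
  do 2 eexists; split; last by [].
  by rewrite divr_gt0 // ltr_wpDl ?nsq_ge0 ?exprn_gt0.
- by move=> /IHg/IHf.
Qed.

Lemma iso_ideal b f : iso b f -> forall p, ideal p -> ideal (f p).
Proof.
elim=> {b f} [q p q0|||b c f g _ IHf _ IHg] x.
- by case=> [->|[z ->]]; [left|right; rewrite /= mulr0; eexists].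
- by case=> [->|[z ->]]; [left|right; eexists].
- case=> [->|[z ->]] /=; first by right; eexists.
  by case: ifP => _; [left|right; rewrite mul0r; eexists].
- by move=> /IHg/IHf.
Qed.

(* cosh of the hyperbolic distance is [1 + hdist p q / 2]. *)
Definition hdist (p q : mpoint R) : R :=
  match p, q with
  | Some (z, t), Some (w, s) => (nsq (z - w) + (t - s) ^+ 2) / (t * s)
  | _, _ => 0
  end.

Lemma iso_hdist b f : iso b f -> forall p q, H3 p -> H3 q ->
  hdist (f p) (f q) = hdist p q.
Proof.
elim=> {b f} [a c a0|||b c f g _ IHf If IHg] p q.
- case=> z [t [t0 ->]] [w [s [s0 ->]]] /=.
  have -> : a * z + c - (a * w + c) = a * (z - w) by ring.
  have h := lt0r_neq0 (normc_gt0 a0).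
  rewrite nsqM -normc_sqr; field.
  by rewrite h !lt0r_neq0.
- case=> z [t [t0 ->]] [w [s [s0 ->]]] /=.
  by rewrite -rmorphB nsq_conj.
- case=> z [t [t0 ->]] [w [s [s0 ->]]] /=.
  rewrite !sumsq_eq0 (gt_eqF t0) (gt_eqF s0) !andbF.
  have h1 : nsq z + t ^+ 2 != 0 by rewrite sumsq_eq0 (gt_eqF t0) andbF.
  have h2 : nsq w + s ^+ 2 != 0 by rewrite sumsq_eq0 (gt_eqF s0) andbF.
  case: z w h1 h2 => [x y] [u v]; rewrite /nsq /= => h1 h2; unfold nsq => /=; field.
  by rewrite h1 h2 !lt0r_neq0.
- by move=> hp hq /=; rewrite IHf ?IHg //; apply: (iso_H3 If).
Qed.

Lemma iso_to_infty v : @ideal R v -> exists2 h, iso true h & h v = None.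
Proof.
case=> [->|[w ->]]; first by exists id => //; exact: iso_id.
exists (invs \o (@reflection R \o aff 1 (- w))).
  apply: (@iso_comp false false); first exact: iso_invs.
  apply: (@iso_comp false true); first exact: iso_refl.
  by apply: iso_aff; rewrite oner_neq0.
by rewrite /= mul1r subrr mulr0 nsq_conj sumsq_eq0 !eqxx.
Qed.

(* [None] is the point at infinity. *)
Definition mob (a b c d : C) (x : option C) : option C :=
  match x with
  | None => if c == 0 then None else Some (a / c)
  | Some z => if c * z + d == 0 then None else Some ((a * z + b) / (c * z + d))
  end.

Definition ip (x : option C) : mpoint R := if x is Some z then Some (z, 0) else None.

Definition oconj (b : bool) (x : option C) : option C :=
  if b then x else omap conjc x.

Lemma mob_comp a b c d a' b' c' d' x : a * d - b * c != 0 -> a' * d' - b' * c' != 0 ->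
  mob a b c d (mob a' b' c' d' x) =
  mob (a * a' + b * c') (a * b' + b * d') (c * a' + d * c') (c * b' + d * d') x.
Proof.
move=> h h'.
case: x => [z|] /=.
  have [e|e] := eqVneq (c' * z + d') 0 => /=.
    have f : a' * z + b' != 0.
      apply: contraNneq h' => f.
      have [c0|c0] := eqVneq c' 0.
        by move: e; rewrite c0 mul0r add0r => ->; rewrite !mulr0 subr0.
      have -> : d' = - (c' * z) by apply/eqP; rewrite -addr_eq0 addrC e.
      have -> : b' = - (a' * z) by apply/eqP; rewrite -addr_eq0 addrC f.
      by apply/eqP; ring.
    have -> : (c * a' + d * c') * z + (c * b' + d * d') = c * (a' * z + b') by rewrite -[RHS]addr0 -(mulr0 d) -e; ring.
    have -> : (a * a' + b * c') * z + (a * b' + b * d') = a * (a' * z + b') by rewrite -[RHS]addr0 -(mulr0 b) -e; ring.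
    rewrite mulf_eq0 (negPf f) orbF; case: ifPn => // c0.
    by congr Some; field; rewrite f c0.
  have -> : c * ((a' * z + b') / (c' * z + d')) + d = ((c * a' + d * c') * z + (c * b' + d * d')) / (c' * z + d') by field.
  rewrite mulf_eq0 invr_eq0 (negPf e) orbF; case: ifPn => // k.
  by congr Some; field; rewrite e k /=.
have [e|e] := eqVneq c' 0 => /=.
  rewrite e !mulr0 !addr0.
  have f : a' != 0 by apply: contraNneq h' => ->; rewrite e mul0r mulr0 subr0.
  rewrite mulf_eq0 (negPf f) orbF; case: ifPn => // c0.
  by congr Some; field; rewrite f c0.
have -> : c * (a' / c') + d = (c * a' + d * c') / c' by field.
rewrite mulf_eq0 invr_eq0 (negPf e) orbF; case: ifPn => // k.
by congr Some; field; rewrite e k.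
Qed.

Lemma conjc_eq0 (z : C) : (conjc z == 0) = (z == 0).
Proof. by rewrite -(nsq_eq0 (conjc z)) nsq_conj nsq_eq0. Qed.

Lemma oconj_mob e a b c d : exists a' b' c' d', 
  (a * d - b * c != 0 -> a' * d' - b' * c' != 0) /\
  forall x, oconj e (mob a b c d x) = mob a' b' c' d' (oconj e x).
Proof.
case: e; first by exists a, b, c, d.
exists (conjc a), (conjc b), (conjc c), (conjc d); split.
  by rewrite -!rmorphM -rmorphB conjc_eq0.
case=> [z|] /=; last by rewrite conjc_eq0; case: ifP => //= _; rewrite rmorphM fmorphV.
by rewrite -!rmorphM -!rmorphD conjc_eq0; case: ifP => //= _; rewrite rmorphM fmorphV.
Qed.

Lemma oconjK e x : oconj e (oconj e x) = x.
Proof. by case: e => //=; case: x => //= z; rewrite conjcK. Qed.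

Lemma oconj_comp e e' x : oconj e (oconj e' x) = oconj (e == e') x.
Proof. by case: e e' => [] [] //; exact: oconjK. Qed.

(** On ideal points every isometry is a fractional linear map, preceded by complex conjugation if it
    reverses orientation. Conjugations are moved to the right by conjugating coefficients. *)
Lemma iso_boundary e f : iso e f -> exists a b c d, a * d - b * c != 0 /\
  forall x, f (ip x) = ip (mob a b c d (oconj e x)).
Proof.
elim=> {e f} [q p q0|||e e' f g _ [a [b [c [d [h E]]]]] _ [a' [b' [c' [d' [h' E']]]]]].
- exists q, p, 0, 1; rewrite mulr1 mulr0 subr0; split=> // -[z|] /=; last by rewrite eqxx.
  by rewrite mul0r add0r oner_eq0 divr1 mulr0.
- exists 1, 0, 0, 1; rewrite mulr1 mulr0 subr0 oner_neq0; split=> // -[z|] /=; last by rewrite eqxx.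
  by rewrite mul0r add0r oner_eq0 divr1 mul1r addr0.
- exists 0, 1, 1, 0; rewrite mulr1 mulr0 sub0r oppr_eq0 oner_neq0; split=> // -[z|] /=; last first.
    by rewrite oner_eq0 mul0r.
  rewrite !mul1r !mul0r !add0r ?addr0 conjc_eq0 expr0n /= addr0 nsq_eq0.
  case: ifPn => // z0; congr (Some (_, _)).
  have n0 : (nsq z)%:C != 0 :> C by rewrite -(rmorph0 (real_complex R)) (inj_eq (@complexI R)) nsq_eq0.
  have -> : conjc z = (nsq z)%:C / z by rewrite -complex_conj_nsq mulrC mulKf.
  by rewrite rmorphV ?unitfE ?nsq_eq0 //=; field; rewrite n0 z0.
- have [a1 [b1 [c1 [d1 [h1 E1]]]]] := oconj_mob e a' b' c' d'.
  exists (a * a1 + b * c1), (a * b1 + b * d1), (c * a1 + d * c1), (c * b1 + d * d1).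
  have k1 := h1 h'; split.
    have -> : (a * a1 + b * c1) * (c * b1 + d * d1) - (a * b1 + b * d1) * (c * a1 + d * c1) = (a * d - b * c) * (a1 * d1 - b1 * c1) by ring.
    by rewrite mulf_neq0.
  by move=> x; rewrite /= E' E E1 mob_comp // oconj_comp.
Qed.

Lemma iso_fix_infty e f : iso e f -> f None = None -> exists q p, q != 0 /\
  forall z, f (Some (z, 0)) = Some (q * (if e then z else conjc z) + p, 0).
Proof.
move=> /iso_boundary[a [b [c [d [h E]]]]] f0.
have := E None; rewrite /= f0; have -> : oconj e None = None by case: e {E}.
rewrite /=; case: ifPn => // /eqP c0 _.
move: h; rewrite c0 mulr0 subr0 mulf_eq0 negb_or => /andP[a0 d0].
exists (a / d), (b / d); rewrite mulf_neq0 ?invr_eq0 //; split=> // z.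
have := E (Some z); rewrite /= => ->.
have -> : oconj e (Some z) = Some (if e then z else conjc z) by case: e {E}.
by rewrite /= c0 mul0r add0r (negPf d0) /=; congr (Some (_, _)); field.
Qed.

(** * Ideal polyhedra *)

Implicit Types V W : set (mpoint R).

Lemma side_None al be de : side al be de None = al :> R. Proof. by []. Qed.

Lemma sideE (al : R) be de z t :
  side al be de (Some (z, t)) = al * (nsq z + t ^+ 2) + 2 * complex.Re (conjc be * z) + de.
Proof. by rewrite /side normc_sqr. Qed.

Lemma discE (al : R) be de : circle_disc al be de = nsq be - al * de.
Proof. by rewrite /circle_disc normc_sqr. Qed.

Lemma hull_image_sub b f V p : iso b f -> ideal_hull V p -> ideal_hull (f @` V) (f p).
Proof.
move=> If [p3 hp]; split; first exact: (iso_H3 If).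
move=> al be de h hV; have [a1 [b1 [d1 [h1 E]]]] := iso_side If h.
have [k k0 ->] := E p; rewrite pmulr_rge0 //; apply: hp => // v Vv.
have [l l0 El] := E v; rewrite -(pmulr_rge0 _ l0) -El; apply: hV.
by exists v.
Qed.

Lemma image_cancel (X Y : Type) (f : X -> Y) (g : Y -> X) (A : set X) :
  cancel f g -> g @` (f @` A) = A.
Proof.
move=> fK; rewrite image_comp; apply/seteqP; split=> [x [y Ay <-]|x Ax].
  by rewrite /= fK.
by exists x => //=; rewrite fK.
Qed.

Lemma hull_image b f V : iso b f -> ideal_hull (f @` V) = f @` ideal_hull V.
Proof.
move=> If; have [g [Ig fK gK]] := iso_inv If.
apply/seteqP; split=> [p hp|_ [p hp <-]]; last exact: (hull_image_sub If).
exists (g p); last exact: gK.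
by have := hull_image_sub Ig hp; rewrite image_cancel.
Qed.

Lemma H3E (z : C) (t : R) : H3 (Some (z, t)) -> 0 < t.
Proof. by case=> z' [t' [t0 E]]; case: E => _ ->. Qed.

Lemma hull_H3 V p : ideal_hull V p -> H3 p. Proof. by case. Qed.

Lemma hull_vertical V w t : V None -> V (Some (w, 0)) -> 0 < t -> ideal_hull V (Some (w, t)).
Proof.
move=> V0 Vw t0; split; first by exists w, t.
move=> al be de h hV; have := hV _ Vw; have := hV _ V0; rewrite side_None !sideE.
move=> al0 k; have := sqr_ge0 t; nra.
Qed.

Lemma hull_ball V r : (forall v, V v -> exists2 z, v = Some (z, 0) & nsq z <= r ^+ 2) ->
  0 < r -> forall z t, ideal_hull V (Some (z, t)) -> nsq z + t ^+ 2 <= r ^+ 2.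
Proof.
move=> h r0 z t [_ /(_ (-1) 0 (r ^+ 2))]; rewrite discE sideE nsqC => /(_ _ _).
rewrite expr0n sub0r mulN1r opprK exprn_gt0 // conjc0 mul0r /= => /(_ isT).
move=> k; have : 0 <= - 1 * (nsq z + t ^+ 2) + 2 * 0 + r ^+ 2.
  apply: k => v /h[w -> hw]; rewrite sideE conjc0 mul0r /=; lra.
lra.
Qed.

End Moebius.

Section Polyhedra.
Variable R : realType.
Local Notation C := R[i].
Implicit Types (V W T : set (mpoint R)) (P F : set (set (mpoint R))).

Definition polyh T V := [/\ V `<=` @ideal R, finite_set V,
  (exists v w, [/\ V v, V w & v <> w]) & T = ideal_hull V].

Lemma iso_bij b f : @iso R b f -> injective f.
Proof. by move=> /iso_inv[g [_ fK _]]; apply: can_inj fK. Qed.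

Lemma polyh_image b f T V : iso b f -> polyh T V -> polyh (f @` T) (f @` V).
Proof.
move=> If [Vi Vf [v [w [Vv Vw vw]]] ->]; split.
- by move=> _ [x Vx <-]; apply: (iso_ideal If); apply: Vi.
- exact: finite_image.
- exists (f v), (f w); split; [by exists v|by exists w|].
  by move/(iso_bij If).
- by rewrite (hull_image _ If).
Qed.

Lemma finite_bound (X : Type) (g : X -> R) (A : set X) : finite_set A ->
  exists2 M, 0 < M & forall x, A x -> g x <= M ^+ 2.
Proof.
(* [Pchoice] gives the bare type the choice structure that the enumeration of a finite set by a
   sequence requires. *)
elim/Pchoice: X => X in g A *.
case/finite_seqP => s ->; elim: s => [|x s [M M0 IH]]; first by exists 1.
exists (M + `|g x| + 1); first by rewrite -addrA ltr_wpDr // addr_ge0.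
have n0 := normr_ge0 (g x); have n1 := ler_norm (g x).
move=> y /=; rewrite inE => /orP[/eqP ->|]; first nra.
move/IH => h; nra.
Qed.

Definition fpart (p : mpoint R) : C := if p is Some (z, _) then z else 0.

(** A vertical half-plane at distance [M] from 0 with any unit normal contains all vertices; the
    four axis directions enclose the hull in a square. *)
Lemma hull_bounded V : V `<=` @ideal R -> finite_set V -> exists M, forall z t,
  ideal_hull V (Some (z, t)) -> nsq z <= M.
Proof.
move=> Vi /(finite_bound (fun p => nsq (fpart p)))[M M0 hM].
exists (2 * M ^+ 2) => z t [_ hz].
have key be : nsq be = 1 -> 0 <= 2 * complex.Re (conjc be * z) + 2 * M.
  move=> be1; have := hz 0 be (2 * M); rewrite discE be1 mul0r subr0 ltr01 sideE mul0r add0r; apply=> //.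
  move=> v Vv; have := hM _ Vv; case: (Vi _ Vv) => [->|[w ->]]; first by [].
  rewrite sideE mul0r add0r {1}/fpart => hw.
  have : complex.Re (conjc be * w) ^+ 2 <= nsq w.
    rewrite -[leRHS]mul1r -be1 -nsq_conj -nsqM /nsq lerDl sqr_ge0 //.
  by move: (complex.Re _) => r hr; nra.
case: z {hz} key => [x y] key.
have {}key (a b : R) : a ^+ 2 + b ^+ 2 = 1 -> 0 <= 2 * (a * x + b * y) + 2 * M.
  move=> ab; have := key (a +i* b); rewrite {1}/nsq => /(_ ab).
  by congr (0 <= _); rewrite /=; ring.
have k1 : 0 <= 2 * (1 * x + 0 * y) + 2 * M by apply: key; ring.
have k2 : 0 <= 2 * (- 1 * x + 0 * y) + 2 * M by apply: key; ring.
have k3 : 0 <= 2 * (0 * x + 1 * y) + 2 * M by apply: key; ring.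
have k4 : 0 <= 2 * (0 * x + - 1 * y) + 2 * M by apply: key; ring.
rewrite /nsq /=; nra.
Qed.

Lemma hull_low V : V `<=` @ideal R -> finite_set V -> ~ V None -> exists M, forall z t,
  ideal_hull V (Some (z, t)) -> t <= M.
Proof.
move=> Vi /(finite_bound (fun p => nsq (fpart p)))[M M0 hM] V0.
exists M => z t hz; have := H3E (hull_H3 hz).
suff : nsq z + t ^+ 2 <= M ^+ 2 by have := nsq_ge0 z; nra.
apply: (hull_ball _ M0 hz) => v Vv.
case: (Vi _ Vv) (hM _ Vv) => [v0|[w ->] /= h]; first by case: V0; rewrite -v0.
by exists w.
Qed.

(** A criterion that mentions [T] only: vertices are the ideal points from which [T] looks unbounded
    in height. It makes the vertex set a function of the tile, which [polyh_inj] records. *)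
Lemma polyh_vertex T V v : polyh T V -> ideal v ->
  V v <-> (forall b h, iso b h -> h v = None -> forall M, exists z t, M < t /\ (h @` T) (Some (z, t))).
Proof.
move=> PT vi; split=> [Vv b h Ih hv M|H].
  have [Vi Vf [w0 [w1 [Vw0 Vw1 w01]]] ->] := PT.
  have [w Vw vw] : exists2 w, V w & v <> w.
    have [e|ne] := pselect (v = w0); last by exists w0.
    by exists w1 => //; rewrite e.
  rewrite -(hull_image _ Ih).
  have [e|[z hw]] := iso_ideal Ih (Vi _ Vw).
    by case: vw; apply: (iso_bij Ih); rewrite hv e.
  exists z, (`|M| + 1); split; first by rewrite (le_lt_trans (ler_norm _)) // ltrDl.
  apply: hull_vertical; [by exists v|by exists w|].
  by rewrite ltr_wpDl.
apply: contrapT => nVv; have [h Ih hv] := iso_to_infty vi.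
have [Wi Wf _ E] := polyh_image Ih PT.
have [|M hM] := hull_low Wi Wf.
  by case=> x Vx hx; apply: nVv; rewrite (_ : v = x) //; apply: (iso_bij Ih); rewrite hv hx.
have [z [t [Mt]]] := H _ _ Ih hv M; rewrite E => /hM.
by rewrite leNgt Mt.
Qed.

Lemma polyh_inj T V W : polyh T V -> polyh T W -> V = W.
Proof.
move=> h1 h2; have [i1 _ _ _] := h1; have [i2 _ _ _] := h2.
apply/seteqP; split=> v Vv.
  by apply/(polyh_vertex h2 (i1 _ Vv))/(polyh_vertex h1 (i1 _ Vv)).
by apply/(polyh_vertex h1 (i2 _ Vv))/(polyh_vertex h2 (i2 _ Vv)).
Qed.

(** The limits for [t] to infinity and to 0 of [side] along a vertical geodesic, taken at explicit
    heights. *)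
Lemma sqr_comb_ge0 (a k : R) : (forall t, 0 < t -> 0 <= a * t ^+ 2 + k) -> 0 <= a /\ 0 <= k.
Proof.
move=> h; have a0 : 0 <= a.
  rewrite leNgt; apply/negP => a0.
  have t1 : 1 <= 1 + `|k| / - a by rewrite lerDl divr_ge0 // oppr_ge0 ltW.
  have := h _ (lt_le_trans ltr01 t1).
  have E : - a * (1 + `|k| / - a) = - a + `|k| by field; rewrite lt_eqF.
  have := ler_norm k; move: E t1; move: (1 + `|k| / - a) => t E t1.
  have n0 := normr_ge0 k; have p1 : 0 <= (- a * t) * (t - 1) by rewrite mulr_ge0 //; lra.
  lra.
split=> //; rewrite leNgt; apply/negP => k0.
have d0 : 0 < a + 1 - k by lra.
(* If [d t = - k] with [d = a + 1 - k], then [a t ^ 2 + k = t (a t - d)], which is negative because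
   [t < 1]. *)
have t0 : 0 < - k / (a + 1 - k) by rewrite divr_gt0 // oppr_gt0.
have := h _ t0; have : - k / (a + 1 - k) < 1 by rewrite ltr_pdivrMr //; lra.
have E : (a + 1 - k) * (- k / (a + 1 - k)) = - k by field; rewrite gt_eqF.
move: E t0; move: (- k / _) => t E t0 t1; nra.
Qed.

(** [T] contains no ideal points, so [v] has to be approached from inside: once [v] is at infinity,
    this is the limit along a vertical geodesic ending at another vertex. *)
Lemma side_hull_vertex T V al be de : polyh T V ->
  (forall p, T p -> 0 <= side al be de p) -> 0 < circle_disc al be de ->
  forall v, V v -> 0 <= side al be de v.
Proof.
move=> PT hT hd v Vv; have [Vi _ _ _] := PT.
have [h Ih hv] := iso_to_infty (Vi _ Vv).
have [g [Ig hK gK]] := iso_inv Ih.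
have [a1 [b1 [d1 [h1 E]]]] := iso_side Ig hd.
have [k k0 Ek] := E None; rewrite -(hK v) hv Ek pmulr_rge0 // side_None.
have [Wi Wf [x [y [Wx Wy xy]]] ET] := polyh_image Ih PT.
have W0 : (h @` V) None by exists v.
have [z Wz] : exists z, (h @` V) (Some (z, 0)).
  case: (Wi _ Wx) => [e|[z e]]; last by exists z; rewrite -e.
  case: (Wi _ Wy) => [e'|[z e']]; last by exists z; rewrite -e'.
  by case: xy; rewrite e e'.
have [] // := @sqr_comb_ge0 a1 (side a1 b1 d1 (Some (z, 0))).
move=> t t0; have [l l0 El] := E (Some (z, t)).
have : 0 <= side al be de (g (Some (z, t))).
  apply: hT; have : (h @` T) (Some (z, t)) by rewrite ET; apply: hull_vertical.
  by case=> p Tp <-; rewrite hK.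
rewrite El pmulr_rge0 // !sideE; congr (0 <= _); ring.
Qed.

(* No supporting plane of [T] passes through [p]. *)
Definition inner T p := T p /\ forall al be de, 0 < circle_disc al be de ->
  (forall q, T q -> 0 <= side al be de q) -> 0 < side al be de p.

Lemma inner_iso b f T p : iso b f -> inner T p -> inner (f @` T) (f p).
Proof.
move=> If [Tp h]; split; first by exists p.
move=> al be de hd hT; have [a1 [b1 [d1 [h1 E]]]] := iso_side If hd.
have [k k0 ->] := E p; rewrite pmulr_rgt0 //; apply: h => // q Tq.
have [l l0 El] := E q; rewrite -(pmulr_rge0 _ l0) -El; apply: hT.
by exists q.
Qed.

Lemma inner_face T1 T2 p : face (T1 `&` T2) T1 -> inner T1 p -> ~ T2 p.
Proof.
move=> [al [be [de [hd hT E]]]] [T1p h] T2p.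
have := h _ _ _ hd hT; have : (T1 `&` T2) p by [].
by rewrite E => -[_ /= ->]; rewrite ltxx.
Qed.

(** [side] at [(z, t)] is the weighted mean of its values at the [w_i] plus [al] times the slack in
    the height condition. That condition says that the point is not below the hemisphere through the
    three vertices. *)
Lemma hull_infty_comb V w1 w2 w3 (a1 a2 a3 : R) t : V None -> V (Some (w1, 0)) -> V (Some (w2, 0)) ->
  V (Some (w3, 0)) -> 0 <= a1 -> 0 <= a2 -> 0 <= a3 -> a1 + a2 + a3 = 1 -> 0 < t ->
  let z := a1%:C * w1 + a2%:C * w2 + a3%:C * w3 in
  a1 * nsq w1 + a2 * nsq w2 + a3 * nsq w3 <= nsq z + t ^+ 2 -> ideal_hull V (Some (z, t)).
Proof.
move=> V0 V1 V2 V3 p1 p2 p3 a123 t0 z ht; split; first by exists z, t.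
move=> al be de hd hV; have := hV _ V0; have := hV _ V1; have := hV _ V2; have := hV _ V3.
rewrite side_None !sideE => h3 h2 h1 h0.
have -> : complex.Re (conjc be * z) = a1 * complex.Re (conjc be * w1) + a2 * complex.Re (conjc be * w2) + a3 * complex.Re (conjc be * w3).
  by rewrite /z; case: w1 w2 w3 be {V1 V2 V3 z ht hd hV h1 h2 h3} => [x1 y1] [x2 y2] [x3 y3] [u v] /=; ring.
have k0 := mulr_ge0 h0; rewrite -subr_ge0 in ht; have := k0 _ ht.
have := mulr_ge0 p1 h1; have := mulr_ge0 p2 h2; have := mulr_ge0 p3 h3.
have -> : a3 = 1 - a1 - a2 by lra.
set A := nsq z + t ^+ 2; move: (nsq w1) (nsq w2) (nsq w3) => n1 n2 n3.
move: (complex.Re _) (complex.Re _) (complex.Re _) => r1 r2 r3; lra.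
Qed.

Definition crossp (u v : C) : R := complex.Re u * complex.Im v - complex.Im u * complex.Re v.

(** If [side] were not positive, each nonnegative term of the same decomposition would vanish. Then
    [al = 0] and an affine function vanishes at three non-collinear points, so [be = 0], against the
    positive discriminant. *)
Lemma hull_infty_inner V w1 w2 w3 (a1 a2 a3 : R) t : V None -> V (Some (w1, 0)) -> V (Some (w2, 0)) ->
  V (Some (w3, 0)) -> 0 < a1 -> 0 < a2 -> 0 < a3 -> a1 + a2 + a3 = 1 -> 0 < t ->
  crossp (w2 - w1) (w3 - w1) != 0 ->
  let z := a1%:C * w1 + a2%:C * w2 + a3%:C * w3 in
  a1 * nsq w1 + a2 * nsq w2 + a3 * nsq w3 < nsq z + t ^+ 2 -> inner (ideal_hull V) (Some (z, t)).
Proof.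
move=> V0 V1 V2 V3 p1 p2 p3 a123 t0 cr z ht; split.
  by apply: hull_infty_comb => //; exact: ltW.
move=> al be de hd hT.
have hv w : V (Some (w, 0)) -> 0 <= al /\ 0 <= side al be de (Some (w, 0)).
  move=> Vw; apply: sqr_comb_ge0 => s s0.
  have := hT _ (hull_vertical V0 Vw s0); rewrite !sideE; congr (0 <= _); ring.
have [h0 h1] := hv _ V1; have [_ h2] := hv _ V2; have [_ h3] := hv _ V3.
rewrite sideE ltNge; apply/negP.
have -> : complex.Re (conjc be * z) = a1 * complex.Re (conjc be * w1) + a2 * complex.Re (conjc be * w2) + a3 * complex.Re (conjc be * w3).
  by rewrite /z; case: w1 w2 w3 be {V1 V2 V3 z ht hd hT hv cr h1 h2 h3} => [x1 y1] [x2 y2] [x3 y3] [u v] /=; ring.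
rewrite !sideE in h1 h2 h3.
set A := nsq z + t ^+ 2; rewrite -/A in ht.
move: (h1) (h2) (h3).
set f1 := _ + de; set f2 := _ + de; set f3 := _ + de => g1 g2 g3 hle.
have E : al * (A - (a1 * nsq w1 + a2 * nsq w2 + a3 * nsq w3)) + a1 * f1 + a2 * f2 + a3 * f3 <= 0.
  apply: le_trans hle; rewrite le_eqVlt; apply/orP; left; apply/eqP.
  have -> : a3 = 1 - a1 - a2 by lra.
  rewrite /f1 /f2 /f3; ring.
have q1 := mulr_ge0 (ltW p1) g1; have q2 := mulr_ge0 (ltW p2) g2; have q3 := mulr_ge0 (ltW p3) g3.
have {}ht : 0 < A - (a1 * nsq w1 + a2 * nsq w2 + a3 * nsq w3) by lra.
have q0 := mulr_ge0 h0 (ltW ht).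
have al0 : al = 0.
  by apply/eqP; rewrite -(mulIr_eq0 _ (mulIf (lt0r_neq0 ht))); apply/eqP; lra.
have e1 : f1 = 0 by apply/eqP; rewrite -(mulrI_eq0 _ (mulfI (lt0r_neq0 p1))); apply/eqP; lra.
have e2 : f2 = 0 by apply/eqP; rewrite -(mulrI_eq0 _ (mulfI (lt0r_neq0 p2))); apply/eqP; lra.
have e3 : f3 = 0 by apply/eqP; rewrite -(mulrI_eq0 _ (mulfI (lt0r_neq0 p3))); apply/eqP; lra.
move: hd e1 e2 e3 cr; rewrite discE /f1 /f2 /f3 al0 !mul0r !add0r subr0.
case: w1 w2 w3 be {V1 V2 V3 z ht hT hv h1 h2 h3 A f1 f2 f3 g1 g2 g3 hle E q0 q1 q2 q3} => [x1 y1] [x2 y2] [x3 y3] [u v].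
rewrite /crossp /nsq /= => hd e1 e2 e3 /eqP; apply.
have c1 : u * (x2 - x1) + v * (y2 - y1) = 0 by lra.
have c2 : u * (x3 - x1) + v * (y3 - y1) = 0 by lra.
set D := (X in X = 0).
have cu : u * D = 0 by rewrite /D; transitivity ((u * (x2 - x1) + v * (y2 - y1)) * (y3 - y1) - (u * (x3 - x1) + v * (y3 - y1)) * (y2 - y1)); [ring|rewrite c1 c2; ring].
have cv : v * D = 0 by rewrite /D; transitivity ((u * (x3 - x1) + v * (y3 - y1)) * (x2 - x1) - (u * (x2 - x1) + v * (y2 - y1)) * (x3 - x1)); [ring|rewrite c1 c2; ring].
move/eqP: cu; rewrite mulf_eq0 => /orP[/eqP u0|/eqP //].
move/eqP: cv; rewrite mulf_eq0 => /orP[/eqP v0|/eqP //].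
by move: hd; rewrite u0 v0; lra.
Qed.

End Polyhedra.

(** * Invariant tilings *)

Section Systems.
Variable R : realType.
Local Notation C := R[i].
Implicit Types (V W T : set (mpoint R)) (P F : set (set (mpoint R))).
Implicit Types G : set (mpoint R -> mpoint R).

Definition tetV : set (mpoint R) := [set Some (0, 0); Some (1, 0); None; Some (omega R, 0)].
Definition octV : set (mpoint R) :=
  [set Some (0, 0); Some (1, 0); None; Some (1 +i* 1, 0); Some (0 +i* 1, 0); Some (2^-1 +i* 2^-1, 0)].

Definition regular T := exists b g, iso b g /\
  (T = g @` @standard_tetrahedron R \/ T = g @` @standard_octahedron R).

Lemma polyh_tet : polyh (@standard_tetrahedron R) tetV.
Proof.
split=> //.
- move=> v [[[->|->]|->]|->]; try (by left); by right; eexists.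
- by rewrite /tetV !finite_setU; do !split; exact: finite_set1.
- exists None, (Some (0, 0)); split; [by left; right|by left; left; left|by []].
Qed.

Lemma polyh_oct : polyh (@standard_octahedron R) octV.
Proof.
split=> //.
- move=> v [[[[[->|->]|->]|->]|->]|->]; try (by left); by right; eexists.
- by rewrite /octV !finite_setU; do !split; exact: finite_set1.
- exists None, (Some (0, 0)); split; [by left; left; left; right| |by []].
  by left; left; left; left; left.
Qed.

Lemma regular_polyh T : regular T -> exists V, polyh T V.
Proof.
case=> b [g [Ig [->|->]]]; eexists; first exact: (polyh_image Ig polyh_tet).
exact: (polyh_image Ig polyh_oct).
Qed.

(** The properties of a group with invariant tiling that survive conjugation. Local finiteness is
    stated with hyperbolic balls, because [hdist] is invariant whereas compact sets of coordinates
    would have to be transported. *)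
Record tsys G P : Prop := Tsys {
  ts_group : transformation_group G;
  ts_iso : forall f, G f -> iso true f;
  ts_tile : forall T, P T -> regular T;
  ts_cover : forall p, H3 p -> exists2 T, P T & T p;
  ts_lf : forall q M, H3 q ->
    finite_set [set T | P T /\ exists2 p, T p & hdist p q <= M];
  ts_face : forall T1 T2, P T1 -> P T2 -> T1 <> T2 ->
    face (T1 `&` T2) T1 /\ face (T1 `&` T2) T2;
  ts_inv : invariant_tiling G P }.

Definition cofinite G P := exists F, [/\ finite_set F, F `<=` P &
  forall T, P T -> exists2 f, G f & F (f @` T)].

Lemma inner_eq G P T1 T2 p : tsys G P -> P T1 -> P T2 -> inner T1 p -> T2 p -> T1 = T2.
Proof.
move=> sys P1 P2 h1 h2; apply: contrapT => ne.
by have [/inner_face/(_ h1)] := ts_face sys P1 P2 ne.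
Qed.

Lemma face_iso b f A T : iso b f -> face A T -> face (f @` A) (f @` T).
Proof.
move=> If [al [be [de [hd hT EA]]]].
have [g [Ig fK gK]] := iso_inv If.
have [a1 [b1 [d1 [h1 E]]]] := iso_side Ig hd.
exists a1, b1, d1; split=> //.
  by move=> _ [p Tp <-]; have [k k0 Ek] := E (f p); rewrite -(pmulr_rge0 _ k0) -Ek fK; apply: hT.
rewrite EA; apply/seteqP; split=> [_ [p [Tp /= p0] <-]|_ [[p Tp <-] /= p0]].
  split; first by exists p.
  by have [k k0] := E (f p); rewrite fK p0 /= => /esym/eqP; rewrite mulf_eq0 (gt_eqF k0) => /eqP.
exists p => //; split=> //=.
by have [k k0] := E (f p); rewrite fK p0 mulr0.
Qed.

Lemma image_setI_inj (X Y : Type) (f : X -> Y) (A B : set X) : injective f ->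
  f @` (A `&` B) = f @` A `&` f @` B.
Proof.
move=> fI; apply/seteqP; split=> [_ [x [Ax Bx] <-]|_ [[x Ax <-] [y By] /fI e]].
  by split; exists x.
by exists x => //; split=> //; rewrite -e.
Qed.

Lemma conj_group b h G : iso b h -> transformation_group G -> transformation_group (conjugate_by h G).
Proof.
move=> Ih [G1 G2 G3]; split; first by exists id.
- move=> f g [f' Gf' Ef] [g' Gg' Eg]; exists (f' \o g'); first exact: G2.
  by rewrite -compA Eg compA Ef.
- move=> f [f' Gf' Ef]; have [k [Ik hK kK]] := iso_inv Ih.
  have [g' Gg' [K1 K2]] := G3 _ Gf'.
  have fE x : f x = h (f' (k x)) by rewrite -[x in LHS]kK -[f _]/((f \o h) _) Ef.
  exists (h \o g' \o k); last by split=> x /=; rewrite ?fE ?hK ?K1 ?K2 ?kK // fE hK K2.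
  by exists g' => //; apply/funext => x /=; rewrite hK.
Qed.

Lemma conj_elt b h G f : iso b h -> G f -> exists2 k, conjugate_by h G k & forall x, k (h x) = h (f x).
Proof.
move=> Ih Gf; have [k [Ik hK kK]] := iso_inv Ih.
exists (h \o f \o k) => [|x /=]; last by rewrite hK.
by exists f => //; apply/funext => x /=; rewrite hK.
Qed.

Lemma regular_image b h T : iso b h -> regular T -> regular (h @` T).
Proof.
move=> Ih [c [g [Ig E]]]; exists (b == c), (h \o g); split; first exact: iso_comp.
by case: E => ->; [left|right]; rewrite image_comp.
Qed.

Lemma tsys_conj b h G P : iso b h -> tsys G P -> tsys (conjugate_by h G) [set h @` T | T in P].
Proof.
move=> Ih sys; have [k [Ik hK kK]] := iso_inv Ih; split.
- exact: (conj_group Ih (ts_group sys)).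
- move=> f [f' Gf' Ef]; have -> : f = h \o (f' \o k).
    by apply/funext => x /=; rewrite -[x in LHS]kK -[f _]/((f \o h) _) Ef.
  have -> : true = (b == (true == b)) by case: (b).
  by apply: iso_comp => //; apply: iso_comp => //; exact: (ts_iso sys).
- by move=> _ [T PT <-]; apply: (regular_image Ih); exact: (ts_tile sys).
- move=> p p3; have [T PT Tp] := ts_cover sys (iso_H3 Ik p3).
  by exists (h @` T); [exists T|exists (k p)].
- move=> q M q3; apply: sub_finite_set (@finite_image _ _ _ (fun T => h @` T) (ts_lf sys M (iso_H3 Ik q3))).
  move=> _ [[T PT <-] [_ [p Tp <-] hp]]; exists T => //; split=> //.
  exists p => //; have [c [g [Ig E]]] := ts_tile sys PT.
  have p3 : H3 p.
    by case: (regular_polyh (ts_tile sys PT)) Tp => V [_ _ _ ->] /hull_H3.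
  by rewrite -(iso_hdist Ih p3 (iso_H3 Ik q3)) kK.
- move=> _ _ [T1 P1 <-] [T2 P2 <-] ne.
  have [|f1 f2] := ts_face sys P1 P2; first by move=> e; apply: ne; rewrite e.
  rewrite -(image_setI_inj _ _ (iso_bij Ih)).
  by split; apply: (face_iso Ih).
- move=> f _ [f' Gf' Ef] [T PT <-]; exists (f' @` T); first exact: (ts_inv sys).
  by rewrite !image_comp Ef.
Qed.

Lemma cofinite_conj b h G P : iso b h -> cofinite G P -> cofinite (conjugate_by h G) [set h @` T | T in P].
Proof.
move=> Ih [F [Ff FP h1]]; exists [set h @` T | T in F]; split; first exact: finite_image.
  by move=> _ [T FT <-]; exists T => //; exact: FP.
move=> _ [T PT <-]; have [f Gf FT] := h1 _ PT; have [k Gk E] := conj_elt Ih Gf.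
exists k => //; exists (f @` T) => //; rewrite !image_comp; congr (_ @` _).
by apply/funext => x /=; rewrite E.
Qed.

Lemma finite_max (A : set C) : finite_set A -> A !=set0 ->
  exists2 w, A w & forall z, A z -> complex.Re z <= complex.Re w.
Proof.
case/finite_seqP => s ->; elim: s => [|x s IH] [w0 /= hw0]; first by [].
have [[y ys]|ns] := pselect ([set` s] !=set0); last first.
  exists x => [/=|z /=]; first by rewrite inE eqxx.
  by rewrite inE => /orP[/eqP -> //|zs]; case: ns; exists z.
have [|w ws hw] := IH; first by exists y.
have [xw|wx] := lerP (complex.Re x) (complex.Re w).
  exists w => [/=|z /=]; first by rewrite inE orbC; apply/orP; left.
  by rewrite inE => /orP[/eqP -> //|]; exact: hw.
exists x => [/=|z /=]; first by rewrite inE eqxx.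
by rewrite inE => /orP[/eqP -> //|] /hw/le_trans; apply; exact: ltW.
Qed.

(** The pigeonhole principle for a relation, so that no function choosing [y] has to be built. *)
Lemma fiber_infinite (X Y : Type) (A : set X) (B : set Y) (r : X -> Y -> Prop) :
  infinite_set A -> finite_set B -> (forall x, A x -> exists2 y, B y & r x y) ->
  exists2 y, B y & infinite_set [set x | A x /\ r x y].
Proof.
move=> Ai Bf h; apply: contrapT => hn; apply: Ai.
apply: (@sub_finite_set _ _ (\bigcup_(y in B) [set x | A x /\ r x y])).
  by move=> x Ax; have [y By rxy] := h _ Ax; exists y.
apply: bigcup_finite => // y By; apply: contrapT => hy; apply: hn; by exists y.
Qed.

Definition at_infty P T := P T /\ exists2 V, polyh T V & V None.

Lemma real_part_bound V w : V None -> (forall v z, V v -> v = Some (z, 0) -> complex.Re z <= complex.Re w) ->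
  V `<=` @ideal R ->
  forall z t, ideal_hull V (Some (z, t)) -> complex.Re z <= complex.Re w.
Proof.
move=> V0 hV Vi z t [_ /(_ 0 (-1) (2 * complex.Re w))].
rewrite discE nsqN nsq1 mul0r subr0 ltr01 sideE mul0r add0r => /(_ isT) h.
have : 0 <= 2 * complex.Re (conjc (-1) * z) + 2 * complex.Re w.
  apply: h => v Vv; case: (Vi _ Vv) => [->//|[u e]].
  have := hV _ _ Vv e; rewrite e sideE mul0r add0r; case: (u) => x y /=; lra.
case: (z) => x y /=; lra.
Qed.

(* Otherwise let [w] be a rightmost vertex of the finitely many tiles at
   infinity.  A tile containing points just to the right of [(w, 1)] meets one
   of them in a face through [(w, 1)], which must be vertical, so it has a
   vertex at infinity as well. *)
Lemma infinite_at_infty G P : tsys G P -> at_infty P !=set0 -> infinite_set (at_infty P).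
Proof.
move=> sys [T0 [PT0 [V0 PV0 V0n]]] Pf.
pose Wt T : set C := [set w | exists2 V, polyh T V & V (Some (w, 0))].
have Wtf T : at_infty P T -> finite_set (Wt T).
  move=> [_ [V PV _]]; have [_ Vf _ _] := PV.
  apply: sub_finite_set (finite_image (@fpart R) Vf) => w [V' PV' Vw].
  by exists (Some (w, 0)) => //; rewrite (polyh_inj PV PV').
have Wf : finite_set (\bigcup_(T in at_infty P) Wt T) by apply: bigcup_finite.
have [|w [Ts [PTs [Vs PVs Vs0]] [Vs' PVs' Vsw]] wmax] := finite_max Wf.
  have [Vi _ [x [y [Vx Vy xy]]] _] := PV0.
  have [z Vz] : exists z, V0 (Some (z, 0)).
    case: (Vi _ Vx) => [e|[z e]]; last by exists z; rewrite -e.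
    case: (Vi _ Vy) => [e'|[z e']]; last by exists z; rewrite -e'.
    by case: xy; rewrite e e'.
  by exists z; exists T0; [split=> //; exists V0|exists V0].
have {PVs'} Vsw : Vs (Some (w, 0)) by rewrite (polyh_inj PVs PVs').
pose x (n : nat) : mpoint R := Some (w + (n.+1%:R^-1)%:C, 1).
have x3 n : H3 (x n) by do 2 eexists; split; last by [].
have w3 : H3 (Some (w, 1 : R)) by do 2 eexists; split; last by [].
have Tsw : forall t, 0 < t -> Ts (Some (w, t)).
  by move=> t t0; have [_ _ _ ->] := PVs; apply: hull_vertical.
pose B := [set T | P T /\ exists2 p, T p & hdist p (Some (w, 1)) <= 1].
have Bf : finite_set B by apply: (ts_lf sys).
have nat_inf : infinite_set [set: nat] by exact: infinite_nat.
have [n _|T' [PT' _] Tinf] := @fiber_infinite _ _ _ _ (fun n T => T (x n) /\ ~ at_infty P T) nat_inf Bf.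
  have [T PT Tx] := ts_cover sys (x3 n); exists T.
    split=> //; exists (x n) => //.
    rewrite /x /hdist; have -> : w + (n.+1%:R^-1)%:C - w = (n.+1%:R^-1)%:C by ring.
    rewrite nsqC subrr expr0n addr0 mulr1 divr1 exprVn invf_le1 ?exprn_gt0 ?ltr0n //.
    by rewrite -natrX ler1n expn_gt0.
  split=> // aT; have [_ [V PV Vn]] := aT; have [Vi _ _ E] := PV.
  rewrite E in Tx.
  have : complex.Re (w + (n.+1%:R^-1)%:C) <= complex.Re w.
    apply: (real_part_bound Vn _ Vi Tx) => v z Vv e; apply: wmax; exists T => //; exists V => //; by rewrite -e.
  have : 0 < (n.+1%:R^-1 : R) by rewrite invr_gt0 ltr0n.
  by move: (n.+1%:R^-1) => e; case: (w) => a b /=; lra.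
have T'n : ~ at_infty P T'.
  have : [set n | [set: nat] n /\ T' (x n) /\ ~ at_infty P T'] !=set0 by apply: infinite_setN0.
  by case=> n [_ []].
have T'w : T' (Some (w, 1)).
  have [V [Vi Vf V2 E]] := regular_polyh (ts_tile sys PT').
  rewrite E; split=> // al be de hd hV; rewrite leNgt; apply/negP => neg.
  apply: Tinf; set s0 := side al be de (Some (w, 1)) in neg.
  (* If [(w, 1)] were strictly outside a half-space containing [T'], continuity with this explicit
     constant would leave [x n] inside only while [n.+1 <= K / - s0]. *)
  set K := `|2 * al * complex.Re w + 2 * complex.Re be| + `|al| + 1.
  have K0 : 0 < K by rewrite ltr_wpDl // addr_ge0.
  apply: (@sub_finite_set _ _ `I_(Num.truncn (K / - s0)).+1); last exact: finite_II.
  move=> n [_ [T'x _]] /=; rewrite ltnS.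
  move: T'x; rewrite E => -[_ /(_ _ _ _ hd hV)].
  set e := (n.+1%:R^-1 : R).
  have e0 : 0 < e by rewrite invr_gt0 ltr0n.
  have e1 : e <= 1 by rewrite invf_le1 ?ltr0n // ler1n.
  have -> : side al be de (x n) = s0 + e * (2 * al * complex.Re w + 2 * complex.Re be) + al * e ^+ 2.
    rewrite /s0 /x !sideE -/e; case: (w) (be) => [a b] [u v]; rewrite /nsq /=; ring.
  move=> hs; have hK : - s0 <= K * e.
    rewrite /K; move: hs; move: (2 * al * _ + _) => l hs.
    have p1 : 0 <= e * (`|l| - l) by rewrite mulr_ge0 ?(ltW e0) // subr_ge0 ler_norm.
    have p2 : 0 <= e ^+ 2 * (`|al| - al) by rewrite mulr_ge0 ?sqr_ge0 // subr_ge0 ler_norm.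
    have p3 : 0 <= `|al| * (e * (1 - e)) by rewrite !mulr_ge0 ?(ltW e0) // subr_ge0.
    move: (`|l|) (`|al|) p1 p2 p3 => L A p1 p2 p3; lra.
  have : n.+1%:R <= K / - s0.
    rewrite ler_pdivlMr ?oppr_gt0 // -(ler_pM2r e0) mulrAC /e divff ?pnatr_eq0 // mul1r //.
  by move=> hn; apply: ltnW; rewrite truncn_gt_nat.
have ne : Ts <> T' by move=> e; apply: T'n; rewrite -e; split=> //; exists Vs.
have [[al [be [de [hd hT E]]]] _] := ts_face sys PTs PT' ne.
have w1 : side al be de (Some (w, 1)) = 0.
  have : (Ts `&` T') (Some (w, 1)) by split=> //; apply: Tsw.
  by rewrite E => -[].
rewrite sideE in w1.
have [al0 k0] : 0 <= al /\ 0 <= side al be de (Some (w, 0)).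
  apply: sqr_comb_ge0 => t t0; have := hT _ (Tsw _ t0); rewrite !sideE; congr (0 <= _); ring.
rewrite sideE in k0.
(* The side function vanishes at height 1 over [w], so its value at height 0 is [- al]; both signs
   of [al] are excluded and the common face lies in a vertical plane. *)
have {}al0 : al = 0 by nra.
apply: T'n; split=> //; have [V PV] := regular_polyh (ts_tile sys PT'); exists V => //.
apply: contrapT => Vn; have [Vi Vf _ EV] := PV.
have [M hM] := hull_low Vi Vf Vn.
have t0 : 0 < `|M| + 1 by rewrite ltr_wpDl.
have : (Ts `&` T') (Some (w, `|M| + 1)).
  rewrite E; split; first exact: Tsw.
  by rewrite /mkset sideE; move: w1; rewrite al0 !mul0r.
case=> _; rewrite EV => /hM; have := ler_norm M; lra.
Qed.

End Systems.

(** * Vertices of tiles are cusps *)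

Section Cusps.
Variable R : realType.
Local Notation C := R[i].
Implicit Types (V W T : set (mpoint R)) (P F : set (set (mpoint R))).
Implicit Types G : set (mpoint R -> mpoint R).

Lemma group_comp G f g : transformation_group G -> G f -> G g -> G (f \o g).
Proof. by case=> _ h _; exact: h. Qed.

Lemma group_inv G f : transformation_group G -> G f -> exists2 g, G g & cancel f g /\ cancel g f.
Proof. by case=> _ _; exact. Qed.

Lemma group_iter G f n : transformation_group G -> G f -> G (iter n f).
Proof.
move=> Gg Gf; elim: n => [|n IH]; first by case: Gg.
exact: (group_comp Gg Gf IH).
Qed.

Lemma hull_line (w z : C) (t : R) : ideal_hull [set None; Some (w, 0)] (Some (z, t)) -> z = w.
Proof.
move=> [_ /(_ 0 (w - z) (- 2 * complex.Re (conjc (w - z) * w)))].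
rewrite discE mul0r subr0 nsq_gt0 sideE mul0r add0r => h.
apply/eqP; rewrite eq_sym -subr_eq0; apply/negPn/negP => ne.
have := nsq_gt0 (w - z); rewrite ne => n0.
have : 0 <= 2 * complex.Re (conjc (w - z) * z) + - 2 * complex.Re (conjc (w - z) * w).
  by apply: h => // v [->|->] //; rewrite sideE mul0r add0r; lra.
have -> : 2 * complex.Re (conjc (w - z) * z) + - 2 * complex.Re (conjc (w - z) * w) = - 2 * nsq (w - z).
  by case: (w) (z) => [a b] [x y]; rewrite /nsq /=; ring.
lra.
Qed.

(** [iso_boundary] describes [f] on ideal points only; the interior is recovered from hulls, here of
    the two ends of a vertical geodesic. *)
Lemma fix_infty_vertical b (f : mpoint R -> mpoint R) z t w : iso b f -> f None = None -> f (Some (z, 0)) = Some (w, 0) ->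
  0 < t -> exists2 s, 0 < s & f (Some (z, t)) = Some (w, s).
Proof.
move=> If f0 fz t0.
have : ideal_hull (f @` [set None; Some (z, 0)]) (f (Some (z, t))).
  by apply: (hull_image_sub If); apply: hull_vertical => //; [left|right].
rewrite image_setU !image_set1 f0 fz => h.
have [z' [s [s0 e]]] := hull_H3 h.
by rewrite e in h *; exists s => //; rewrite (hull_line h).
Qed.

(** [(z, t)] is the top of the geodesic from [z - t] to [z + t]. Its image is on the vertical line
    over [z + c] and on both sides of the hemisphere of radius [t] there, hence at height [t]. *)
Lemma translation_height b (f : mpoint R -> mpoint R) c : iso b f -> f None = None ->
  (forall z, f (Some (z, 0)) = Some (z + c, 0)) -> forall z t, 0 < t -> f (Some (z, t)) = Some (z + c, t).
Proof.
move=> If f0 fz z t t0; have [s s0 e] := fix_infty_vertical If f0 (fz z) t0.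
rewrite e; congr (Some (_, _)).
have : ideal_hull (f @` [set Some (z - t%:C, 0); Some (z + t%:C, 0)]) (f (Some (z, t))).
  apply: (hull_image_sub If); split; first by exists z, t.
  move=> al be de hd hV.
  have := hV _ (or_introl erefl); have := hV _ (or_intror erefl); rewrite !sideE.
  case: (z) (be) => [x y] [u v]; rewrite /nsq /=; lra.
rewrite image_setU !image_set1 !fz e => -[_ h].
set z' := z + c in h *.
have d0 : 0 < t ^+ 2 by rewrite exprn_gt0.
have h1 := h (-1) z' (t ^+ 2 - nsq z'); have h2 := h 1 (- z') (nsq z' - t ^+ 2).
have {}h1 : 0 <= t ^+ 2 - s ^+ 2.
  have : 0 <= side (-1) z' (t ^+ 2 - nsq z') (Some (z', s)).
    apply: h1; first by rewrite discE; lra.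
    by rewrite /z' => v [->|->]; rewrite sideE; case: (z) (c) => [x y] [u v']; rewrite /nsq /=; lra.
  by rewrite sideE; case: (z') => [x y]; rewrite /nsq /=; lra.
have {}h2 : 0 <= s ^+ 2 - t ^+ 2.
  have : 0 <= side 1 (- z') (nsq z' - t ^+ 2) (Some (z', s)).
    apply: h2; first by rewrite discE nsqN; lra.
    by rewrite /z' => v [->|->]; rewrite sideE; case: (z) (c) => [x y] [u v']; rewrite /nsq /=; lra.
  by rewrite sideE; case: (z') => [x y]; rewrite /nsq /=; lra.
by apply/eqP; rewrite -(@eqrXn2 _ 2) ?ltW // eq_le; apply/andP; split; lra.
Qed.

Lemma ball_tiles_finite G P z0 M : tsys G P ->
  finite_set [set T | at_infty P T /\ exists V w, [/\ polyh T V, V (Some (w, 0)) & nsq (w - z0) <= M]].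
Proof.
move=> sys; apply: sub_finite_set (@ts_lf _ _ _ sys (Some (z0, 1)) M _); last by do 2 eexists; split; last by [].
move=> T [[PT [V PV V0]] [V' [w [PV' Vw hw]]]]; split=> //; exists (Some (w, 1)).
  by have [_ _ _ ->] := PV'; apply: hull_vertical; rewrite // (polyh_inj PV' PV).
by rewrite /hdist subrr expr0n addr0 mulr1 divr1.
Qed.

Lemma ball_vertices_finite G P z0 M : tsys G P ->
  finite_set [set w | exists T V, [/\ at_infty P T, polyh T V, V (Some (w, 0)) & nsq (w - z0) <= M]].
Proof.
move=> sys; set B := [set T | at_infty P T /\ exists V w, [/\ polyh T V, V (Some (w, 0)) & nsq (w - z0) <= M]].
have Bf : finite_set B by exact: (ball_tiles_finite z0 M sys).
apply: (@sub_finite_set _ _ (\bigcup_(T in B) [set w | exists2 V, polyh T V & V (Some (w, 0))])).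
  by move=> w [T [V [aT PV Vw hw]]]; exists T; [split=> //; exists V, w|exists V].
apply: bigcup_finite => // T [_ [V [w [PV _ _]]]]; have [_ Vf _ _] := PV.
apply: sub_finite_set (finite_image (@fpart R) Vf) => u [V' PV' Vu].
by exists (Some (u, 0)) => //; rewrite (polyh_inj PV PV').
Qed.

Lemma at_infty_image G P T f : tsys G P -> G f -> f None = None -> at_infty P T -> at_infty P (f @` T).
Proof.
move=> sys Gf f0 [PT [V PV V0]]; split; first exact: (ts_inv sys).
by exists (f @` V); [exact: (polyh_image (ts_iso sys Gf))|exists None].
Qed.

Lemma at_infty_vertex G P (z : C) : tsys G P -> at_infty P !=set0 ->
  exists T V w, [/\ at_infty P T, polyh T V, V (Some (w, 0)) & w != z].
Proof.
move=> sys n0; apply: contrapT => hn; apply: (infinite_at_infty sys n0).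
apply: (@sub_finite_set _ _ [set ideal_hull [set None; Some (z, 0)]]); last exact: finite_set1.
move=> T aT; have [PT [V PV V0]] := aT; have [Vi _ [u [v [Vu Vv uv]]] ->] := PV.
have hV x : V x -> x = None \/ x = Some (z, 0).
  move=> Vx; case: (Vi _ Vx) => [->|[w e]]; [by left|right].
  rewrite e; have [->//|wz] := eqVneq w z.
  by case: hn; exists T, V, w; split=> //; rewrite -e.
rewrite /set1 /=; congr ideal_hull; apply/seteqP; split=> [x /hV[]->|x [->|->]] //; [by left|by right|].
by have [e|<-//] := hV _ Vu; have [e'|<-//] := hV _ Vv; case: uv; rewrite e e'.
Qed.

(** The powers of a contraction would carry a vertex different from its fixed point [p / (1 - q)] to
    infinitely many vertices in a bounded region, against local finiteness. *)
Lemma infty_no_contraction G P f q p : tsys G P -> at_infty P !=set0 -> G f -> f None = None ->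
  q != 0 -> (forall z, f (Some (z, 0)) = Some (q * z + p, 0)) -> ~ nsq q < 1.
Proof.
move=> sys n0 Gf f0 q0 fz q1.
have q1n : 1 - q != 0.
  by rewrite subr_eq0; apply: contraTneq q1 => <-; rewrite nsq1 ltxx.
pose zs := p / (1 - q).
have [T [V [w [aT PV Vw wz]]]] := at_infty_vertex zs sys n0.
pose u n := zs + q ^+ n * (w - zs).
have fn n : iter n f (Some (w, 0)) = Some (u n, 0).
  elim: n => [|n IH]; first by rewrite /u expr0 mul1r addrC subrK.
  rewrite iterS IH fz; congr (Some (_, _)); rewrite /u exprS /zs; field; exact: q1n.
have inf_nat := infinite_nat.
have [n _|y _ inf] := @fiber_infinite _ _ _ _ (fun n y => y = u n) inf_nat (ball_vertices_finite zs (nsq (w - zs)) sys).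
  exists (u n) => //; exists (iter n f @` T), (iter n f @` V).
  have Gn := group_iter n (ts_group sys) Gf.
  have fn0 : iter n f None = None by elim: (n) => //= m ->.
  split; first exact: (at_infty_image sys).
  - exact: (polyh_image (ts_iso sys Gn)).
  - by exists (Some (w, 0)).
  - rewrite /u addrC addKr nsqM nsqX; have := nsq_ge0 (w - zs).
    have : nsq q ^+ n <= 1 by rewrite exprn_ile1 ?nsq_ge0 // ltW.
    by move: (nsq q ^+ n) => r; nra.
have [n [_ e]] := infinite_setN0 inf; apply: inf.
apply: (@sub_finite_set _ _ [set n]); last exact: finite_set1.
move=> m [_]; rewrite e => /addrI /mulIf; rewrite subr_eq0 wz => /(_ isT) /(congr1 (@nsq R)).
rewrite !nsqX => /ieexprIn; rewrite nsq_gt0 q0 (lt_eqF q1) => h.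
by rewrite /set1 /= h.
Qed.

Lemma infty_isometric G P f q p : tsys G P -> at_infty P !=set0 -> G f -> f None = None ->
  q != 0 -> (forall z, f (Some (z, 0)) = Some (q * z + p, 0)) -> nsq q = 1.
Proof.
move=> sys n0 Gf f0 q0 fz; apply/eqP; rewrite eq_le !leNgt.
have nq : 0 < nsq q by rewrite nsq_gt0.
apply/andP; split; apply/negP => h; last exact: (infty_no_contraction sys n0 Gf f0 q0 fz).
have [g Gg [fK gK]] := group_inv (ts_group sys) Gf.
apply: (@infty_no_contraction G P g q^-1 (- (q^-1 * p)) sys n0 Gg); rewrite ?invr_neq0 //.
- by rewrite -[in LHS]f0 fK.
- move=> z; apply: (can_inj fK); rewrite gK fz.
  by congr (Some (_, _)); field.
- by rewrite nsqV invf_lt1.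
Qed.

(* Infinitely many elements fix infinity and move one tile to distinct tiles.
   If no commutator of these Euclidean motions is a nontrivial translation, they
   all fix one point, against local finiteness. *)
Lemma translation_at_infty G P : tsys G P -> cofinite G P -> at_infty P !=set0 ->
  exists f b, [/\ G f, f None = None, b != 0 & forall z, f (Some (z, 0)) = Some (z + b, 0)].
Proof.
move=> sys [F [Ff FP hF]] n0; have Gg := ts_group sys.
pose U := \bigcup_(T in F) [set v | exists2 V, polyh T V & V v].
have Uf : finite_set U.
  apply: bigcup_finite => // T /FP/(ts_tile sys)/regular_polyh[V PV].
  have [_ Vf _ _] := PV; apply: sub_finite_set Vf => v [V' PV' V'v].
  by rewrite (polyh_inj PV PV').
have FUf : finite_set (F `*` U) by exact: finite_setX.
have [T aT|[T1 v] /= _ inf] := @fiber_infinite _ _ _ _ (fun T (x : set (mpoint R) * mpoint R) =>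
    exists f, [/\ G f, f @` T = x.1 & f None = x.2]) (infinite_at_infty sys n0) FUf.
  have [PT [V PV V0]] := aT; have [f Gf FT] := hF _ PT.
  exists (f @` T, f None); last by exists f.
  split=> //=; exists (f @` T) => //; exists (f @` V); last by exists None.
  exact: (polyh_image (ts_iso sys Gf)).
set A := [set T | _] in inf.
have [T0 [aT0 [f0 [Gf0 fT0 f0v]]]] := infinite_setN0 inf.
have link T : A T -> exists g q p, [/\ G g, g None = None, q != 0,
    (forall z, g (Some (z, 0)) = Some (q * z + p, 0)) & g @` T0 = T].
  move=> [aT [f [Gf fT fv]]].
  have [f' Gf' [fK fK']] := group_inv Gg Gf.
  have Gg' := group_comp Gg Gf' Gf0; have g0 : (f' \o f0) None = None by rewrite /= f0v -fv fK.
  have [q [p [q0 h]]] := iso_fix_infty (ts_iso sys Gg') g0.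
  exists (f' \o f0), q, p; split=> //.
  by rewrite -image_comp fT0 -fT image_cancel.
have [PT0 [V0 PV0 V0n]] := aT0.
have [Vi _ [a [b [Va Vb ab]]] E0] := PV0.
have [w Vw] : exists w, V0 (Some (w, 0)).
  case: (Vi _ Va) => [e|[z e]]; last by exists z; rewrite -e.
  case: (Vi _ Vb) => [e'|[z e']]; last by exists z; rewrite -e'.
  by case: ab; rewrite e e'.
have [T2 AT2 T20] : exists2 T, A T & T <> T0.
  apply: contrapT => hn; apply: inf; apply: sub_finite_set (finite_set1 T0) => T AT.
  by apply: contrapT => e; apply: hn; exists T.
have [f1 [q1 [p1 [Gf1 f1n q10 f1z f1T]]]] := link _ AT2.
have [q1E|q11] := eqVneq q1 1.
  exists f1, p1; split=> //; last by move=> z; rewrite f1z q1E mul1r.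
  apply/eqP => p0; apply: T20; rewrite -f1T E0 -(hull_image _ (ts_iso sys Gf1)).
  congr ideal_hull; have fE x : V0 x -> f1 x = x.
    by move=> /Vi[->//|[z ->]]; rewrite f1z q1E p0 mul1r addr0.
  apply/seteqP; split=> [_ [x Vx <-]|x Vx]; first by rewrite fE.
  by exists x => //; exact: fE.
have q11' : 1 - q1 != 0 by rewrite subr_eq0 eq_sym.
apply: contrapT => hn; apply: inf.
pose z0 := p1 / (1 - q1).
apply: sub_finite_set (ball_tiles_finite z0 (nsq (w - z0)) sys) => T AT; split; first by case: AT.
have [g [q [p [Gg' gn q0 gz gT]]]] := link _ AT.
exists (g @` V0), (q * w + p); split.
- by rewrite -gT; exact: (polyh_image (ts_iso sys Gg')).
- by exists (Some (w, 0)).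
have [k Gk [k1 k2]] := group_inv Gg (group_comp Gg Gg' Gf1).
(* The commutator of [f1] and [g] translates by this number. If it is zero, [g] fixes the fixed
   point [z0] of [f1]. *)
have hb : q1 * p + p1 - q * p1 - p = 0.
  apply/eqP; apply: contrapT => /negP bn; apply: hn.
  exists (f1 \o g \o k), (q1 * p + p1 - q * p1 - p); split=> //.
  - by apply: group_comp => //; apply: group_comp.
  - by have := k1 None; rewrite /= f1n gn => ->; rewrite gn f1n.
  - move=> y; have -> : Some (y, 0) = (g \o f1) (Some (((y - p) / q - p1) / q1, 0)).
      by rewrite /= f1z gz; congr (Some (_, _)); field; rewrite q0 q10.
    rewrite /= (k1 (Some _)) gz f1z; congr (Some (_, _)); field.
    by rewrite q0 q10.
have -> : q * w + p - z0 = q * (w - z0).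
  have pE : p = (1 - q) * z0.
    have : p * (1 - q1) = (1 - q) * p1 by apply/eqP; rewrite -subr_eq0 -oppr_eq0 -[X in _ == X]hb; apply/eqP; ring.
    by rewrite /z0 mulrA => <-; rewrite mulfK.
  rewrite pE; ring.
by rewrite nsqM (infty_isometric sys n0 Gg' gn q0 gz) mul1r.
Qed.

Lemma parabolic_vertex G P T V v : tsys G P -> cofinite G P -> P T -> polyh T V -> V v ->
  parabolic_fixed_point G v.
Proof.
move=> sys cof PT PV Vv; have [Vi _ _ _] := PV; have vi := Vi _ Vv.
have [h Ih hv] := iso_to_infty vi.
have [|f [b [[f' Gf' Ef] fn b0 fz]]] := translation_at_infty (tsys_conj Ih sys) (cofinite_conj Ih cof).
  exists (h @` T); split; first by exists T.
  by exists (h @` V); [exact: (polyh_image Ih)|exists v].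
have Efx x : f (h x) = h (f' x) by rewrite -[LHS]/((f \o h) x) Ef.
have hI := iso_bij Ih.
have fv : f' v = v by apply: hI; rewrite -Efx hv fn.
have If : iso true f by apply: (ts_iso (tsys_conj Ih sys)); exists f'.
have bz z : z + b <> z by move/eqP; rewrite -subr_eq0 addrC addKr (negPf b0).
split=> //; exists f' => //; split=> //; split.
  move=> p p3 fp; have [z [t [t0 e]]] := iso_H3 Ih p3.
  have := Efx p; rewrite fp e (translation_height If fn fz) // => -[] /bz.
  by [].
exists v; split=> // v' [v'i fv']; apply: hI; rewrite hv.
have := Efx v'; rewrite fv'; case: (iso_ideal Ih v'i) => [->//|[z ->]].
by rewrite fz => -[/bz].
Qed.

End Cusps.

(** * Finiteness of the number of orbits *)

Section Cofinite.
Variable R : realType.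
Local Notation C := R[i].
Implicit Types (V W T : set (mpoint R)) (P F : set (set (mpoint R))).
Implicit Types G : set (mpoint R -> mpoint R).

(* [c] is the centre of a hyperbolic ball of size [e] inside [T]. *)
Definition centred (e : R) T (c : mpoint R) := forall q, H3 q -> hdist q c <= e -> inner T q.

Lemma centred_iso b h e T c : iso b h -> H3 c -> centred e T c -> centred e (h @` T) (h c).
Proof.
move=> Ih c3 hc q q3 hq; have [g [Ig hK gK]] := iso_inv Ih.
rewrite -(gK q); apply: (inner_iso Ih); apply: hc; first exact: (iso_H3 Ig).
by rewrite -(hK c) (iso_hdist Ig) //; exact: (iso_H3 Ih).
Qed.

Lemma centred_inner e T c : 0 < e -> H3 c -> centred e T c -> inner T c.
Proof.
move=> e0 c3; apply=> //; case: c3 => z [t [t0 ->]].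
by rewrite /hdist !subrr expr0n addr0 /nsq /= !expr0n addr0 mul0r ltW.
Qed.

Lemma omegaE : omega R = 2^-1 +i* (Num.sqrt 3 / 2). Proof. by []. Qed.

(** The point over [1 / 2 + i / 5] at height 2 is well inside both standard polyhedra; the bounds
    are a box around it that stays over the triangle and the square and above height 1. *)
Lemma near_std (e x y t : R) : e <= 1 / 1000 -> 0 < t -> hdist (Some (x +i* y, t)) (Some (2^-1 +i* 5^-1, 2)) <= e ->
  [/\ 4 / 10 < x, x < 6 / 10, 1 / 10 < y, y < 3 / 10 & 1 < t ^+ 2].
Proof.
move=> e1 t0; rewrite /hdist /nsq /= ler_pdivrMr ?mulr_gt0 // => h.
have h1 : 0 <= (x - 2^-1) ^+ 2 by rewrite sqr_ge0.
have h2 : 0 <= (y - 5^-1) ^+ 2 by rewrite sqr_ge0.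
have h3 : 0 <= (t - 2) ^+ 2 by rewrite sqr_ge0.
have small (u k : R) : 0 < k -> u ^+ 2 < k ^+ 2 -> - k < u /\ u < k.
  by move=> k0 uk; apply/andP; rewrite -ltr_norml -(@ltr_pXn2r _ 2) ?nnegrE ?(ltW k0) // real_normK ?num_real.
have ht : (x - 2^-1) ^+ 2 + (y - 5^-1) ^+ 2 + (t - 2) ^+ 2 <= t * 2 / 1000
  by have : 0 <= t * (1 / 1000 - e) by [rewrite mulr_ge0 ?subr_ge0 // ltW]; lra.
clear h e e1; have t3 : t < 3.
  rewrite ltNge; apply/negP => t3; have : 0 <= (t - 3) * (t - 2) by rewrite mulr_ge0 //; lra.
  lra.
have [x1 x2] : - (1 / 10) < x - 2^-1 /\ x - 2^-1 < 1 / 10 by apply: small; lra.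
have [y1 y2] : - (1 / 10) < y - 5^-1 /\ y - 5^-1 < 1 / 10 by apply: small; lra.
have [t1 t2] : - (1 / 10) < t - 2 /\ t - 2 < 1 / 10 by apply: small; lra.
clear h1 h2 h3 small ht t3; split; [lra|lra|lra|lra|].
by rewrite exprn_egt1 //; lra.
Qed.

Lemma half_sqrt3 (s := Num.sqrt 3 / 2 : R) : s ^+ 2 = 3 / 4 /\ 8 / 10 < s.
Proof.
have s2 : s ^+ 2 = 3 / 4 by rewrite /s exprMn sqr_sqrtr // exprVn; congr (_ / _); ring.
split=> //; rewrite ltNge; apply/negP => h.
have s0 : 0 <= s by rewrite divr_ge0 // sqrtr_ge0.
have : s ^+ 2 <= (8 / 10) ^+ 2 by rewrite ler_sqr ?nnegrE //; lra.
lra.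
Qed.

Lemma nsq_omega : nsq (omega R) = 1.
Proof. by have [h _] := half_sqrt3; rewrite omegaE /nsq /= h; lra. Qed.

Lemma regular_centre : exists2 e, 0 < e & forall T, regular T -> exists2 c, H3 c & centred e T c.
Proof.
have [e e0 e1] : exists2 e : R, 0 < e & e <= 1 / 1000 by exists (1 / 1000); lra.
exists e => //.
have c3 : @H3 R (Some (2^-1 +i* 5^-1, 2)) by do 2 eexists; split; last by [].
suff [ht ho] : centred e (@standard_tetrahedron R) (Some (2^-1 +i* 5^-1, 2)) /\
               centred e (@standard_octahedron R) (Some (2^-1 +i* 5^-1, 2)).
  move=> T [b [g [Ig [->|->]]]]; exists (g (Some (2^-1 +i* 5^-1, 2)));
    by [exact: (iso_H3 Ig)|apply: (centred_iso Ig)].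
split=> q [[x y] [t [t0 ->]]] /(near_std e1 t0)[x1 x2 y1 y2 t1].
  have [s2 s1] := half_sqrt3; have nO := nsq_omega.
  rewrite omegaE in nO *; move: s2 s1 nO; set s : R := Num.sqrt 3 / 2 => s2 s1 nO.
  have s0 : 0 < s by lra.
  have sn : s != 0 by rewrite gt_eqF.
  (* Barycentric coordinates in the triangle 0, 1, [omega]. Its vertices have norm at most 1, so
     [1 < t ^+ 2] implies the height condition of [hull_infty_inner]. *)
  have E : x +i* y = (1 - x - y / s / 2)%:C * 0 + (x - y / s / 2)%:C * 1 + (y / s)%:C * (2^-1 +i* s).
    by apply: complexE2; rewrite /=; field.
  have ys : y / s < 4 / 10 by rewrite ltr_pdivrMr //; lra.
  have ys0 : 0 < y / s by rewrite divr_gt0 //; lra.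
  rewrite E; apply: hull_infty_inner.
  - by left; right.
  - by left; left; left.
  - by left; left; right.
  - by right.
  - by move: (y / s) ys ys0 => r *; lra.
  - by move: (y / s) ys ys0 => r *; lra.
  - by [].
  - by move: (y / s) => r; lra.
  - by [].
  - by rewrite /crossp /= !subr0 !mul1r mul0r subr0.
  - rewrite -E nO nsq1; have -> : nsq (0 : C) = 0 by rewrite /nsq /= expr0n addr0.
    by have := nsq_ge0 (x +i* y); move: (y / s) ys ys0 (nsq _) => r r1 r2 n n0; lra.
have E : x +i* y = (1 - x - y)%:C * 0 + x%:C * 1 + y%:C * (0 +i* 1).
  by apply: complexE2; rewrite /=; ring.
rewrite E; apply: hull_infty_inner.
- by left; left; left; right.
- by do 5 left.
- by left; left; left; left; right.
- by left; right.
- lra.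
- lra.
- lra.
- ring.
- by [].
- by rewrite /crossp /= !subr0 mulr1 mul0r subr0 oner_eq0.
- rewrite -E nsq1; have -> : nsq (0 : C) = 0 by rewrite /nsq /= expr0n addr0.
  have -> : nsq (0 +i* 1 : C) = 1 by rewrite /nsq /=; ring.
  by have := nsq_ge0 (x +i* y); move: (nsq _) => n n0; lra.
Qed.

(* A translation moving [(z, t)] by a small hyperbolic distance maps the tile
   to itself; but tiles are horizontally bounded. *)
Lemma centre_height_bound G P f b e T z t : tsys G P -> G f -> f None = None -> b != 0 ->
  (forall z, f (Some (z, 0)) = Some (z + b, 0)) -> P T -> 0 < t -> centred e T (Some (z, t)) ->
  0 < e -> e * t ^+ 2 <= nsq b.
Proof.
move=> sys Gf fn b0 fz PT t0 hc e0; rewrite leNgt; apply/negP => hlt.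
have Hf := translation_height (ts_iso sys Gf) fn fz.
have in0 : inner T (Some (z, t)).
  by apply: (centred_inner e0); [do 2 eexists; split; last by []|].
have in1 : inner T (Some (z + b, t)).
  apply: hc; first by do 2 eexists; split; last by [].
  rewrite /hdist (addrC z) addrK subrr expr0n addr0 ler_pdivrMr ?mulr_gt0 // -expr2.
  exact: ltW.
have fT : f @` T = T.
  apply/esym; apply: (inner_eq sys PT (ts_inv sys Gf PT) in1).
  by exists (Some (z, t)); [case: in0|exact: Hf].
have Tn n : T (Some (z + n%:R * b, t)).
  elim: n => [|n IH]; first by rewrite mul0r addr0; case: in0.
  rewrite -fT; exists (Some (z + n%:R * b, t)) => //; rewrite Hf //; congr (Some (_, _)).
  by rewrite -[n.+1]addn1 natrD mulrDl mul1r addrA.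
have [V [Vi Vf _ EV]] := regular_polyh (ts_tile sys PT).
have [M hM] := hull_bounded Vi Vf.
have nb : 0 < nsq b by rewrite nsq_gt0.
pose X := (2 * M + 2 * nsq z) / nsq b.
have key n : n%:R ^+ 2 <= X :> R.
  rewrite ler_pdivlMr //; have := Tn n; rewrite EV => /hM.
  have -> : (n%:R : C) = (n%:R : R)%:C by rewrite rmorph_nat.
  move: (n%:R : R) => m; case: (z) (b) => [x y] [u v]; rewrite /nsq /=.
  have := sqr_ge0 (2 * x + m * u); have := sqr_ge0 (2 * y + m * v); lra.
have := key (Num.truncn X).+1; have := truncnS_gt X.
have : (1 : R) <= (Num.truncn X).+1%:R by rewrite ler1n.
move: ((Num.truncn X).+1%:R : R) => m h1 h2; nra.
Qed.

(** Finiteness of orbits on [P'] supplies an element of [G] acting as a translation once [v] is at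
    infinity. Since [G] also preserves [P], that translation bounds the heights of centres of tiles
    of [P]. *)
Lemma vertex_height_bound G P P' e T' V' v h b : tsys G P -> tsys G P' -> cofinite G P' -> 0 < e ->
  P' T' -> polyh T' V' -> V' v -> iso b h -> h v = None ->
  exists M, forall T c z t, P T -> H3 c -> centred e T c -> h c = Some (z, t) -> t <= M.
Proof.
move=> sys sys' cof' e0 PT' PV' V'v Ih hv.
have sysh := tsys_conj Ih sys.
have [|f [c [Gf fn c0 fz]]] := translation_at_infty (tsys_conj Ih sys') (cofinite_conj Ih cof').
  exists (h @` T'); split; first by exists T'.
  by exists (h @` V'); [exact: (polyh_image Ih)|exists v].
exists (nsq c / e + 1) => T p z t PT p3 hp hz.
have t0 : 0 < t by apply: (@H3E _ z); rewrite -hz; exact: (iso_H3 Ih).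
have := @centre_height_bound _ _ _ _ _ _ z t sysh Gf fn c0 fz (_ : [set h @` T | T in P] (h @` T)) t0.
move=> /(_ e); rewrite -hz => H.
have {}H : e * t ^+ 2 <= nsq c by apply: H => //; [exists T|exact: (centred_iso Ih)].
have {}H : t ^+ 2 <= nsq c / e by rewrite ler_pdivlMr // mulrC.
nra.
Qed.

(** Otherwise the outside of the hemisphere of squared radius [2 * t ^+ 2] around [z] would contain
    all vertices but not [(z, t)]. *)
Lemma hull_near_vertex V z t : V `<=` @ideal R -> V None -> ideal_hull V (Some (z, t)) ->
  exists2 w, V (Some (w, 0)) & nsq (w - z) <= 2 * t ^+ 2.
Proof.
move=> Vi V0 [/H3E t0 h]; apply: contrapT => hn.
have d0 : 0 < t ^+ 2 by rewrite exprn_gt0.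
have : 0 <= side 1 (- z) (nsq z - 2 * t ^+ 2) (Some (z, t)).
  apply: h; first by rewrite discE nsqN; lra.
  move=> v Vv; case: (Vi _ Vv) => [->|[w e]]; first by rewrite side_None.
  rewrite e sideE leNgt; apply/negP => k; apply: hn; exists w; first by rewrite -e.
  apply: ltW; move: k; case: (w) (z) => [x y] [u v']; rewrite /nsq /=; lra.
rewrite sideE; case: (z) => x y; rewrite /nsq /=; lra.
Qed.

Lemma finite_unif (X : Type) (A : set X) (Q : X -> R -> Prop) : finite_set A ->
  (forall x M M', Q x M -> M <= M' -> Q x M') ->
  (forall x, A x -> exists M, Q x M) -> exists M, forall x, A x -> Q x M.
Proof.
elim/Pchoice: X => X in A Q *.
case/finite_seqP => s -> mon; elim: s => [|x s IH] h; first by exists 0.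
have [M hM] := h x (mem_head _ _).
have [|N hN] := IH; first by move=> y ys; apply: h; rewrite /= inE orbC (_ : y \in s).
exists (Num.max M N) => y /=; rewrite inE => /orP[/eqP ->|/hN hy].
  by apply: mon hM _; rewrite le_max lexx.
by apply: mon hy _; rewrite le_max lexx orbT.
Qed.

Lemma centres_in_tile_finite G P P' e T' : tsys G P -> tsys G P' -> cofinite G P' -> 0 < e -> P' T' ->
  finite_set [set T | P T /\ exists c, [/\ H3 c, centred e T c & T' c]].
Proof.
move=> sys sys' cof' e0 PT'.
have [V' PV'] := regular_polyh (ts_tile sys' PT'); have [V'i V'f [v0 [v1 [V'v0 V'v1 v01]]] _] := PV'.
have [h Ih hv] := iso_to_infty (V'i _ V'v0).
have [g [Ig hK gK]] := iso_inv Ih.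
have [M0 hM0] := vertex_height_bound sys sys' cof' e0 PT' PV' V'v0 Ih hv.
have PV1 := polyh_image Ih PV'; have [V1i V1f _ E1] := PV1.
have V10 : (h @` V') None by exists v0.
have [M1 hM1] := hull_bounded V1i V1f.
(* [t / (nsq (z - w) + t ^+ 2)] is the height of the centre after an inversion at [w], so this is
   the height bound at every finite vertex, with one constant for all. *)
have [M2 hM2] : exists M, forall v, (h @` V') v -> forall w T c z t, v = Some (w, 0) ->
    P T -> H3 c -> centred e T c -> h c = Some (z, t) -> t <= M * (nsq (z - w) + t ^+ 2).
  apply: (finite_unif V1f).
    move=> v M M' H MM' w T c z t ev PT c3 hc hz; apply: le_trans (H _ _ _ _ _ ev PT c3 hc hz) _.
    by rewrite ler_wpM2r // addr_ge0 ?nsq_ge0 ?sqr_ge0.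
  move=> v V1v; have [u V'u hu] := V1v.
  case: (V1i _ V1v) => [->|[w ev]]; first by exists 0.
  pose k : mpoint R -> mpoint R := @invs R \o aff 1 (- w).
  have Ik : iso (false == true) k by apply: iso_comp; [exact: iso_invs|apply: iso_aff; rewrite oner_neq0].
  have kv : (k \o h) u = None by rewrite /comp hu ev /k /comp /aff mul1r subrr mulr0 /invs sumsq_eq0 !eqxx.
  have [M hM] := vertex_height_bound sys sys' cof' e0 PT' PV' V'u (iso_comp Ik Ih) kv.
  exists M => w' T c z t; rewrite ev => -[<-] PT c3 hc hz.
  have t0 : 0 < t by apply: (@H3E _ z); rewrite -hz; exact: (iso_H3 Ih).
  have n0 : 0 < nsq (z - w) + t ^+ 2 by rewrite ltr_wpDl ?nsq_ge0 // exprn_gt0.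
  have : (k \o h) c = Some (((nsq (z - w) + t ^+ 2)^-1)%:C * (z - w), t / (nsq (z - w) + t ^+ 2)).
    by rewrite /comp hz /k /comp /aff normc1 !mul1r /invs gt_eqF.
  by move/(hM _ _ _ _ PT c3 hc); rewrite ler_pdivrMr.
have q3 : H3 (g (Some (0, 1))) by apply: (iso_H3 Ig); do 2 eexists; split; last by [].
pose K := `|M1| + (`|M0| + 1) ^+ 2.
apply: sub_finite_set (ts_lf sys (K * (3 * `|M2|)) q3) => T [PT [c [c3 hc T'c]]]; split=> //.
exists c; first by have [] := centred_inner e0 c3 hc.
have [z [t [t0 hz]]] := iso_H3 Ih c3.
have h1 := hM0 _ _ _ _ PT c3 hc hz.
have T1c : ideal_hull (h @` V') (Some (z, t)) by rewrite -E1 -hz; exists c.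
have h2 := hM1 _ _ T1c.
have [w Vw hw] := hull_near_vertex V1i V10 T1c.
have h3 := hM2 _ Vw w T c z t erefl PT c3 hc hz.
rewrite -(iso_hdist Ih c3 q3) gK hz /hdist subr0 mulr1 ler_pdivrMr //.
(* At a vertex [w] with [nsq (z - w) <= 2 * t ^+ 2] the bound becomes [t <= M2 * (3 * t ^+ 2)], a
   lower bound for the height; hence the factor 3. *)
have h4 : 1 <= 3 * `|M2| * t.
  rewrite -nsqN opprB in hw; have := ler_norm M2; have := normr_ge0 M2; have := nsq_ge0 (z - w).
  move: (nsq (z - w)) (`|M2|) hw h3 => N m hw h3 N0 m0 mM.
  have : t <= m * (3 * t ^+ 2) by nra.
  by rewrite -[X in X <= _ -> _]mulr1 => h5; rewrite -(ler_pM2l t0) (le_trans h5) // le_eqVlt; apply/orP; left; apply/eqP; ring.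
have h5 : nsq z + (t - 1) ^+ 2 <= K.
  have := ler_norm M1; have := ler_norm M0; rewrite /K; nra.
apply: (le_trans h5); rewrite -mulrA -[leLHS]mulr1 ler_wpM2l //.
by rewrite /K addr_ge0 ?sqr_ge0.
Qed.

(** Each tile of [P] has a centre, which lies in some tile of [P']; moving the latter to a
    representative brings the former into one of finitely many finite sets. *)
Lemma cofinite_transfer G P P' : tsys G P -> tsys G P' -> cofinite G P' -> cofinite G P.
Proof.
move=> sys sys' cof'; have [e e0 hc] := regular_centre.
have [F [Ff FP hF]] := cof'.
exists (\bigcup_(T' in F) [set T | P T /\ exists c, [/\ H3 c, centred e T c & T' c]]); split.
- by apply: bigcup_finite => // T' /FP; exact: (centres_in_tile_finite sys sys').
- by move=> T [T' _ []].
move=> T PT; have [c c3 cc] := hc _ (ts_tile sys PT).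
have [T' PT' T'c] := ts_cover sys' c3; have [f Gf FT'] := hF _ PT'.
exists f => //; exists (f @` T') => //; split; first exact: (ts_inv sys).
exists (f c); split; last by exists c.
  exact: (iso_H3 (ts_iso sys Gf)).
exact: (centred_iso (ts_iso sys Gf)).
Qed.

End Cofinite.

Ltac perm_set := apply/seteqP; split=> ? /=; rewrite /setU /set1 /mkset; tauto.

(** * Tiles with a vertex at infinity *)

Section Identify.
Variable R : realType.
Local Notation C := R[i].
Local Notation w6 := (omega R).
Local Notation I := ('i : C).
Implicit Types (V W T : set (mpoint R)) (P F : set (set (mpoint R))).
Implicit Types G : set (mpoint R -> mpoint R).

(** The ideal tetrahedron with a vertex at infinity over the equilateral triangle to the left of the
    directed edge from [a] to [a + x]. *)
Definition triV (a x : C) : set (mpoint R) :=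
  [set None; Some (a, 0); Some (a + x, 0); Some (a + x * w6, 0)].

(** The ideal octahedron over the square to the left of that edge; the last vertex, at the centre of
    the square, is opposite to infinity. *)
Definition sqV (a x : C) : set (mpoint R) :=
  [set None; Some (a, 0); Some (a + x, 0); Some (a + x + x * I, 0); Some (a + x * I, 0);
       Some (a + x * (2^-1 +i* 2^-1), 0)].

Lemma iE : I = 0 +i* 1. Proof. by []. Qed.

Lemma i_sqr : I * I = - 1.
Proof. by apply: complexE2; rewrite /=; ring. Qed.

Lemma omega_sqr : w6 * w6 = w6 - 1.
Proof.
have [h _] := half_sqrt3 R; move: h; rewrite omegaE; set s := Num.sqrt 3 / 2 => h.
by apply: complexE2; rewrite /= -?expr2 ?h; lra.
Qed.

Lemma omega_neq0 : w6 != 0.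
Proof. by rewrite -nsq_eq0 nsq_omega oner_eq0. Qed.

Lemma complex_neq (u v : C) : complex.Re u != complex.Re v \/ complex.Im u != complex.Im v -> u != v.
Proof. by case=> h; apply: contraNneq h => ->. Qed.

Lemma omega_conj : conjc w6 = 1 - w6.
Proof. by rewrite omegaE; apply: complexE2; rewrite /=; lra. Qed.

Lemma tet_symm v : @tetV R v -> exists b f, [/\ iso b f, f None = v & f @` @tetV R = @tetV R].
Proof.
(* [r] turns the triangle 0, 1, [omega]; [f0] is [z] to [omega / z], which exchanges 0 with infinity
   and 1 with [omega]. *)
pose r := aff (w6 * w6) 1; pose f0 := aff w6 0 \o (@reflection R \o @invs R).
have w0 := omega_neq0.
have Ir : iso true r by apply: iso_aff; rewrite mulf_neq0.
have If0 : iso (true == (false == false)) f0.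
  by apply: iso_comp; [exact: iso_aff|apply: iso_comp; [exact: iso_refl|exact: iso_invs]].
have f0N : f0 None = Some (0, 0) by rewrite /f0 /comp /invs /reflection /aff conjc0 mulr0 addr0 mulr0.
have f00 : f0 (Some (0, 0)) = None by rewrite /f0 /comp /invs sumsq_eq0 !eqxx.
have f01 : f0 (Some (1, 0)) = Some (w6, 0).
  rewrite /f0 /comp /invs nsq1 expr0n addr0 oner_eq0 invr1 mul0r mulr1 /reflection /aff mulr0 addr0.
  by congr (Some (_, _)); rewrite -[RHS]mulr1; congr (_ * _); apply: complexE2; rewrite /=; ring.
have f0w : f0 (Some (w6, 0)) = Some (1, 0).
  rewrite /f0 /comp /invs nsq_omega expr0n addr0 oner_eq0 invr1 mul0r /reflection /aff mulr0 addr0.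
  by rewrite rmorph1 mul1r omega_conj mulrBr mulr1 omega_sqr; congr (Some (_, _)); ring.
have rN : r None = None by [].
have r0 : r (Some (0, 0)) = Some (1, 0) by rewrite /r /aff !mulr0 add0r.
have r1 : r (Some (1, 0)) = Some (w6, 0) by rewrite /r /aff !mulr0 mulr1 omega_sqr subrK.
have rw : r (Some (w6, 0)) = Some (0, 0).
  by rewrite /r /aff mulr0 omega_sqr mulrBl mul1r omega_sqr; congr (Some (_, _)); ring.
have rV : r @` @tetV R = @tetV R.
  by rewrite /tetV !image_setU !image_set1 rN r0 r1 rw; perm_set.
have fV : f0 @` @tetV R = @tetV R.
  by rewrite /tetV !image_setU !image_set1 f0N f00 f01 f0w; perm_set.
case=> [[[->|->]|->]|->].
- by exists true, f0.
- exists (true == true), (r \o f0); split; [exact: iso_comp|by rewrite /comp f0N|].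
  by rewrite -image_comp fV.
- by exists true, id; split=> //; [exact: iso_id|rewrite image_id].
- exists (true == (true == true)), (r \o (r \o f0)); split; last by rewrite -image_comp -[X in r @` X]image_comp fV !rV.
    by apply: iso_comp => //; apply: iso_comp.
  by rewrite /comp f0N r0 r1.
Qed.

Lemma oct_symm v : @octV R v -> exists b f, [/\ iso b f, f None = v & f @` @octV R = @octV R].
Proof.
(* [r] turns the square; [f0] is [z] to [- i / (z - (1 + i))], which fixes 1 and [i] and takes
   infinity to 0, 0 to the centre, the centre to [1 + i] and that to infinity. *)
pose r := aff I 1; pose f0 := aff (- I) 0 \o (@reflection R \o (@invs R \o aff 1 (- (1 +i* 1)))).
have i0 : I != 0 by apply: complex_neq; right; rewrite /= oner_eq0.
have Ir : iso true r by apply: iso_aff.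
have If0 : iso (true == (false == (false == true))) f0.
  apply: iso_comp; first by apply: iso_aff; rewrite oppr_eq0.
  apply: iso_comp; first exact: iso_refl.
  apply: iso_comp; first exact: iso_invs.
  by apply: iso_aff; rewrite oner_neq0.
have f0E z : z != 1 +i* 1 -> f0 (Some (z, 0)) =
    Some (- I * conjc ((nsq (z - (1 +i* 1)))^-1%:C * (z - (1 +i* 1))), 0).
  rewrite -subr_eq0 -nsq_eq0 => h.
  by rewrite /f0 /comp /aff mul1r mulr0 /invs expr0n addr0 (negPf h) /reflection mul0r mulr0 addr0.
have f0N : f0 None = Some (0, 0) by rewrite /f0 /comp /invs /reflection /aff conjc0 mulr0 addr0 mulr0.
have f00 : f0 (Some (0, 0)) = Some (2^-1 +i* 2^-1, 0).
  rewrite f0E; last by apply: complex_neq; left; rewrite /= eq_sym oner_eq0.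
  by congr (Some (_, _)); apply: complexE2; rewrite /nsq /=; field.
have f01 : f0 (Some (1, 0)) = Some (1, 0).
  rewrite f0E; last by apply: complex_neq; right; rewrite /= eq_sym oner_eq0.
  by congr (Some (_, _)); apply: complexE2; rewrite /nsq /=; field.
have f0d : f0 (Some (1 +i* 1, 0)) = None.
  by rewrite /f0 /comp /aff mul1r mulr0 subrr /invs sumsq_eq0 !eqxx.
have f0i : f0 (Some (0 +i* 1, 0)) = Some (0 +i* 1, 0).
  rewrite f0E; last by apply: complex_neq; left; rewrite /= eq_sym oner_eq0.
  by congr (Some (_, _)); apply: complexE2; rewrite /nsq /=; field.
have f0m : f0 (Some (2^-1 +i* 2^-1, 0)) = Some (1 +i* 1, 0).
  rewrite f0E; last by apply: complex_neq; left => /=; apply/eqP; lra.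
  by congr (Some (_, _)); apply: complexE2; rewrite /nsq /=; field.
have rN : r None = None by [].
have rE z : r (Some (z, 0)) = Some (I * z + 1, 0) by rewrite /r /aff mulr0.
have r0 : r (Some (0, 0)) = Some (1, 0) by rewrite rE; congr (Some (_, _)); apply: complexE2; rewrite /=; ring.
have r1 : r (Some (1, 0)) = Some (1 +i* 1, 0) by rewrite rE; congr (Some (_, _)); apply: complexE2; rewrite /=; ring.
have rd : r (Some (1 +i* 1, 0)) = Some (0 +i* 1, 0) by rewrite rE; congr (Some (_, _)); apply: complexE2; rewrite /=; ring.
have ri : r (Some (0 +i* 1, 0)) = Some (0, 0) by rewrite rE; congr (Some (_, _)); apply: complexE2; rewrite /=; ring.
have rm : r (Some (2^-1 +i* 2^-1, 0)) = Some (2^-1 +i* 2^-1, 0) by rewrite rE; congr (Some (_, _)); apply: complexE2; rewrite /=; lra.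
have rV : r @` @octV R = @octV R.
  by rewrite /octV !image_setU !image_set1 rN r0 r1 rd ri rm; perm_set.
have fV : f0 @` @octV R = @octV R.
  by rewrite /octV !image_setU !image_set1 f0N f00 f01 f0d f0i f0m; perm_set.
have step b f u : iso b f -> f None = u -> f @` @octV R = @octV R ->
    exists b' f', [/\ iso b' f', f' None = r u & f' @` @octV R = @octV R].
  move=> If fN fE; exists (true == b), (r \o f); split; [exact: iso_comp|by rewrite /comp fN|].
  by rewrite -image_comp fE.
have s0 : exists b f, [/\ iso b f, f None = Some (0, 0) & f @` @octV R = @octV R] by exists true, f0.
have [b1 [f1 [h1 h2 h3]]] := step _ _ _ If0 f0N fV; rewrite r0 in h2.
have [b2 [f2 [h4 h5 h6]]] := step _ _ _ h1 h2 h3; rewrite r1 in h5.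
have [b3 [f3 [h7 h8 h9]]] := step _ _ _ h4 h5 h6; rewrite rd in h8.
case=> [[[[[->|->]|->]|->]|->]|->].
- by [].
- by exists b1, f1.
- by exists true, id; split=> //; [exact: iso_id|rewrite image_id].
- by exists b2, f2.
- by exists b3, f3.
- exists (true == true), (f0 \o f0); split; last by rewrite -image_comp !fV.
    exact: (iso_comp If0 If0).
  by rewrite /comp f0N.
Qed.

(** By transitivity on vertices, [g] may be composed with a symmetry of the standard polyhedron so
    as to fix infinity. It is then a similarity of the plane; if it reverses orientation, another
    base edge is chosen. *)
Lemma regular_infty T V : regular T -> polyh T V -> V None ->
  exists a x, x != 0 /\ (V = triV a x \/ V = sqV a x).
Proof.
case=> b [g [Ig hT]] PV V0.
have aux U : (forall v, U v -> exists b f, [/\ iso b f, f None = v & f @` U = U]) -> V = g @` U ->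
    exists e q p, q != 0 /\ V = (fun v => if v is Some (z, t) then Some (q * (if e then z else conjc z) + p, 0 : R) else None) @` (U `&` @ideal R).
  move=> hU EV; move: (V0); rewrite EV => -[v Uv gv].
  have [c [f [If fN fU]]] := hU v Uv.
  have Igf := iso_comp Ig If; have gfN : (g \o f) None = None by rewrite /comp fN.
  have [q [p [q0 h]]] := iso_fix_infty Igf gfN.
  exists (b == c), q, p; split=> //; rewrite -{1}fU image_comp.
  have Vi : V `<=` @ideal R by case: PV.
  apply/seteqP; split=> [_ [u Uu <-]|_ [u [Uu ui] <-]].
    have ui : ideal u.
      have : V (g (f u)) by rewrite EV -fU image_comp; exists u.
      move=> /Vi; have [k [Ik K1 K2]] := iso_inv Igf.
      by move=> /(iso_ideal Ik); rewrite -[g (f u)]/((g \o f) u) K1.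
    by exists u => //; case: ui => [->|[z ->]]; rewrite ?gfN ?h.
  by exists u => //; case: ui => [->|[z ->]]; rewrite ?gfN ?h.
have triE e q p : q != 0 -> exists a x, x != 0 /\
  [set None; Some (q * (if e then 0 else conjc 0) + p, 0 : R); Some (q * (if e then 1 else conjc 1) + p, 0); Some (q * (if e then w6 else conjc w6) + p, 0)] = triV a x.
  case: e => q0.
    exists p, q; split=> //; rewrite /triV.
    by rewrite mulr0 add0r mulr1 addrC ![_ + p]addrC.
  exists p, (q * conjc w6); split; first by rewrite mulf_neq0 // conjc_eq0 omega_neq0.
  rewrite conjc0 mulr0 add0r conjc1 mulr1 /triV -mulrA [_ * w6]mulrC complex_conj_nsq nsq_omega mulr1.
  by rewrite ![_ + p]addrC; perm_set.
have sqE e q p : q != 0 -> exists a x, x != 0 /\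
  [set None; Some (q * (if e then 0 else conjc 0) + p, 0 : R); Some (q * (if e then 1 else conjc 1) + p, 0);
    Some (q * (if e then 1 +i* 1 else conjc (1 +i* 1)) + p, 0);
    Some (q * (if e then 0 +i* 1 else conjc (0 +i* 1)) + p, 0);
    Some (q * (if e then 2^-1 +i* 2^-1 else conjc (2^-1 +i* 2^-1)) + p, 0)] = sqV a x.
  have E1 : (1 +i* 1 : C) = 1 + I by apply: complexE2; rewrite /=; ring.
  case: e => q0.
    exists p, q; split=> //; rewrite /sqV mulr0 add0r mulr1 E1 mulrDr mulr1 -iE ![_ + p]addrC.
    by rewrite addrA.
  exists (p - q * I), q; split=> //.
  have -> : conjc (1 +i* 1 : C) = 1 - I by apply: complexE2; rewrite /=; ring.
  have -> : conjc (0 +i* 1 : C) = - I by apply: complexE2; rewrite /=; ring.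
  rewrite conjc0 mulr0 add0r conjc1 mulr1 /sqV subrK.
  have -> : p - q * I + q + q * I = q + p by ring.
  have -> : p - q * I + q * (2^-1 +i* 2^-1) = q * conjc (2^-1 +i* 2^-1) + p.
    have -> : conjc (2^-1 +i* 2^-1 : C) = (2^-1 +i* 2^-1) - I by apply: complexE2; rewrite /=; lra.
    ring.
  have -> : q * (1 - I) + p = p - q * I + q by ring.
  have -> : q * - I + p = p - q * I by ring.
  perm_set.
have idI U : U `<=` @ideal R -> U `&` @ideal R = U by move=> h; apply/setIidPl.
case: hT => ET.
  have EV : V = g @` @tetV R.
    by apply: (polyh_inj PV); rewrite ET; exact: (polyh_image Ig (@polyh_tet R)).
  have [e [q [p [q0]]]] := aux _ (@tet_symm) EV; have [ti _ _ _] := @polyh_tet R.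
  rewrite (idI _ ti) /tetV !image_setU !image_set1 => ->.
  have [a [x [x0 E]]] := triE e q p q0; exists a, x; split=> //; left; rewrite -E; perm_set.
have EV : V = g @` @octV R.
  by apply: (polyh_inj PV); rewrite ET; exact: (polyh_image Ig (@polyh_oct R)).
have [e [q [p [q0]]]] := aux _ (@oct_symm) EV; have [ti _ _ _] := @polyh_oct R.
rewrite (idI _ ti) /octV !image_setU !image_set1 => ->.
have [a [x [x0 E]]] := sqE e q p q0; exists a, x; split=> //; right; rewrite -E; perm_set.
Qed.

End Identify.

(** * Corners of slices at height one *)

Section Slices.
Variable R : realType.
Local Notation C := R[i].
Local Notation w6 := (omega R).
Local Notation I := ('i : C).
Implicit Types (V W T : set (mpoint R)) (P F : set (set (mpoint R))).
Implicit Types G : set (mpoint R -> mpoint R).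

Definition TQ (a x : C) : set C := convex_hull [:: a; a + x; a + x * w6].
Definition SQ (a x : C) : set C := convex_hull [:: a; a + x; a + x + x * I; a + x * I].

Lemma conv3E (p q r z : C) : convex_hull [:: p; q; r] z <->
  exists a b c : R, [/\ 0 <= a, 0 <= b, 0 <= c, a + b + c = 1 & z = a%:C * p + b%:C * q + c%:C * r].
Proof.
split=> [[a [a0 a1 ->]]|[a [b [c [a0 b0 c0 e ->]]]]].
  exists (a ord0), (a (lift ord0 ord0)), (a (lift ord0 (lift ord0 ord0))); split=> //.
    by rewrite -a1 /= !big_ord_recl big_ord0 addr0 addrA.
  by rewrite /= !big_ord_recl big_ord0 /= addr0 addrA.
exists (fun i => nth 0 [:: a; b; c] i); split.
- by case=> [[|[|[|]]]] //=.
- by rewrite /= !big_ord_recl big_ord0 /= addr0 addrA.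
- by rewrite /= !big_ord_recl big_ord0 /= addr0 addrA.
Qed.

Lemma conv4E (p q r s z : C) : convex_hull [:: p; q; r; s] z <->
  exists a b c d : R, [/\ 0 <= a, 0 <= b, 0 <= c, 0 <= d & a + b + c + d = 1 /\
    z = a%:C * p + b%:C * q + c%:C * r + d%:C * s].
Proof.
split=> [[a [a0 a1 ->]]|[a [b [c [d [a0 b0 c0 d0 [e ->]]]]]]].
  exists (a ord0), (a (lift ord0 ord0)), (a (lift ord0 (lift ord0 ord0))),
    (a (lift ord0 (lift ord0 (lift ord0 ord0)))); split=> //; split.
    by rewrite -a1 /= !big_ord_recl big_ord0 addr0 !addrA.
  by rewrite /= !big_ord_recl big_ord0 /= addr0 !addrA.
exists (fun i => nth 0 [:: a; b; c; d] i); split.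
- by case=> [[|[|[|[|]]]]] //=.
- by rewrite /= !big_ord_recl big_ord0 /= addr0 !addrA.
- by rewrite /= !big_ord_recl big_ord0 /= addr0 !addrA.
Qed.

Lemma conv3_rot (p q r : C) : convex_hull [:: p; q; r] = convex_hull [:: q; r; p].
Proof.
apply/seteqP; split=> z /conv3E[a [b [c [a0 b0 c0 e ->]]]]; apply/conv3E.
  by exists b, c, a; split=> //; [lra|ring].
by exists c, a, b; split=> //; [lra|ring].
Qed.

Lemma conv4_rot (p q r s : C) : convex_hull [:: p; q; r; s] = convex_hull [:: q; r; s; p].
Proof.
apply/seteqP; split=> z /conv4E[a [b [c [d [a0 b0 c0 d0 [e ->]]]]]]; apply/conv4E.
  by exists b, c, d, a; split=> //; split; [lra|ring].
by exists d, a, b, c; split=> //; split; [lra|ring].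
Qed.

Lemma TQ_rot a x : TQ a x = TQ (a + x) (x * (w6 - 1)).
Proof.
rewrite /TQ conv3_rot; congr (convex_hull [:: _; _; _]); first by ring.
by rewrite -mulrA mulrBl mul1r omega_sqr; ring.
Qed.

Lemma SQ_rot a x : SQ a x = SQ (a + x) (x * I).
Proof.
rewrite /SQ conv4_rot; congr (convex_hull [:: _; _; _; _]); rewrite -mulrA i_sqr; ring.
Qed.

Lemma triV_rot a x : triV a x = triV (a + x) (x * (w6 - 1)).
Proof.
rewrite /triV; have -> : a + x + x * (w6 - 1) = a + x * w6 by ring.
have -> : a + x + x * (w6 - 1) * w6 = a by rewrite -mulrA mulrBl mul1r omega_sqr; ring.
perm_set.
Qed.

Lemma sqV_rot a x : sqV a x = sqV (a + x) (x * I).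
Proof.
rewrite /sqV; have -> : a + x + x * I + x * I * I = a + x * I by rewrite -mulrA i_sqr; ring.
have -> : a + x + x * I * I = a by rewrite -mulrA i_sqr; ring.
have -> : a + x + x * I * (2^-1 +i* 2^-1) = a + x * (2^-1 +i* 2^-1).
  have E : I * (2^-1 +i* 2^-1) = (2^-1 +i* 2^-1 : C) - 1 by apply: complexE2; rewrite /=; lra.
  by rewrite -mulrA E; ring.
perm_set.
Qed.

Lemma w6B1_neq0 : w6 - 1 != 0.
Proof. by rewrite -omega_sqr mulf_neq0 ?omega_neq0. Qed.

Lemma i_neq0 : I != 0.
Proof. by apply: complex_neq; right; rewrite /= oner_eq0. Qed.

Definition dotp (x z : C) : R := complex.Re (conjc x * z).

Lemma dotpD x y z : dotp x (y + z) = dotp x y + dotp x z.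
Proof. by rewrite /dotp mulrDr; case: (_ * _) (_ * _) => [? ?] [? ?]. Qed.

Lemma dotpC x (a : R) z : dotp x (a%:C * z) = a * dotp x z.
Proof. by rewrite /dotp; case: x z => [? ?] [? ?] /=; ring. Qed.

Lemma hull_dotp_min V be z t : V `<=` @ideal R -> finite_set V -> V None -> be != 0 ->
  ideal_hull V (Some (z, t)) -> exists2 w, V (Some (w, 0)) & dotp be w <= dotp be z.
Proof.
move=> Vi Vf V0 be0 [_ h]; apply: contrapT => hn.
have {}hn w : V (Some (w, 0)) -> dotp be z < dotp be w.
  by move=> Vw; rewrite ltNge; apply/negP => k; apply: hn; exists w.
(* [M^-1] is a uniform gap between the value at [z] and the values at the finite vertices. Moving
   the vertical plane through [z] by this gap separates [z] from all vertices. *)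
have [M hM] : exists M, forall v, V v -> (fun v M => 0 < M /\ forall w, V v -> v = Some (w, 0) -> 1 <= M * (dotp be w - dotp be z)) v M.
  apply: (finite_unif Vf) => [v M M' [M0 HM] MM'|v Vv].
    split=> [|w Vv e]; first exact: lt_le_trans MM'.
    apply: le_trans (HM w Vv e) _; rewrite ler_wpM2r //.
    by apply: ltW; rewrite subr_gt0 hn // -e; exact: Vv.
  case: (Vi _ Vv) => [->|[w e]]; first by exists 1.
  have d0 : 0 < dotp be w - dotp be z by rewrite subr_gt0 hn // -e.
  exists (dotp be w - dotp be z)^-1; rewrite invr_gt0; split=> // w'.
  by rewrite e => _ [<-]; rewrite mulVf // gt_eqF.
have [M0 _] := hM _ V0.
have : 0 <= side 0 be (- 2 * (dotp be z + M^-1)) (Some (z, t)).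
  apply: h; first by rewrite discE mul0r subr0 nsq_gt0.
  move=> v Vv; case: (Vi _ Vv) => [->//|[w e]].
  have [_ /(_ w Vv e) k] := hM _ Vv; rewrite e sideE mul0r add0r -/(dotp be w).
  have : M^-1 <= dotp be w - dotp be z by rewrite -[M^-1]mulr1 ler_pdivrMl.
  lra.
rewrite sideE mul0r add0r -/(dotp be z).
have : 0 < M^-1 by rewrite invr_gt0.
lra.
Qed.

Definition has_slice T (Q : set C) := forall z, T (Some (z, 1)) <-> Q z.

Lemma slice_vertex T V Q w : polyh T V -> has_slice T Q -> V None -> V (Some (w, 0)) -> Q w.
Proof.
move=> [_ _ _ ->] hQ V0 Vw; apply/hQ; exact: hull_vertical.
Qed.

(** A tile at infinity projects into the convex hull of its finite vertices, and these lie in its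
    slice. The minimum of a linear functional over the slice is therefore attained at a vertex. *)
Lemma slice_corner T V Q a be : polyh T V -> has_slice T Q -> V None -> be != 0 -> Q a ->
  (forall z, Q z -> z <> a -> dotp be a < dotp be z) -> V (Some (a, 0)).
Proof.
move=> PV hQ V0 be0 Qa h; have [Vi Vf _ E] := PV.
have [|w Vw hw] := @hull_dotp_min V be a 1 Vi Vf V0 be0; first by rewrite -E; apply/hQ.
have [<-//|ne] := pselect (w = a).
by have := h _ (slice_vertex PV hQ V0 Vw) ne; rewrite ltNge hw.
Qed.

Lemma slice_corner_tri T V a x : polyh T V -> V None -> x != 0 -> has_slice T (TQ a x) ->
  V (Some (a, 0)).
Proof.
move=> PV V0 x0 hQ.
have n0 : 0 < nsq x by rewrite nsq_gt0.
have d1 : dotp (x * (1 + w6)) x = nsq x * (3 / 2).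
  by rewrite /dotp omegaE; case: (x) => u v; rewrite /nsq /=; lra.
have d2 : dotp (x * (1 + w6)) (x * w6) = nsq x * (3 / 2).
  have [h _] := half_sqrt3 R; move: h; rewrite /dotp omegaE; set s := Num.sqrt 3 / 2.
  case: (x) => u v; rewrite /nsq /= => h.
  transitivity ((u ^+ 2 + v ^+ 2) * (2^-1 + 2^-1 ^+ 2 + s ^+ 2)); first by ring.
  rewrite h; lra.
(* The functional points along the bisector of the angle at [a]. *)
apply: (slice_corner PV hQ V0 (be := x * (1 + w6))).
- rewrite mulf_neq0 //; apply: complex_neq; left; rewrite omegaE /=; apply/eqP; lra.
- by apply/conv3E; exists 1, 0, 0; split=> //; [ring|ring].
- move=> z /conv3E[u [v [w [u0 v0 w0 e ->]]]] ne.
  rewrite -subr_gt0; have -> : u%:C * a + v%:C * (a + x) + w%:C * (a + x * w6) = a + (v%:C * x + w%:C * (x * w6)).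
    have -> : u%:C = 1 - v%:C - w%:C by rewrite (_ : u = 1 - v - w) ?rmorphB ?rmorph1 //; lra.
    ring.
  rewrite [dotp _ (a + _)]dotpD addrC addKr dotpD !dotpC d1 d2 -mulrDl mulr_gt0 //; last by rewrite mulr_gt0 //; lra.
  rewrite lt_neqAle addr_ge0 // andbT; apply/eqP => k; apply: ne.
  have v1 : v = 0 by lra.
  have w1 : w = 0 by lra.
  have -> : u = 1 by lra.
  by rewrite v1 w1; ring.
Qed.

Lemma slice_corner_sq T V a x : polyh T V -> V None -> x != 0 -> has_slice T (SQ a x) ->
  V (Some (a, 0)).
Proof.
move=> PV V0 x0 hQ.
have n0 : 0 < nsq x by rewrite nsq_gt0.
have d1 : dotp (x * (1 + I)) x = nsq x.
  by rewrite /dotp; case: (x) => u v; rewrite /nsq /=; ring.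
have d2 : dotp (x * (1 + I)) (x * I) = nsq x.
  by rewrite /dotp; case: (x) => u v; rewrite /nsq /=; ring.
apply: (slice_corner PV hQ V0 (be := x * (1 + I))).
- by rewrite mulf_neq0 //; apply: complex_neq; right; rewrite /= add0r oner_eq0.
- by apply/conv4E; exists 1, 0, 0, 0; split=> //; split; ring.
- move=> z /conv4E[u [v [w [r [u0 v0 w0 r0 [e ->]]]]]] ne.
  rewrite -subr_gt0; have -> : u%:C * a + v%:C * (a + x) + w%:C * (a + x + x * I) + r%:C * (a + x * I) = a + ((v + w)%:C * x + (w + r)%:C * (x * I)).
    have -> : u%:C = 1 - v%:C - w%:C - r%:C by rewrite (_ : u = 1 - v - w - r) ?rmorphB ?rmorph1 //; lra.
    rewrite !rmorphD; ring.
  rewrite [dotp _ (a + _)]dotpD addrC addKr dotpD !dotpC d1 d2 -mulrDl mulr_gt0 //.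
  rewrite lt_neqAle !addr_ge0 // andbT; apply/eqP => k; apply: ne.
  have v1 : v = 0 by lra.
  have w1 : w = 0 by lra.
  have r1 : r = 0 by lra.
  have -> : u = 1 by lra.
  by rewrite v1 w1 r1; ring.
Qed.

End Slices.

(** * Tetrahedra and octahedra recovered from their slices *)

Section Tiles.
Variable R : realType.
Local Notation C := R[i].
Local Notation w6 := (omega R).
Local Notation I := ('i : C).
Implicit Types (V W T : set (mpoint R)) (P F : set (set (mpoint R))).
Implicit Types G : set (mpoint R -> mpoint R).

Lemma triV_fin a x z : triV a x (Some (z, 0)) <-> exists2 c, List.In c [:: 0; 1; w6] & z = a + x * c.
Proof.
split=> [[[[//|[->]]|[->]]|[->]]|[c [<-|[<-|[<-|//]]] ->]].
- by exists 0; [left|ring].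
- by exists 1; [right; left|ring].
- by exists w6; [right; right; left|].
- by rewrite mulr0 addr0; left; left; right.
- by rewrite mulr1; left; right.
- by right.
Qed.

Lemma sqV_fin a x z : sqV a x (Some (z, 0)) <->
  exists2 c, List.In c [:: 0; 1; 1 + I; I; 2^-1 +i* 2^-1] & z = a + x * c.
Proof.
split=> [[[[[[//|[->]]|[->]]|[->]]|[->]]|[->]]|[c [<-|[<-|[<-|[<-|[<-|//]]]]] ->]].
- by exists 0; [left|ring].
- by exists 1; [right; left|ring].
- by exists (1 + I); [right; right; left|ring].
- by exists I; [right; right; right; left|].
- by exists (2^-1 +i* 2^-1); [right; right; right; right; left|].
- by rewrite mulr0 addr0; left; left; left; left; right.
- by rewrite mulr1; left; left; left; right.
- by rewrite mulrDr mulr1 addrA; left; left; right.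
- by left; right.
- by right.
Qed.

(** Refutes a false equation between constants: [s = sqrt 3 / 2] enters only through
    [s ^+ 2 = 3 / 4] and [8 / 10 < s]. *)
Ltac const_absurd E :=
  let s2 := fresh in let s1 := fresh in
  exfalso; have [s2 s1] := half_sqrt3 R; move: (congr1 (@complex.Re R) E) (congr1 (@complex.Im R) E);
  rewrite ?omegaE /=; move: s2 s1; clear; move: (Num.sqrt 3 / 2) => s *; lra.

Lemma tri_vertices_eq V a x p v : x != 0 -> v != 0 -> V = triV p v ->
  V (Some (a, 0)) -> V (Some (a + x, 0)) -> V (Some (a + x * w6, 0)) -> V = triV a x.
Proof.
move=> x0 v0 EV; wlog E0 : p v v0 EV / p = a => [H|].
  move=> V1; move: (V1); rewrite {1}EV => /triV_fin[c [<-|[<-|[<-|//]]] E] h1 h2.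
  - by apply: (H p v) => //; rewrite E mulr0 addr0.
  - apply: (H (p + v) (v * (w6 - 1))) => //; first by rewrite mulf_neq0 // w6B1_neq0.
      by rewrite -triV_rot.
    by rewrite E mulr1.
  - apply: (H (p + v + v * (w6 - 1)) (v * (w6 - 1) * (w6 - 1))) => //; first by rewrite !mulf_neq0 // w6B1_neq0.
      by rewrite -!triV_rot.
    by rewrite E; ring.
rewrite EV E0 => _ /triV_fin[c1 h1 /addrI E1] /triV_fin[c2 h2 /addrI E2].
have E : c1 * w6 = c2 by apply: (mulfI v0); rewrite mulrA -E1.
have x1 : x = v * c1 by [].
move: h1 h2 E x1 => [<-|[<-|[<-|//]]] [<-|[<-|[<-|//]]] E x1; rewrite ?mulr1 in x1; try (by rewrite x1); 
  try (by rewrite x1 mulr0 eqxx in x0); const_absurd E.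
Qed.

Lemma tri_of_slice T V a x : regular T -> polyh T V -> V None -> x != 0 -> has_slice T (TQ a x) ->
  V = triV a x.
Proof.
move=> rT PV V0 x0 hQ.
have y0 : x * (w6 - 1) != 0 by rewrite mulf_neq0 // w6B1_neq0.
have V1 := slice_corner_tri PV V0 x0 hQ.
have hQ2 : has_slice T (TQ (a + x) (x * (w6 - 1))) by rewrite -TQ_rot.
have V2 := slice_corner_tri PV V0 y0 hQ2.
have hQ3 : has_slice T (TQ (a + x + x * (w6 - 1)) (x * (w6 - 1) * (w6 - 1))) by rewrite -TQ_rot.
have y1 : x * (w6 - 1) * (w6 - 1) != 0 by rewrite mulf_neq0 // w6B1_neq0.
have := slice_corner_tri PV V0 y1 hQ3.
have -> : a + x + x * (w6 - 1) = a + x * w6 by ring.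
move=> V3; have [p [v [v0 [EV|EV]]]] := regular_infty rT PV V0.
  exact: (tri_vertices_eq x0 v0 EV).
(* Over a square, after quarter turns of the base, [a] is the corner [p] or the centre; no
   equilateral triangle with vertices among the five points starts there. *)
exfalso; move: V1 V2 V3; clear -x0 v0 EV; wlog D : p v v0 EV / p = a \/ a = p + v * (2^-1 +i* 2^-1) => [H|].
  move=> V1; move: (V1); rewrite {1}EV => /sqV_fin[c [<-|[<-|[<-|[<-|[<-|//]]]]] E] h1 h2.
  - by apply: (H p v) => //; left; rewrite E mulr0 addr0.
  - apply: (H (p + v) (v * I)) => //; first by rewrite mulf_neq0 // i_neq0.
      by rewrite -sqV_rot.
    by left; rewrite E mulr1.
  - apply: (H (p + v + v * I) (v * I * I)) => //; first by rewrite !mulf_neq0 // i_neq0.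
      by rewrite -!sqV_rot.
    by left; rewrite E; ring.
  - apply: (H (p + v + v * I + v * I * I) (v * I * I * I)) => //; first by rewrite !mulf_neq0 // i_neq0.
      by rewrite -!sqV_rot.
    by left; rewrite E -mulrA i_sqr; ring.
  - by apply: (H p v) => //; right.
case: D => E0.
  rewrite EV E0 => _ /sqV_fin[c1 h1 /addrI E1] /sqV_fin[c2 h2 /addrI E2].
  have E : c1 * w6 = c2 by apply: (mulfI v0); rewrite mulrA -E1.
  have c10 : c1 != 0 by apply: contraNneq x0 => c10; rewrite E1 c10 mulr0.
  move: h1 h2 E c10 => [<-|[<-|[<-|[<-|[<-|//]]]]] [<-|[<-|[<-|[<-|[<-|//]]]]] E c10;
  try (by rewrite eqxx in c10); const_absurd E.
rewrite EV => _ /sqV_fin[c1 h1 E1] /sqV_fin[c2 h2 E2].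
have E : (c1 - (2^-1 +i* 2^-1)) * w6 = c2 - (2^-1 +i* 2^-1).
  apply: (mulfI v0); rewrite mulrA !mulrBr.
  have -> : v * c1 = x + v * (2^-1 +i* 2^-1) by apply: (addrI p); rewrite -E1 E0; ring.
  have -> : v * c2 = x * w6 + v * (2^-1 +i* 2^-1) by apply: (addrI p); rewrite -E2 E0; ring.
  ring.
have c10 : c1 != 2^-1 +i* 2^-1.
  by apply: contraNneq x0 => c10; apply/eqP; apply: (addrI a); rewrite E1 c10 -E0 addr0.
move: h1 h2 E c10 => [<-|[<-|[<-|[<-|[<-|//]]]]] [<-|[<-|[<-|[<-|[<-|//]]]]] E c10;
  try (by rewrite eqxx in c10); const_absurd E.
Qed.

Lemma sq_of_slice T V a x : regular T -> polyh T V -> V None -> x != 0 -> has_slice T (SQ a x) ->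
  V = sqV a x.
Proof.
move=> rT PV V0 x0 hQ.
have y0 : x * I != 0 by rewrite mulf_neq0 // i_neq0.
have V1 := slice_corner_sq PV V0 x0 hQ.
have hQ2 : has_slice T (SQ (a + x) (x * I)) by rewrite -SQ_rot.
have V2 := slice_corner_sq PV V0 y0 hQ2.
have hQ3 : has_slice T (SQ (a + x + x * I) (x * I * I)) by rewrite -SQ_rot.
have y1 : x * I * I != 0 by rewrite mulf_neq0 // i_neq0.
have V3 := slice_corner_sq PV V0 y1 hQ3.
have hQ4 : has_slice T (SQ (a + x + x * I + x * I * I) (x * I * I * I)) by rewrite -SQ_rot.
have y2 : x * I * I * I != 0 by rewrite mulf_neq0 // i_neq0.
have := slice_corner_sq PV V0 y2 hQ4.
have -> : a + x + x * I + x * I * I = a + x * I by rewrite -mulrA i_sqr; ring.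
move=> V4; have [p [v [v0 [EV|EV]]]] := regular_infty rT PV V0.
  exfalso; move: V1 V2 V4; clear -x0 v0 EV; wlog E0 : p v v0 EV / p = a => [H|].
    move=> V1; move: (V1); rewrite {1}EV => /triV_fin[c [<-|[<-|[<-|//]]] E] h1 h2.
    - by apply: (H p v) => //; rewrite E mulr0 addr0.
    - apply: (H (p + v) (v * (w6 - 1))) => //; first by rewrite mulf_neq0 // w6B1_neq0.
        by rewrite -triV_rot.
      by rewrite E mulr1.
    - apply: (H (p + v + v * (w6 - 1)) (v * (w6 - 1) * (w6 - 1))) => //; first by rewrite !mulf_neq0 // w6B1_neq0.
        by rewrite -!triV_rot.
      by rewrite E; ring.
  rewrite EV E0 => _ /triV_fin[c1 h1 /addrI E1] /triV_fin[c2 h2 /addrI E2].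
  have E : c1 * I = c2 by apply: (mulfI v0); rewrite mulrA -E1.
  have c10 : c1 != 0 by apply: contraNneq x0 => c10; rewrite E1 c10 mulr0.
  move: h1 h2 E c10 => [<-|[<-|[<-|//]]] [<-|[<-|[<-|//]]] E c10;
  try (by rewrite eqxx in c10); const_absurd E.
move: V1 V2 V3 V4; clear -x0 v0 EV; wlog D : p v v0 EV / p = a \/ a = p + v * (2^-1 +i* 2^-1) => [H|].
  move=> V1; move: (V1); rewrite {1}EV => /sqV_fin[c [<-|[<-|[<-|[<-|[<-|//]]]]] E] h1 h2 h3.
  - by apply: (H p v) => //; left; rewrite E mulr0 addr0.
  - apply: (H (p + v) (v * I)) => //; first by rewrite mulf_neq0 // i_neq0.
      by rewrite -sqV_rot.
    by left; rewrite E mulr1.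
  - apply: (H (p + v + v * I) (v * I * I)) => //; first by rewrite !mulf_neq0 // i_neq0.
      by rewrite -!sqV_rot.
    by left; rewrite E; ring.
  - apply: (H (p + v + v * I + v * I * I) (v * I * I * I)) => //; first by rewrite !mulf_neq0 // i_neq0.
      by rewrite -!sqV_rot.
    by left; rewrite E -mulrA i_sqr; ring.
  - by apply: (H p v) => //; right.
case: D => E0.
  rewrite EV E0 => _ /sqV_fin[c1 h1 /addrI E1] _ /sqV_fin[c2 h2 /addrI E2].
  have E : c1 * I = c2 by apply: (mulfI v0); rewrite mulrA -E1.
  have c10 : c1 != 0 by apply: contraNneq x0 => c10; rewrite E1 c10 mulr0.
  have x1 : x = v * c1 by [].
  move: h1 h2 E c10 x1 => [<-|[<-|[<-|[<-|[<-|//]]]]] [<-|[<-|[<-|[<-|[<-|//]]]]] E c10 x1; rewrite ?mulr1 in x1;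
  try (by rewrite x1); try (by rewrite eqxx in c10); const_absurd E.
move=> _; rewrite EV => /sqV_fin[c1 h1 E1] /sqV_fin[c2 h2 E2] _.
have E' : (c1 - (2^-1 +i* 2^-1)) * (1 + I) = c2 - (2^-1 +i* 2^-1).
  apply: (mulfI v0); rewrite mulrA !mulrBr.
  have -> : v * c1 = x + v * (2^-1 +i* 2^-1) by apply: (addrI p); rewrite -E1 E0; ring.
  have -> : v * c2 = x + x * I + v * (2^-1 +i* 2^-1) by apply: (addrI p); rewrite -E2 E0; ring.
  ring.
have c10 : c1 != 2^-1 +i* 2^-1.
  by apply: contraNneq x0 => c10; apply/eqP; apply: (addrI a); rewrite E1 c10 -E0 addr0.
move: h1 h2 E' c10 => [<-|[<-|[<-|[<-|[<-|//]]]]] [<-|[<-|[<-|[<-|[<-|//]]]]] E' c10;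
  try (by rewrite eqxx in c10); const_absurd E'.
Qed.

End Tiles.

(** * From polygons of the peripheral tiling to tiles at infinity *)

Section Peripheral.
Variable R : realType.
Local Notation C := R[i].
Local Notation w6 := (omega R).
Local Notation I := ('i : C).
Implicit Types (V W T : set (mpoint R)) (P F : set (set (mpoint R))).
Implicit Types G : set (mpoint R -> mpoint R).
Implicit Types S : set (set C).

Lemma crosspM (x u v : C) : crossp (x * u) (x * v) = nsq x * crossp u v.
Proof. by case: x u v => [? ?] [? ?] [? ?]; rewrite /crossp /nsq /=; ring. Qed.

Lemma hull_disc V (c : C) (r : R) z t : (forall v, V v -> exists2 w, v = Some (w, 0) & nsq (w - c) <= r) ->
  0 < r -> ideal_hull V (Some (z, t)) -> nsq (z - c) + t ^+ 2 <= r.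
Proof.
move=> h r0 [_ /(_ (-1) c (r - nsq c))].
have sE w s : side (-1) c (r - nsq c) (Some (w, s)) = r - nsq (w - c) - s ^+ 2.
  by rewrite sideE; case: w (c) => [? ?] [? ?]; rewrite /nsq /=; ring.
rewrite discE sE => H; have : 0 <= r - nsq (z - c) - t ^+ 2; last by lra.
apply: H; first by lra.
by move=> v /h[w -> hw]; rewrite sE; lra.
Qed.

Lemma TQ_inv a x z : TQ a x z -> exists v w : R, [/\ 0 <= v, 0 <= w, v + w <= 1 & z = a + x * (v%:C + w%:C * w6)].
Proof.
move=> /conv3E[u [v [w [u0 v0 w0 e ->]]]]; exists v, w; split=> //; first by lra.
have -> : u%:C = 1 - v%:C - w%:C by rewrite (_ : u = 1 - v - w) ?rmorphB ?rmorph1 //; lra.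
ring.
Qed.

Lemma SQ_inv a x z : SQ a x z -> exists v w : R, [/\ 0 <= v, 0 <= w & z = a + x * (v +i* w)].
Proof.
move=> /conv4E[u [v [w [r [u0 v0 w0 r0 [e ->]]]]]]; exists (v + w), (w + r); split; try by rewrite addr_ge0.
have -> : (v + w) +i* (w + r) = v%:C + w%:C + (w%:C + r%:C) * I by apply: complexE2; rewrite /=; ring.
have -> : u%:C = 1 - v%:C - w%:C - r%:C by rewrite (_ : u = 1 - v - w - r) ?rmorphB ?rmorph1 //; lra.
ring.
Qed.

Lemma half_real : (2^-1 : C) = (2^-1)%:C.
Proof. by rewrite fmorphV rmorph_nat. Qed.

Lemma half_half : (2^-1 : C) + 2^-1 = 1.
Proof. by rewrite half_real -rmorphD (_ : 2^-1 + 2^-1 = 1) ?rmorph1 //; lra. Qed.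

Lemma half_split (u : C) : u = u * 2^-1 + u * 2^-1.
Proof. by rewrite -mulrDr half_half mulr1. Qed.

Lemma TQ_points a x : [/\ TQ a x a, TQ a x (a + x), TQ a x (a + x * 2^-1) & TQ a x (a + x * w6)].
Proof.
split; apply/conv3E.
- by exists 1, 0, 0; split; rewrite ?rmorph1 ?rmorph0 //; ring.
- by exists 0, 1, 0; split; rewrite ?rmorph1 ?rmorph0 //; ring.
- exists 2^-1, 2^-1, 0; split; rewrite ?rmorph0 -?half_real ?invr_ge0 //; first by lra.
  by rewrite {1}(half_split a); ring.
- by exists 0, 0, 1; split; rewrite ?rmorph1 ?rmorph0 //; ring.
Qed.

Lemma SQ_points a x : [/\ SQ a x a, SQ a x (a + x), SQ a x (a + x * 2^-1) & SQ a x (a + x * I)].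
Proof.
split; apply/conv4E.
- by exists 1, 0, 0, 0; split=> //; split; rewrite ?rmorph1 ?rmorph0 //; ring.
- by exists 0, 1, 0, 0; split=> //; split; rewrite ?rmorph1 ?rmorph0 //; ring.
- exists 2^-1, 2^-1, 0, 0; split; rewrite ?invr_ge0 //; split; rewrite ?rmorph0 -?half_real; first by lra.
  by rewrite {1}(half_split a); ring.
- by exists 0, 0, 0, 1; split=> //; split; rewrite ?rmorph1 ?rmorph0 //; ring.
Qed.

(* The tile of [S] to the left of the directed edge from [a] to [a + x]. *)
Definition adj S a x := S (TQ a x) \/ S (SQ a x).

Lemma slice_tile P Q : horosphere_slice P Q -> exists2 T, P T & has_slice T Q.
Proof. by case=> _ [T PT ->]; exists T. Qed.

(* Both tiles contain three collinear points at height 1, so the plane that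
   separates them is vertical. *)
Lemma edge_halfplane G P Q1 T1 V a x d : tsys G P -> P T1 -> has_slice T1 Q1 -> polyh T1 V ->
  x != 0 -> Q1 a -> Q1 (a + x) -> Q1 (a + x * 2^-1) -> Q1 d -> 0 < crossp x (d - a) ->
  (forall z, Q1 z -> 0 <= crossp x (z - a)) -> adj (horosphere_slice P) (a + x) (- x) ->
  forall w, V (Some (w, 0)) -> 0 <= crossp x (w - a).
Proof.
move=> sys PT1 hQ1 PV x0 Qa Qb Qm Qd hd hQ hadj w Vw.
have nx : 0 < nsq x by rewrite nsq_gt0.
have [_ s0] := half_sqrt3 R.
have [T2 [PT2 Ta Tb Tm [c Tc hc]]] : exists T2, [/\ P T2, T2 (Some (a, 1)), T2 (Some (a + x, 1)), T2 (Some (a + x * 2^-1, 1)) &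
    exists2 c, T2 (Some (c, 1)) & crossp x (c - a) < 0].
  case: hadj => /slice_tile[T2 PT2 hQ2]; exists T2; split=> //; try apply/hQ2.
  - by have [_ h _ _] := TQ_points (a + x) (- x); rewrite addrK in h.
  - by have [h _ _ _] := TQ_points (a + x) (- x).
  - have [_ _ h _] := TQ_points (a + x) (- x); move: h; congr (TQ _ _ _).
    by rewrite {1}(half_split x); ring.
  - exists (a + x + - x * w6); first by apply/hQ2; have [] := TQ_points (a + x) (- x).
    have -> : a + x + - x * w6 - a = x * (1 - w6) by ring.
    by rewrite -{1}[x]mulr1 crosspM pmulr_rlt0 // omegaE /crossp /=; lra.
  - by have [_ h _ _] := SQ_points (a + x) (- x); rewrite addrK in h.
  - by have [h _ _ _] := SQ_points (a + x) (- x).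
  - have [_ _ h _] := SQ_points (a + x) (- x); move: h; congr (SQ _ _ _).
    by rewrite {1}(half_split x); ring.
  - exists (a + x + - x * I); first by apply/hQ2; have [] := SQ_points (a + x) (- x).
    have -> : a + x + - x * I - a = x * (1 - I) by ring.
    by rewrite -{1}[x]mulr1 crosspM pmulr_rlt0 // /crossp /=; lra.
have ne : T1 <> T2.
  move=> e; have /hQ1/hQ : T1 (Some (c, 1)) by rewrite e.
  by rewrite leNgt hc.
have [[al [be [de [hdisc hT E]]]] _] := ts_face sys PT1 PT2 ne.
have on z : Q1 z -> T2 (Some (z, 1)) -> side al be de (Some (z, 1)) = 0.
  move=> /hQ1 h1 h2; have : (T1 `&` T2) (Some (z, 1)) by [].
  by rewrite E => -[].
have ea := on _ Qa Ta; have eb := on _ Qb Tb; have em := on _ Qm Tm.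
have al0 : al = 0.
  have : al * nsq x = 0.
    move: ea eb em; rewrite !sideE half_real; case: (a) (x) (be) => [a1 a2] [x1 x2] [b1 b2]; rewrite /nsq /=.
    move=> ea eb em.
    lra.
  by move/eqP; rewrite mulf_eq0 (gt_eqF nx) orbF => /eqP.
have bx : dotp be x = 0.
  by move: ea eb; rewrite !sideE al0 !mul0r !add0r; rewrite -/(dotp be a) -/(dotp be (a + x)) dotpD; lra.
have sE z t : side al be de (Some (z, t)) = 2 * dotp be (z - a).
  have : side al be de (Some (z, t)) - side al be de (Some (a, 1)) = 2 * dotp be (z - a).
    by rewrite !sideE al0 !mul0r !add0r -/(dotp be a) -/(dotp be z); have := dotpD be (z - a) a; rewrite subrK; lra.
  by rewrite ea subr0.
have key z : nsq x * dotp be z = crossp x be * crossp x z.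
  have : nsq x * dotp be z = dotp be x * dotp x z + crossp x be * crossp x z.
    by rewrite /dotp /crossp /nsq; case: (x) (be) z => [? ?] [? ?] [? ?] /=; ring.
  by rewrite bx mul0r add0r.
have hw : 0 <= crossp x be * crossp x (w - a).
  have := side_hull_vertex PV hT hdisc Vw; rewrite sE -key => h.
  by rewrite mulr_ge0 ?(ltW nx) //; lra.
have hdd : 0 <= crossp x be * crossp x (d - a).
  have := hT _ ((hQ1 d).2 Qd); rewrite sE -key => h.
  by rewrite mulr_ge0 ?(ltW nx) //; lra.
have b0 : be != 0.
  by apply: contraTneq hdisc => ->; rewrite discE al0 mul0r subr0 nsqC expr0n ltxx.
have cb : crossp x be != 0.
  apply: contraNneq b0 => c0; rewrite -nsq_eq0.
  have : nsq x * dotp be be = 0 by rewrite key c0 mul0r.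
  have -> : dotp be be = nsq be by rewrite /dotp /nsq; case: (be) => ? ? /=; ring.
  by move/eqP; rewrite mulf_eq0 (gt_eqF nx).
have cp : 0 < crossp x be.
  by rewrite lt_neqAle eq_sym cb -(pmulr_lge0 _ hd).
by rewrite -(pmulr_rge0 _ cp).
Qed.

(** The three adjacency hypotheses serve only to show that the tile reaches infinity: each neighbour
    confines the vertices to one side of an edge, hence all finite vertices to the triangle. *)
Lemma tri_tile G P a x : tsys G P -> x != 0 -> let S := horosphere_slice P in S (TQ a x) ->
  adj S (a + x) (- x) -> adj S (a + x * w6) (- (x * (w6 - 1))) -> adj S a (x * w6) ->
  P (ideal_hull (triV a x)).
Proof.
move=> sys x0 S /slice_tile[T PT hT] e1 e2 e3.
have rT := ts_tile sys PT; have [V PV] := regular_polyh rT.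
have nx : 0 < nsq x by rewrite nsq_gt0.
have [s2 s0] := half_sqrt3 R.
have half b y : adj S (b + y) (- y) -> y != 0 -> TQ a x = TQ b y ->
    forall w, V (Some (w, 0)) -> 0 <= crossp y (w - b).
  move=> hadj y0 EQ; rewrite EQ in hT.
  have ny : 0 < nsq y by rewrite nsq_gt0.
  have hc v u : crossp y (b + y * (v%:C + u%:C * w6) - b) = nsq y * (u * (Num.sqrt 3 / 2)).
    have -> : b + y * (v%:C + u%:C * w6) - b = y * (v%:C + u%:C * w6) by ring.
    rewrite -{1}[y]mulr1 crosspM; congr (_ * _); rewrite omegaE /crossp /=; ring.
  have [p1 p2 p3 p4] := TQ_points b y.
  apply: (edge_halfplane (d := b + y * w6) sys PT hT PV) => //.
  - have := hc 0 1; rewrite rmorph0 rmorph1 add0r !mul1r => ->; rewrite mulr_gt0 //; lra.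
  - by move=> z /TQ_inv[v [u [v0 u0 _ ->]]]; rewrite hc mulr_ge0 ?(ltW ny) // mulr_ge0 //; lra.
have y0 : x * (w6 - 1) != 0 by rewrite mulf_neq0 // w6B1_neq0.
have h1 := half _ _ e1 x0 erefl.
have h2 : forall w, V (Some (w, 0)) -> 0 <= crossp (x * (w6 - 1)) (w - (a + x)).
  apply: half => //; last exact: TQ_rot.
  by have -> : a + x + x * (w6 - 1) = a + x * w6 by ring.
have h3 : forall w, V (Some (w, 0)) -> 0 <= crossp (- (x * w6)) (w - (a + x * w6)).
  have E : x * (w6 - 1) * (w6 - 1) = - (x * w6).
    by have O := omega_sqr R; ring: O.
  apply: half; first by rewrite opprK addrK.
    by rewrite oppr_eq0 mulf_neq0 // omega_neq0.
  rewrite TQ_rot TQ_rot E; congr (TQ _ _); ring.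
(* Otherwise [V] lies in the circumscribed disc, and [(a, 1)] is above the
   hemisphere over it. *)
have V0 : V None.
  apply: contrapT => V0; have [Vi _ _ EV] := PV.
  have Ta : ideal_hull V (Some (a, 1)).
    by rewrite -EV; apply/hT; have [] := TQ_points a x.
  pose c := a + x * ((1 + w6) / 3).
  have third : (3^-1 : C) = (3^-1 : R)%:C by rewrite fmorphV rmorph_nat.
  suff : nsq (a - c) + 1 ^+ 2 <= nsq x / 3.
    have -> : a - c = x * (- ((1 + w6) / 3)) by rewrite /c; ring.
    rewrite nsqM nsqN.
    have -> : nsq ((1 + w6) / 3) = 1 / 3.
      by move: s2; rewrite third omegaE /nsq /=; set s := Num.sqrt 3 / 2 => s2; lra.
    lra.
  apply: hull_disc Ta; last by rewrite divr_gt0.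
  move=> v Vv; case: (Vi _ Vv) => [e|[w e]]; first by case: V0; rewrite -e.
  exists w => //; rewrite e in Vv.
  have := h1 _ Vv; have := h2 _ Vv; have := h3 _ Vv.
  pose u := (w - a) / x; have -> : w = a + x * u by rewrite /u; field.
  have -> : a + x * u - c = x * (u - (1 + w6) / 3) by rewrite /c; ring.
  have -> : a + x * u - (a + x * w6) = x * (u - w6) by ring.
  have -> : a + x * u - a = x * u by ring.
  have -> : a + x * u - (a + x) = x * (u - 1) by ring.
  have -> : - (x * w6) = x * (- w6) by ring.
  have -> : crossp x (x * u) = nsq x * crossp 1 u by rewrite -crosspM mulr1.
  rewrite !crosspM nsqM !pmulr_rge0 // ler_pM2l // third.
  move: s2 s0; rewrite omegaE; case: u => p q; rewrite /crossp /nsq /=; set s := Num.sqrt 3 / 2.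
  move=> s2 s0 k3 k2 k1.
  (* With [u = p + i q], multiplying the edge inequalities in pairs turns membership in the triangle
     into the quadratic bound for its circumscribed disc. *)
  have p12 : 0 <= (s * p - q / 2) * (s * (1 - p) - q / 2) by rewrite mulr_ge0 //; lra.
  have p3 : 0 <= q * (s - q) by rewrite mulr_ge0 //; lra.
  have E1 : s ^+ 2 * (p * (1 - p)) - s * q / 2 + q ^+ 2 / 4 = (s * p - q / 2) * (s * (1 - p) - q / 2) by field.
  rewrite s2 in E1; lra.
have -> : ideal_hull (triV a x) = T; last by [].
by have [_ _ _ ->] := PV; rewrite (tri_of_slice rT PV V0 x0 hT).
Qed.

Lemma sq_tile G P a x : tsys G P -> x != 0 -> let S := horosphere_slice P in S (SQ a x) ->
  adj S (a + x) (- x) -> adj S (a + x + x * I) (- (x * I)) -> adj S (a + x * I) x -> adj S a (x * I) ->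
  P (ideal_hull (sqV a x)).
Proof.
move=> sys x0 S /slice_tile[T PT hT] e1 e2 e3 e4.
have rT := ts_tile sys PT; have [V PV] := regular_polyh rT.
have nx : 0 < nsq x by rewrite nsq_gt0.
have half b y : adj S (b + y) (- y) -> y != 0 -> SQ a x = SQ b y ->
    forall w, V (Some (w, 0)) -> 0 <= crossp y (w - b).
  move=> hadj y0 EQ; rewrite EQ in hT.
  have ny : 0 < nsq y by rewrite nsq_gt0.
  have hc v u : crossp y (b + y * (v +i* u) - b) = nsq y * u.
    have -> : b + y * (v +i* u) - b = y * (v +i* u) by ring.
    rewrite -{1}[y]mulr1 crosspM; congr (_ * _); rewrite /crossp /=; ring.
  have [p1 p2 p3 p4] := SQ_points b y.
  apply: (edge_halfplane (d := b + y * I) sys PT hT PV) => //.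
  - by have := hc 0 1; rewrite -iE mulr1 => ->.
  - by move=> z /SQ_inv[v [u [v0 u0 ->]]]; rewrite hc mulr_ge0 ?(ltW ny).
have h1 := half _ _ e1 x0 erefl.
have h2 : forall w, V (Some (w, 0)) -> 0 <= crossp (x * I) (w - (a + x)).
  by apply: half => //; [rewrite mulf_neq0 // i_neq0|exact: SQ_rot].
have h3 : forall w, V (Some (w, 0)) -> 0 <= crossp (- x) (w - (a + x + x * I)).
  have E : x * I * I = - x by rewrite -mulrA i_sqr mulrN1.
  apply: half; first by rewrite opprK; have -> : a + x + x * I - x = a + x * I by ring.
    by rewrite oppr_eq0.
  by rewrite SQ_rot SQ_rot E.
have h4 : forall w, V (Some (w, 0)) -> 0 <= crossp (- (x * I)) (w - (a + x * I)).
  have E : x * I * I = - x by rewrite -mulrA i_sqr mulrN1.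
  apply: half; first by rewrite opprK addrK.
    by rewrite oppr_eq0 mulf_neq0 // i_neq0.
  rewrite SQ_rot SQ_rot SQ_rot E; congr (SQ _ _); ring.
(* As for triangles: otherwise the vertices lie in the disc around the square, whose hemisphere has
   height 0 over the corner [a]. *)
have V0 : V None.
  apply: contrapT => V0; have [Vi _ _ EV] := PV.
  have Ta : ideal_hull V (Some (a, 1)).
    by rewrite -EV; apply/hT; have [] := SQ_points a x.
  pose c := a + x * (2^-1 +i* 2^-1).
  suff : nsq (a - c) + 1 ^+ 2 <= nsq x / 2.
    have -> : a - c = x * (- (2^-1 +i* 2^-1)) by rewrite /c; ring.
    by rewrite nsqM nsqN {2}/nsq /=; lra.
  apply: hull_disc Ta; last by rewrite divr_gt0.
  move=> v Vv; case: (Vi _ Vv) => [e|[w e]]; first by case: V0; rewrite -e.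
  exists w => //; rewrite e in Vv.
  have := h1 _ Vv; have := h2 _ Vv; have := h3 _ Vv; have := h4 _ Vv.
  pose u := (w - a) / x; have -> : w = a + x * u by rewrite /u; field.
  have -> : a + x * u - c = x * (u - (2^-1 +i* 2^-1)) by rewrite /c; ring.
  have -> : a + x * u - (a + x * I) = x * (u - I) by ring.
  have -> : a + x * u - a = x * u by ring.
  have -> : a + x * u - (a + x) = x * (u - 1) by ring.
  have -> : a + x * u - (a + x + x * I) = x * (u - 1 - I) by ring.
  have -> : - (x * I) = x * (- I) by ring.
  have -> : crossp (- x) (x * (u - 1 - I)) = nsq x * crossp (- 1) (u - 1 - I) by rewrite -crosspM mulrN1.
  have -> : crossp x (x * u) = nsq x * crossp 1 u by rewrite -crosspM mulr1.
  rewrite !crosspM nsqM !pmulr_rge0 // ler_pM2l //.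
  case: u => p q; rewrite /crossp /nsq /= => k4 k3 k2 k1.
  have p1 : 0 <= p * (1 - p) by rewrite mulr_ge0 //; lra.
  have p2 : 0 <= q * (1 - q) by rewrite mulr_ge0 //; lra.
  lra.
have -> : ideal_hull (sqV a x) = T; last by [].
by have [_ _ _ ->] := PV; rewrite (sq_of_slice rT PV V0 x0 hT).
Qed.

Lemma tile_at_infty_slice G P T V : tsys G P -> P T -> polyh T V -> V None ->
  exists2 Q, horosphere_slice P Q & has_slice T Q.
Proof.
move=> sys PT PV V0; exists [set z | T (Some (z, 1))] => //; split; last by exists T.
have [Vi _ [x [y [Vx Vy xy]]] ->] := PV.
have [w Vw] : exists w, V (Some (w, 0)).
  case: (Vi _ Vx) => [e|[z e]]; last by exists z; rewrite -e.
  case: (Vi _ Vy) => [e'|[z e']]; last by exists z; rewrite -e'.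
  by case: xy; rewrite e e'.
by exists w; exact: hull_vertical.
Qed.

Lemma polyh_triV (a x : C) : x != 0 -> polyh (ideal_hull (triV a x)) (triV a x).
Proof.
move=> x0; split=> //.
- by move=> v [[[->|->]|->]|->]; try (by left); right; eexists.
- by rewrite /triV !finite_setU; do !split; exact: finite_set1.
- by exists None, (Some (a, 0)); split; [left; left; left|left; left; right|].
Qed.

Lemma polyh_sqV (a x : C) : x != 0 -> polyh (ideal_hull (sqV a x)) (sqV a x).
Proof.
move=> x0; split=> //.
- by move=> v [[[[[->|->]|->]|->]|->]|->]; try (by left); right; eexists.
- by rewrite /sqV !finite_setU; do !split; exact: finite_set1.
- by exists None, (Some (a, 0)); split; [left; left; left; left; left|left; left; left; left; right|].
Qed.

(** The point [1 / 2 + i / 5] is interior to both polygons. High above it there is a point inner to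
    the tetrahedron that also lies in the octahedron, so the tiles would coincide, but the corner
    [a + x * (1 + i)] belongs to only one of them. *)
Lemma tri_sq_exclusive G P a x : tsys G P -> x != 0 -> P (ideal_hull (triV a x)) ->
  P (ideal_hull (sqV a x)) -> False.
Proof.
move=> sys x0 P1 P2; have [s2 s0] := half_sqrt3 R.
have nx : 0 < nsq x by rewrite nsq_gt0.
set s := Num.sqrt 3 / 2 in s2 s0.
have sn : s != 0 by rewrite gt_eqF //; lra.
pose B := 1 + nsq a + nsq (a + x) + nsq (a + x * w6) + nsq (a + x * I).
have n1 := nsq_ge0 a; have n2 := nsq_ge0 (a + x); have n3 := nsq_ge0 (a + x * w6); have n4 := nsq_ge0 (a + x * I).
have B1 : 1 <= B by rewrite /B; lra.
pose r := (1 / 5) / s : R.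
have r1 : r < 1 / 4 by rewrite /r ltr_pdivrMr; lra.
have r0 : 0 < r by rewrite /r divr_gt0 //; lra.
pose z := a + x * (2^-1 +i* 5^-1).
have E1 : z = (1 - (2^-1 - r / 2) - r)%:C * a + (2^-1 - r / 2)%:C * (a + x) + r%:C * (a + x * w6).
  have -> : (1 - (2^-1 - r / 2) - r)%:C = 1 - (2^-1 - r / 2)%:C - r%:C by rewrite !rmorphB rmorph1.
  have e : 2^-1 +i* 5^-1 = (2^-1 - r / 2)%:C + r%:C * w6.
    by apply: complexE2; rewrite /r omegaE -/s /=; field.
  by rewrite /z e; ring.
have E2 : z = (3 / 10)%:C * a + (1 / 2)%:C * (a + x) + (1 / 5)%:C * (a + x * I).
  have -> : (3 / 10)%:C = 1 - (1 / 2)%:C - (1 / 5)%:C :> C.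
    by rewrite (_ : 3 / 10 = 1 - 1 / 2 - 1 / 5) ?rmorphB ?rmorph1 //; lra.
  have e : 2^-1 +i* 5^-1 = (1 / 2)%:C + (1 / 5)%:C * I by apply: complexE2; rewrite /=; lra.
  by rewrite /z e; ring.
have hB : B <= B ^+ 2 by rewrite expr2 ler_peMl //; lra.
have n5 := nsq_ge0 z.
have B0 : 0 < B by lra.
have in1 : inner (ideal_hull (triV a x)) (Some (z, B)).
  rewrite E1; apply: hull_infty_inner.
  - by left; left; left.
  - by left; left; right.
  - by left; right.
  - by right.
  - lra.
  - lra.
  - lra.
  - ring.
  - by [].
  - have -> : a + x - a = x * 1 by ring.
    have -> : a + x * w6 - a = x * w6 by ring.
    by rewrite crosspM mulf_neq0 ?gt_eqF // omegaE -/s /crossp /=; lra.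
  - rewrite -E1; apply: lt_le_trans (_ : B ^+ 2 <= _); last by lra.
    apply: lt_le_trans hB; rewrite /B.
    have q1 : (1 - (2^-1 - r / 2) - r) * nsq a <= nsq a by rewrite ler_piMl //; lra.
    have q2 : (2^-1 - r / 2) * nsq (a + x) <= nsq (a + x) by rewrite ler_piMl //; lra.
    have q3 : r * nsq (a + x * w6) <= nsq (a + x * w6) by rewrite ler_piMl //; lra.
    lra.
have in2 : ideal_hull (sqV a x) (Some (z, B)).
  rewrite E2; apply: hull_infty_comb.
  - by left; left; left; left; left.
  - by left; left; left; left; right.
  - by left; left; left; right.
  - by left; right.
  - lra.
  - lra.
  - lra.
  - lra.
  - by [].
  - rewrite -E2; apply: le_trans (_ : B ^+ 2 <= _); last by lra.
    apply: le_trans hB; rewrite /B; lra.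
have := inner_eq sys P1 P2 in1 in2.
have h1 := polyh_triV a x0; have h2 := polyh_sqV a x0 => e; rewrite e in h1.
have : triV a x (Some (a + x * (1 + I), 0)).
  by rewrite (polyh_inj h1 h2); apply/sqV_fin; exists (1 + I) => //; right; right; left.
move=> /triV_fin[c hc /addrI/(mulfI x0) ec].
by case: hc ec => [<-|[<-|[<-|//]]] ec; move: (congr1 (@complex.Re R) ec) (congr1 (@complex.Im R) ec);
  rewrite ?omegaE -/s /=; lra.
Qed.

End Peripheral.

(** * The tiling S *)

Section TilingS.
Variable R : realType.
Local Notation C := R[i].
Local Notation w6 := (omega R).
Local Notation I := ('i : C).
Implicit Types (V T : set (mpoint R)) (P : set (set (mpoint R))).
Implicit Types G : set (mpoint R -> mpoint R).

(* A primitive twelfth root of unity: all vertices of S lie in Z[z12]. *)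
Definition z12 : C := (Num.sqrt 3 / 2) +i* 2^-1.
Local Notation z := z12.

Lemma z12_rel : z ^+ 4 = z ^+ 2 - 1.
Proof.
have [h _] := half_sqrt3 R; rewrite /z12; move: h; set s := Num.sqrt 3 / 2 => h.
have e : (s +i* 2^-1) ^+ 2 = 2^-1 +i* s by rewrite expr2; apply: complexE2; rewrite /= -?expr2 ?h; lra.
by rewrite (exprM _ 2 2) e expr2; apply: complexE2; rewrite /= -?expr2 ?h; lra.
Qed.

Lemma omega_z12 : w6 = z ^+ 2.
Proof.
have [h _] := half_sqrt3 R; rewrite /z12 omegaE; move: h; set s := Num.sqrt 3 / 2 => h.
by rewrite expr2; apply: complexE2; rewrite /= -?expr2 ?h; lra.
Qed.

Lemma i_z12 : I = z ^+ 3.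
Proof.
rewrite exprS -omega_z12; have [h _] := half_sqrt3 R; rewrite /z12 omegaE; move: h; set s := Num.sqrt 3 / 2 => h.
by apply: complexE2; rewrite /= -?expr2 ?h; lra.
Qed.

Lemma spacing_z12 : (spacing R)%:C = 2 + 2 * z - z ^+ 3.
Proof.
have -> : (2 : C) = (2 : R)%:C by rewrite rmorph_nat.
by rewrite -i_z12 /z12 /spacing; apply: complexE2; rewrite /=; lra.
Qed.

Lemma diag_left_z12 : (spacing R / 2) +i* (1 / 2) = 1 + z.
Proof. by rewrite /z12 /spacing; apply: complexE2; rewrite /=; lra. Qed.

Lemma diag_right_z12 : (spacing R / 2) -i* (1 / 2) = 1 + z - z ^+ 3.
Proof. by rewrite -i_z12 /z12 /spacing; apply: complexE2; rewrite /=; lra. Qed.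

(** The inverse, and conjugate, of [z], by the relation [z ^+ 4 = z ^+ 2 - 1]. *)
Local Notation z' := (z - z ^+ 3).

Definition hexdir (W : C) := exists k : nat, W = w6 ^+ k.

Lemma hexdir1 : hexdir 1. Proof. by exists 0%N; rewrite expr0. Qed.

Lemma hexdir_mul W : hexdir W -> hexdir (W * w6).
Proof. by case=> k ->; exists k.+1; rewrite exprSr. Qed.

Lemma hexdir_inv W : hexdir W -> hexdir (W * (1 - w6)).
Proof.
case=> k ->; exists (k + 5)%N; rewrite exprD omega_z12; congr (_ * _).
by have h := z12_rel; ring: h.
Qed.

Lemma hexdir_opp W : hexdir W -> hexdir (- W).
Proof.
case=> k ->; exists (k + 3)%N; rewrite exprD -mulrN1 omega_z12; congr (_ * _).
by have h := z12_rel; ring: h.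
Qed.

Lemma hexdir_neq0 W : hexdir W -> W != 0.
Proof. by case=> k ->; rewrite expf_neq0 // omega_neq0. Qed.

Lemma z12_neq0 : z != 0.
Proof. by have := omega_neq0 R; rewrite omega_z12 expf_eq0. Qed.

Lemma z'_neq0 : z' != 0.
Proof.
have h := z12_rel; apply/eqP => e; have : z * z' = 1 by ring: h.
by rewrite e mulr0 => /esym/eqP; rewrite oner_eq0.
Qed.

Local Notation L := (@hex_lattice R).

Lemma lattice0 : L 0.
Proof. by exists 0, 0; ring. Qed.

Lemma lattice_add l l' : L l -> L l' -> L (l + l').
Proof. by case=> m [n ->] [m' [n' ->]]; exists (m + m'), (n + n'); rewrite !rmorphD /=; ring. Qed.

Lemma lattice_omega l : L l -> L (l * w6).
Proof.
case=> m [n ->]; exists (- n), (m + n); rewrite rmorphN rmorphD /=.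
by have h := omega_sqr R; ring: h.
Qed.

Lemma lattice_dir l W : L l -> hexdir W -> L (l * W).
Proof.
move=> Ll [k ->]; elim: k => [|k IH]; first by rewrite expr0 mulr1.
by rewrite exprSr mulrA; exact: lattice_omega.
Qed.

Lemma lattice_spacing W : hexdir W -> L ((spacing R)%:C * W).
Proof. by move=> hW; apply: lattice_dir => //; exists 1, 0; ring. Qed.

Lemma conv3_swap (p q r : C) : convex_hull [:: p; q; r] = convex_hull [:: p; r; q].
Proof.
apply/seteqP; split=> y /conv3E[a [b [c [a0 b0 c0 e ->]]]]; apply/conv3E; (exists a, c, b; split=> //; [lra|ring]).
Qed.

Lemma conv4_refl (p q r s : C) : convex_hull [:: p; q; r; s] = convex_hull [:: p; s; r; q].
Proof.
apply/seteqP; split=> y /conv4E[a [b [c [d [a0 b0 c0 d0 [e ->]]]]]]; apply/conv4E;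
  (exists a, d, c, b; split=> //; split; [lra|ring]).
Qed.

(** A normal form in which each tile lies to the left of a directed edge. The vertices occurring are
    [l], [l + W], and the ends [l + W * (1 + z)] and [l + W * (1 + z')] of the short diagonal in
    direction [W]. *)
Lemma tiling_SE Q : @tiling_S R Q <-> exists l W, [/\ L l, hexdir W &
  [\/ Q = TQ l W, Q = TQ (l + W) (W * z'), Q = TQ (l + W * (1 + z)) (W * w6) | Q = SQ (l + W) (W * z)]].
Proof.
have h := z12_rel.
have EA l k : convex_hull [:: l; hex_vertex l k; hex_vertex l k.+1] = TQ l (w6 ^+ k).
  by rewrite /TQ /hex_vertex exprSr.
have EB l k : convex_hull [:: hex_vertex l k; diag_left l k; diag_right l k] = TQ (l + w6 ^+ k) (w6 ^+ k * z').
  rewrite /TQ conv3_swap /hex_vertex /diag_left /diag_right diag_left_z12 diag_right_z12.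
  move: (w6 ^+ k) => W; rewrite omega_z12; congr (convex_hull [:: _; _; _]); first by ring.
  by ring: h.
have EC l k : convex_hull [:: diag_left l k; diag_right l k.+1; diag_left (neighbor l k) k.+2] =
    TQ (l + w6 ^+ k * (1 + z)) (w6 ^+ k * w6).
  rewrite /TQ conv3_swap /diag_left /diag_right /neighbor diag_left_z12 diag_right_z12 spacing_z12 !exprSr.
  move: (w6 ^+ k) => W; rewrite omega_z12; congr (convex_hull [:: _; _; _]); by ring: h.
have ED l k : convex_hull [:: hex_vertex l k; hex_vertex l k.+1; diag_right l k.+1; diag_left l k] =
    SQ (l + w6 ^+ k) (w6 ^+ k * z).
  rewrite /SQ conv4_refl /hex_vertex /diag_left /diag_right diag_left_z12 diag_right_z12 !exprSr i_z12.
  move: (w6 ^+ k) => W; rewrite omega_z12; congr (convex_hull [:: _; _; _; _]); by ring: h.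
split=> [[l [k [Ll hQ]]]|[l [_ [Ll [k ->] hQ]]]].
  by exists l, (w6 ^+ k); split=> //; [exists k|rewrite -EA -EB -EC -ED].
by exists l, k; split=> //; rewrite EA EB EC ED.
Qed.

Lemma TQ_rot2 a x : TQ a x = TQ (a + x * w6) (- (x * w6)) :> set C.
Proof.
rewrite TQ_rot TQ_rot; have h := omega_sqr R.
by congr (TQ _ _); ring: h.
Qed.

Lemma SQ_rot2 a x : SQ a x = SQ (a + x + x * I) (- x) :> set C.
Proof. by rewrite SQ_rot SQ_rot; have h := i_sqr R; congr (SQ _ _); ring: h. Qed.

Lemma SQ_rot3 a x : SQ a x = SQ (a + x * I) (- (x * I)) :> set C.
Proof. by rewrite SQ_rot2 SQ_rot; have h := i_sqr R; congr (SQ _ _); ring: h. Qed.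

Lemma triV_rot2 a x : triV a x = triV (a + x * w6) (- (x * w6)) :> set (mpoint R).
Proof.
rewrite triV_rot triV_rot; have h := omega_sqr R.
by congr (triV _ _); ring: h.
Qed.

Lemma sqV_rot2 a x : sqV a x = sqV (a + x + x * I) (- x) :> set (mpoint R).
Proof. by rewrite sqV_rot sqV_rot; have h := i_sqr R; congr (sqV _ _); ring: h. Qed.

Lemma sqV_rot3 a x : sqV a x = sqV (a + x * I) (- (x * I)) :> set (mpoint R).
Proof. by rewrite sqV_rot2 sqV_rot; have h := i_sqr R; congr (sqV _ _); ring: h. Qed.

Section Facts.
Variables (l W : C).
Hypotheses (Ll : L l) (hW : hexdir W).

Lemma S_hex : @tiling_S R (TQ l W).
Proof. by apply/tiling_SE; exists l, W; split=> //; constructor 1. Qed.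

Lemma S_rhomb : @tiling_S R (TQ (l + W) (W * z')).
Proof. by apply/tiling_SE; exists l, W; split=> //; constructor 2. Qed.

Lemma S_mid : @tiling_S R (TQ (l + W * (1 + z)) (W * w6)).
Proof. by apply/tiling_SE; exists l, W; split=> //; constructor 3. Qed.

Lemma S_sq : @tiling_S R (SQ (l + W) (W * z)).
Proof. by apply/tiling_SE; exists l, W; split=> //; constructor 4. Qed.

End Facts.

Section Tiles.
Variables (G : set (mpoint R -> mpoint R)) (P : set (set (mpoint R))).
Hypotheses (sys : tsys G P) (hs : horosphere_slice P = @tiling_S R).

Definition has_tri a x := P (ideal_hull (triV a x)).
Definition has_sq a x := P (ideal_hull (sqV a x)).

Lemma TL_rot2 a x : has_tri a x -> has_tri (a + x * w6) (- (x * w6)).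
Proof. by rewrite /has_tri -triV_rot2. Qed.
Lemma SL_rot2 a x : has_sq a x -> has_sq (a + x + x * I) (- x).
Proof. by rewrite /has_sq -sqV_rot2. Qed.
Lemma SL_rot a x : has_sq a x -> has_sq (a + x) (x * I).
Proof. by rewrite /has_sq -sqV_rot. Qed.
Lemma SL_rot3 a x : has_sq a x -> has_sq (a + x * I) (- (x * I)).
Proof. by rewrite /has_sq -sqV_rot3. Qed.

Ltac z12_ring := have := z12_rel; rewrite ?spacing_z12 ?omega_z12 ?i_z12; let h := fresh in move=> h; ring: h.

(** The neighbours are the previous sixth of the hexagon, a square and the next sixth. *)
Lemma TL_hex l W : L l -> hexdir W -> has_tri l W.
Proof.
move=> Ll hW; apply: (tri_tile sys (hexdir_neq0 hW)); rewrite hs; first exact: S_hex.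
- left; have := S_hex Ll (hexdir_inv hW); rewrite TQ_rot2; congr (tiling_S (TQ _ _)); z12_ring.
- right; have := S_sq Ll hW; rewrite SQ_rot3; congr (tiling_S (SQ _ _)); z12_ring.
- left; exact: (S_hex Ll (hexdir_mul hW)).
Qed.

(** The neighbours are two halves of rhombi on opposite sides, a middle triangle, and a sixth of the
    hexagon. *)
Lemma SL_sq l W : L l -> hexdir W -> has_sq (l + W) (W * z).
Proof.
move=> Ll hW; apply: (sq_tile sys); rewrite ?hs; first by rewrite mulf_neq0 ?(hexdir_neq0 hW) ?z12_neq0.
- exact: S_sq.
- left; have := S_rhomb Ll hW; rewrite TQ_rot2; congr (tiling_S (TQ _ _)); z12_ring.
- left; have := S_mid Ll hW; rewrite TQ_rot2; congr (tiling_S (TQ _ _)); z12_ring.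
- left; have := S_rhomb Ll (hexdir_mul hW); congr (tiling_S (TQ _ _)); z12_ring.
- left; have := S_hex Ll hW; rewrite TQ_rot; congr (tiling_S (TQ _ _)); z12_ring.
Qed.

(** The same square, based on the edge that it shares with the middle triangle. *)
Lemma SL_mid l W : L l -> hexdir W -> has_sq (l + W * (1 + z)) (W * w6 * w6).
Proof.
move=> Ll hW; have := SL_rot (SL_sq Ll hW); congr (has_sq _ _); z12_ring.
Qed.

Lemma hexdir_mul2 W : hexdir W -> hexdir (W * w6 * w6).
Proof. by move=> hW; do 2 apply: hexdir_mul. Qed.

Lemma TL_SL a x : x != 0 -> has_tri a x -> has_sq a x -> False.
Proof. exact: (tri_sq_exclusive sys). Qed.

End Tiles.
End TilingS.

Ltac const_absurd R E :=
  let s2 := fresh in let s1 := fresh in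
  exfalso; have [s2 s1] := half_sqrt3 R; move: (congr1 (@complex.Re R) E) (congr1 (@complex.Im R) E);
  rewrite ?omegaE /=; move: s2 s1; clear; move: (Num.sqrt 3 / 2) => s *; lra.

(** * Stars of vertices *)

Section Contradiction.
Variable R : realType.
Local Notation C := R[i].
Local Notation w6 := (omega R).
Local Notation I := ('i : C).
Local Notation z := (z12 R).
Local Notation z' := (z12 R - z12 R ^+ 3).
Local Notation L := (@hex_lattice R).
Implicit Types V T : set (mpoint R).

Ltac z12_ring := have := z12_rel R; rewrite ?spacing_z12 ?omega_z12 ?i_z12; let h := fresh in move=> h; ring: h.

Lemma triV_eq (a x p v : C) : x != 0 -> v != 0 -> triV a x = triV p v ->
  [\/ a = p /\ x = v, a = p + v /\ x = v * (w6 - 1) | a = p + v * w6 /\ x = - (v * w6)].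
Proof.
move=> x0 v0 E.
have : triV p v (Some (a, 0)) by rewrite -E; apply/triV_fin; exists 0; [left|ring].
have : triV p v (Some (a + x, 0)) by rewrite -E; apply/triV_fin; exists 1; [right; left|ring].
have : triV p v (Some (a + x * w6, 0)) by rewrite -E; apply/triV_fin; exists w6; [right; right; left|ring].
move=> /triV_fin[c2 h2 E2] /triV_fin[c1 h1 E1] /triV_fin[c0 h0 E0].
have xE : x = v * (c1 - c0) by apply: (addrI a); rewrite E1 E0; ring.
have E3 : (c1 - c0) * w6 = c2 - c0.
  by apply: (mulfI v0); rewrite mulrA -xE; apply: (addrI a); rewrite E2 E0; ring.
have O := omega_sqr R.
move: h0 h1 h2 E0 xE E3 => [<-|[<-|[<-|//]]] [<-|[<-|[<-|//]]] [<-|[<-|[<-|//]]] E0 xE E3;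
  try (by rewrite xE subrr mulr0 eqxx in x0);
  try (by constructor 1; rewrite E0 xE; split; ring: O);
  try (by constructor 2; rewrite E0 xE; split; ring: O);
  try (by constructor 3; rewrite E0 xE; split; ring: O); const_absurd R E3.
Qed.

Lemma triV_sqV (a x p v : C) : v != 0 -> triV a x <> sqV p v.
Proof.
move=> v0 E.
have : triV a x (Some (p, 0)) by rewrite E; apply/sqV_fin; exists 0; [left|ring].
have : triV a x (Some (p + v, 0)) by rewrite E; apply/sqV_fin; exists 1; [right; left|ring].
have : triV a x (Some (p + v * (1 + I), 0)) by rewrite E; apply/sqV_fin; exists (1 + I) => //; right; right; left.
move=> /triV_fin[c2 h2 E2] /triV_fin[c1 h1 E1] /triV_fin[c0 h0 E0].
have vE : v = x * (c1 - c0) by apply: (addrI p); rewrite E1 E0; ring.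
have x0 : x != 0 by apply: contraNneq v0 => x0; rewrite vE x0 mul0r.
have E3 : (c1 - c0) * (1 + I) = c2 - c0.
  by apply: (mulfI x0); rewrite mulrA -vE; apply: (addrI p); rewrite E2 E0; ring.
move: h0 h1 h2 vE E3 => [<-|[<-|[<-|//]]] [<-|[<-|[<-|//]]] [<-|[<-|[<-|//]]] vE E3;
  try (by rewrite vE subrr mulr0 eqxx in v0); const_absurd R E3.
Qed.

Lemma iso_pole (f : mpoint R -> mpoint R) p : iso true f -> f (Some (p, 0)) = None ->
  exists a u, [/\ u != 0, f None = Some (a, 0) & forall y, y != p -> f (Some (y, 0)) = Some (a + u / (y - p), 0)].
Proof.
move=> /iso_boundary[a [b [c [d [h E]]]]] fp.
have := E (Some p); rewrite /= fp; case: ifPn => // /eqP cp _.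
have c0 : c != 0.
  by apply: contraNneq h => c0; rewrite c0 mul0r add0r in cp; rewrite c0 cp !mulr0 subr0.
have dE : d = - (c * p) by apply/eqP; rewrite -addr_eq0 addrC cp.
exists (a / c), ((b * c - a * d) / c ^+ 2); split.
- rewrite mulf_neq0 ?invr_eq0 ?expf_neq0 //; apply: contraNneq h => e.
  by rewrite -oppr_eq0 opprB e.
- by have := E None; rewrite /= (negPf c0).
- move=> y yp; have := E (Some y); rewrite /= => ->.
  have e : c * y + d = c * (y - p) by rewrite dE; ring.
  have yp' : y - p != 0 by rewrite subr_eq0.
  rewrite e mulf_eq0 (negPf c0) (negPf yp') /= dE; congr (Some (_, _)); field.
  by rewrite yp' c0.
Qed.

Variables (G : set (mpoint R -> mpoint R)) (P : set (set (mpoint R))).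
Hypotheses (sys : tsys G P) (hs : horosphere_slice P = @tiling_S R).
Local Notation TL := (has_tri P).
Local Notation SL := (has_sq P).

(** The converse of [TL_hex]: the slice of a tetrahedron at infinity is a tile of S, and the edge
    from [a] to [a + x] is one of its three edges. The names [p] and [v] keep the nine cases
    uniform. *)
Lemma TL_classify a x : x != 0 -> TL a x -> exists l W, [/\ L l, hexdir W &
  [\/ exists2 p, p = l & exists2 v, v = W & [\/ a = p /\ x = v, a = p + v /\ x = v * (w6 - 1) | a = p + v * w6 /\ x = - (v * w6)],
      exists2 p, p = l + W & exists2 v, v = W * z' & [\/ a = p /\ x = v, a = p + v /\ x = v * (w6 - 1) | a = p + v * w6 /\ x = - (v * w6)] |
      exists2 p, p = l + W * (1 + z) & exists2 v, v = W * w6 & [\/ a = p /\ x = v, a = p + v /\ x = v * (w6 - 1) | a = p + v * w6 /\ x = - (v * w6)]]].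
Proof.
move=> x0 hT; have PV := polyh_triV a x0.
have V0 : triV a x None by left; left; left.
have rT := ts_tile sys hT.
have [Q] := tile_at_infty_slice sys hT PV V0.
rewrite hs => /tiling_SE[l [W [Ll hW hQ]]] hsl; have W0 := hexdir_neq0 hW.
exists l, W; split=> //; case: hQ => EQ; rewrite EQ in hsl.
- constructor 1; exists l => //; exists W => //; apply: triV_eq => //.
  exact: (tri_of_slice rT PV V0 W0 hsl).
- have v0 : W * z' != 0 by rewrite mulf_neq0 // z'_neq0.
  constructor 2; exists (l + W) => //; exists (W * z') => //; apply: triV_eq => //.
  exact: (tri_of_slice rT PV V0 v0 hsl).
- have v0 : W * w6 != 0 by rewrite mulf_neq0 // omega_neq0.
  constructor 3; exists (l + W * (1 + z)) => //; exists (W * w6) => //; apply: triV_eq => //.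
  exact: (tri_of_slice rT PV V0 v0 hsl).
- have v0 : W * z != 0 by rewrite mulf_neq0 // z12_neq0.
  by case: (@triV_sqV a x (l + W) (W * z) v0); exact: (sq_of_slice rT PV V0 v0 hsl).
Qed.

Lemma SL_conv a x b y : SL a x -> a = b -> x = y -> SL b y. Proof. by move=> h <- <-. Qed.
Lemma TL_conv a x b y : TL a x -> a = b -> x = y -> TL b y. Proof. by move=> h <- <-. Qed.

(* Up to symmetry there are three directed edges of S with triangles on both
   sides: from the centre of a hexagon to a vertex of it, the reverse, and the
   short diagonal of a rhombus.  In the first case the next tile around [a] is
   a triangle, in the other two it is a square. *)
Lemma double_triangle a x : x != 0 -> TL a x -> TL (a + x) (- x) -> exists l W, [/\ L l, hexdir W &
  [\/ a = l /\ x = W, a = l + W * w6 /\ x = - (W * w6) | a = l + W * (1 + z') /\ x = W * I]].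
Proof.
move=> x0 h1 h2; have nx0 : - x != 0 by rewrite oppr_eq0.
have no := TL_SL sys nx0 h2.
have [l [W [Ll hW hc]]] := TL_classify x0 h1.
have hW2 := hexdir_mul2 hW; have hW4 := hexdir_mul2 hW2.
have Ll1 := lattice_add Ll (lattice_spacing hW).
have Ll2 := lattice_add Ll1 (lattice_spacing hW2).
exists l, W; split=> //; case: hc => [] [p Ep [v Ev hc]]; case: hc => [] [Ea Ex]; rewrite Ep Ev in Ea Ex.
- by constructor 1.
- exfalso; apply: no; rewrite Ea Ex; apply: SL_conv (SL_rot3 (SL_sq sys hs Ll hW)) _ _; z12_ring.
- by constructor 2.
- exfalso; apply: no; rewrite Ea Ex; apply: SL_conv (SL_rot2 (SL_sq sys hs Ll (hexdir_inv hW))) _ _; z12_ring.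
- by constructor 3; rewrite Ea Ex; split; z12_ring.
- exfalso; apply: no; rewrite Ea Ex; apply: SL_conv (SL_sq sys hs Ll hW) _ _; z12_ring.
- exfalso; apply: no; rewrite Ea Ex; apply: SL_conv (SL_mid sys hs Ll1 hW2) _ _; z12_ring.
- exfalso; apply: no; rewrite Ea Ex; apply: SL_conv (SL_mid sys hs Ll2 hW4) _ _; z12_ring.
- exfalso; apply: no; rewrite Ea Ex; apply: SL_conv (SL_mid sys hs Ll hW) _ _; z12_ring.
Qed.

Lemma TL_image f a x b y : G f -> f @` triV a x = triV b y -> TL a x -> TL b y.
Proof. by move=> Gf E h; rewrite /has_tri -E (hull_image _ (ts_iso sys Gf)); exact: (ts_inv sys). Qed.

Lemma SL_image f a x b y : G f -> f @` sqV a x = sqV b y -> SL a x -> SL b y.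
Proof. by move=> Gf E h; rewrite /has_sq -E (hull_image _ (ts_iso sys Gf)); exact: (ts_inv sys). Qed.

(** Six tetrahedra surround the edge from infinity to the centre 0, hence also the vertical edge
    over [f None]. Three consecutive triangles around a vertex of S already force it to be the
    centre of a hexagon. *)
Lemma pole_at_centre f : G f -> f (Some (0, 0)) = None ->
  exists l W, [/\ L l, hexdir W, f None = Some (l, 0) & forall y, y != 0 -> f (Some (y, 0)) = Some (l + W * w6 / y, 0)].
Proof.
move=> Gf f0; have [a [u [u0 fN fy]]] := iso_pole (ts_iso sys Gf) f0.
have {}fy y : y != 0 -> f (Some (y, 0)) = Some (a + u / y, 0) by move=> y0; rewrite fy // subr0.
have w0 := omega_neq0 R; have O := omega_sqr R.
(* With this [x], the tetrahedron over [0], [W], [W * w6] goes to the one over the edge from [a] to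
   [a + x / W]. *)
pose x := u / w6; have x0 : x != 0 by rewrite mulf_neq0 // invr_eq0.
have xE : u = x * w6 by rewrite /x divfK.
have L0 := @lattice0 R; have h1 := @hexdir1 R.
have img W : hexdir W -> TL a (x / W).
  move=> hW; have W0 := hexdir_neq0 hW.
  apply: (TL_image Gf _ (TL_hex sys hs L0 hW)).
  rewrite /triV !image_setU !image_set1 fN f0 !add0r !fy ?mulf_neq0 //.
  have -> : u / (W * w6) = x / W by rewrite xE; field; rewrite W0 w0.
  have -> : u / W = x / W * w6 by rewrite xE; field.
  perm_set.
have t1 : TL a x by apply: TL_conv (img _ h1) _ _; rewrite ?divr1.
have t2 : TL (a + x) (- x).
  apply: TL_conv (TL_rot2 (img _ (hexdir_mul h1))) _ _; rewrite mul1r; field; exact: w0.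
have t3 : TL a (x * w6).
  apply: TL_conv (img _ (hexdir_inv h1)) _ _ => //; rewrite mul1r.
  have e : (1 - w6) * w6 = 1 by ring: O.
  have n0 : 1 - w6 != 0 by apply: contraTneq (oner_neq0 C) => n; rewrite -e n mul0r eqxx.
  by apply: (mulIf n0); rewrite divfK // -mulrA [w6 * _]mulrC e mulr1.
have xw0 : x * w6 != 0 by rewrite mulf_neq0.
have no := TL_SL sys xw0 t3.
have [l [W [Ll hW [] [Ea Ex]]]] := double_triangle x0 t1 t2.
- exists l, W; split=> //; first by rewrite fN Ea.
  by move=> y y0; rewrite fy // xE Ea Ex.
- exfalso; apply: no; rewrite Ea Ex; apply: SL_conv (SL_rot3 (SL_sq sys hs Ll hW)) _ _; z12_ring.
- exfalso; apply: no; rewrite Ea Ex; apply: SL_conv (SL_rot2 (SL_sq sys hs Ll (hexdir_inv hW))) _ _; z12_ring.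
Qed.

(** Both around a vertex of a hexagon and around an end of a short diagonal the tiles are, in cyclic
    order, triangle, triangle, square, triangle, square, so two cases remain. The vector [x] goes
    from [f None] to the image of 0, along the edge between the two adjacent triangles. *)
Lemma pole_at_hex f : G f -> f (Some (1, 0)) = None ->
  exists l W, [/\ L l, hexdir W &
   (f None = Some (l + W * w6, 0) /\ forall y, y != 1 -> f (Some (y, 0)) = Some (l + W * (w6 + w6 / (y - 1)), 0)) \/
   (f None = Some (l + W * (1 + z'), 0) /\ forall y, y != 1 -> f (Some (y, 0)) = Some (l + W * (1 + z' - I / (y - 1)), 0))].
Proof.
move=> Gf f1; have [a [u [u0 fN fy]]] := iso_pole (ts_iso sys Gf) f1.
have w0 := omega_neq0 R; have O := omega_sqr R; have i0 := i_neq0 R.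
pose x := - u; have x0 : x != 0 by rewrite oppr_eq0.
have xE : u = - x by rewrite opprK.
have L0 := @lattice0 R; have h1 := @hexdir1 R; have z0 := z12_neq0 R.
have n01 : (0 : C) != 1 by rewrite eq_sym oner_neq0.
have fz : f (Some (0, 0)) = Some (a + x, 0).
  by rewrite fy // xE; congr (Some (_, _)); rewrite sub0r invrN1; ring.
(* The factor [v] is [- 1 / (y - 1)]; stated as a product, each instance becomes a polynomial
   identity in [z]. *)
have fE y v : v != 0 -> (y - 1) * v = - 1 -> f (Some (y, 0)) = Some (a + x * v, 0).
  move=> v0 e; have y1 : y - 1 != 0.
    by apply: contraTneq (oner_neq0 C) => n; move/eqP: e; rewrite n mul0r eq_sym oppr_eq0 => ->.
  have y1' : y != 1 by rewrite -subr_eq0.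
  rewrite fy // xE; congr (Some (_, _)).
  have -> : (y - 1)^-1 = - v by apply: (mulfI y1); rewrite mulrN e opprK divff.
  ring.
have t1 : TL a x.
  apply: (TL_image Gf _ (TL_hex sys hs L0 h1)).
  rewrite /triV !image_setU !image_set1 fN !add0r mul1r f1 fz (fE _ w6) //; last by ring: O.
  perm_set.
have t2 : TL (a + x) (- x).
  have n0 : 1 - w6 != 0 by apply: (hexdir_neq0 (W := 1 - w6)); rewrite -[1 - w6]mul1r; exact: hexdir_inv.
  apply: (TL_image Gf _ (TL_hex sys hs L0 (hexdir_inv h1))).
  rewrite /triV; have -> : 1 * (1 - w6) * w6 = 1 by ring: O.
  rewrite !image_setU !image_set1 fN !add0r mul1r f1 fz (fE _ (1 - w6)) //; last by ring: O.
  have -> : a + x + - x = a by ring.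
  have -> : a + x + - x * w6 = a + x * (1 - w6) by ring.
  perm_set.
have t3 : SL a (x * w6).
  apply: (SL_image Gf _ (SL_sq sys hs L0 h1)).
  have nE v : v != 0 -> v * z12 R != 0 by move=> v0; rewrite mulf_neq0.
  rewrite /sqV !image_setU !image_set1 fN !add0r !mul1r f1.
  have e3 : z * (z ^+ 3 - z) = -1 by z12_ring.
  have nz' : z ^+ 3 - z != 0.
    by apply: contraTneq (oner_neq0 C) => n; move/eqP: e3; rewrite n mulr0 eq_sym oppr_eq0 => ->.
  have E2 : (2 : C) * (2^-1 +i* 2^-1) = 1 + I.
    have -> : (2 : C) = (2 : R)%:C by rewrite rmorph_nat.
    by apply: complexE2; rewrite /=; lra.
  have m0 : (2^-1 +i* 2^-1 : C) != 0 by apply: complex_neq; left; rewrite /= invr_eq0 pnatr_eq0.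
  have mm : (2^-1 +i* 2^-1) * (1 - I) = 1 :> C by apply: complexE2; rewrite /=; lra.
  have n1I : 1 - I != 0 by apply: contraTneq (oner_neq0 C) => n; rewrite -mm n mulr0 eqxx.
  rewrite (fE (1 + z) (z ^+ 3 - z)) //; last by z12_ring.
  rewrite (fE (1 + z * I) w6) //; last by z12_ring.
  rewrite (fE (1 + z * (2^-1 +i* 2^-1)) ((z ^+ 3 - z) * (1 - I))) ?mulf_neq0 //; last first.
    have -> : (1 + z * (2^-1 +i* 2^-1) - 1) * ((z ^+ 3 - z) * (1 - I)) = z * (z ^+ 3 - z) * ((2^-1 +i* 2^-1) * (1 - I)) by ring.
    by rewrite e3 mm mulr1.
  rewrite (fE (1 + z + z * I) ((z ^+ 3 - z) * (2^-1 * (1 - I)))) ?mulf_neq0 ?invr_eq0 ?pnatr_eq0 //; last first.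
    have -> : (1 + z + z * I - 1) * ((z ^+ 3 - z) * (2^-1 * (1 - I))) = z * (z ^+ 3 - z) * (2^-1 * ((1 + I) * (1 - I))) by ring.
    by rewrite e3 -E2 -mulrA mm mulr1 mulVf ?mulr1 // pnatr_eq0.
  have -> : a + x * w6 + x * w6 * I = a + x * ((z ^+ 3 - z) * (1 - I)) by z12_ring.
  have -> : a + x * w6 * I = a + x * (z ^+ 3 - z) by z12_ring.
  have -> : a + x * w6 * (2^-1 +i* 2^-1) = a + x * ((z ^+ 3 - z) * (2^-1 * (1 - I))).
    have n2 : (2 : C) != 0 by rewrite pnatr_eq0.
    congr (_ + _); apply: (mulfI n2).
    have -> : 2 * (x * w6 * (2^-1 +i* 2^-1)) = x * w6 * (2 * (2^-1 +i* 2^-1)) by ring.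
    have -> : 2 * (x * ((z ^+ 3 - z) * (2^-1 * (1 - I)))) = x * (z ^+ 3 - z) * (1 - I) by field.
    by rewrite E2; z12_ring.
  perm_set.
have xw0 : x * w6 != 0 by rewrite mulf_neq0.
have no h := TL_SL sys xw0 h t3.
have [l [W [Ll hW [] [Ea Ex]]]] := double_triangle x0 t1 t2.
- by exfalso; apply: no; rewrite Ea Ex; exact: (TL_hex sys hs Ll (hexdir_mul hW)).
- exists l, W; split=> //; left; split; first by rewrite fN Ea.
  by move=> y y1; rewrite fy // xE Ea Ex; congr (Some (_, _)); ring.
- exists l, W; split=> //; right; split; first by rewrite fN Ea.
  by move=> y y1; rewrite fy // xE Ea Ex; congr (Some (_, _)); ring.
Qed.

(** All symmetries whose linear part is a power of [omega ^+ 2] and whose translation part is in the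
    lattice; [k = 0] gives the translations. Rotations by pi / 3 are not assumed. *)
Hypothesis rotations : forall l k, L l -> exists f, [/\ G f, f None = None &
  forall y, f (Some (y, 0)) = Some (l + w6 ^+ (2 * k) * y, 0)].

(* The parameter of [f] at 1 sends infinity either to the vertex of a hexagon
   or to the end of a short diagonal.  In the first case the tile below the
   side of the hexagon, seen from the vertex 0, becomes a square overlapping a
   hexagon.  In the second case conjugating by [f] the rotation about the
   nearest middle triangle gives an element of [G] that permutes infinity and
   the ends of the diagonal; composed with [f] it fixes infinity and moves the
   centre of a hexagon to the end of a diagonal. *)
Lemma no_pole_pair f0 f : G f0 -> f0 (Some (0, 0)) = None -> G f -> f (Some (1, 0)) = None -> False.
Proof.
move=> Gf0 f00 Gf f1; have Gg := ts_group sys.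
have w0 := omega_neq0 R; have O := omega_sqr R; have z0 := z12_neq0 R; have i0 := i_neq0 R.
have h1 := @hexdir1 R; have L0 := @lattice0 R.
have h2 : 2 * (2^-1 +i* 2^-1) = 1 + I :> C.
  have -> : (2 : C) = (2 : R)%:C by rewrite rmorph_nat.
  by apply: complexE2; rewrite /=; lra.
have n2 : (2 : C) != 0 by rewrite pnatr_eq0.
have neq1 (y e c : C) : c != 0 -> (y - 1) * e = c -> y != 1.
  by move=> c0 E; apply: contraNneq c0 => y1; rewrite -E y1 subrr mul0r.
have [l [W [Ll hW [[fN fy]|[fN fy]]]]] := pole_at_hex Gf f1.
  have [l0 [W0 [Ll0 hW0 f0N f0y]]] := pole_at_centre Gf0 f00.
  have [g0 Gg0 [f0K g0K]] := group_inv Gg Gf0.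
  have W00 := hexdir_neq0 hW0.
  (* [c] is a position around [l0] in units of [W0], and [e] is the position of its image around [l]
     in units of [W]. Since [v] is the inverse of [c], [g0] takes the first point to [v * w6]. *)
  have g0E c v e : c * v = 1 -> (v * w6 - 1) * (e - w6) = w6 -> (f \o g0) (Some (l0 + W0 * c, 0)) = Some (l + W * e, 0).
    move=> cv E; have n1 := neq1 _ _ _ w0 E.
    have v0 : v != 0 by apply: contraTneq (oner_neq0 C) => v0; rewrite -cv v0 mulr0 eqxx.
    have -> : Some (l0 + W0 * c, 0) = f0 (Some (v * w6, 0)).
      rewrite f0y ?mulf_neq0 //; congr (Some (_, _)).
      have -> : c = v^-1 by apply: (mulIf v0); rewrite mulVf.
      by field; rewrite v0 w0.
    rewrite /comp f0K fy //; congr (Some (l + W * _, _)).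
    have d0 : v * w6 - 1 != 0 by rewrite subr_eq0.
    have -> : w6 / (v * w6 - 1) = e - w6 by apply: (mulfI d0); rewrite E mulrC divfK.
    ring.
  have F0 : (f \o g0) None = Some (l, 0).
    rewrite /comp -f00 f0K fy 1?eq_sym ?oner_neq0 //; congr (Some (_, _)).
    by rewrite sub0r invrN1; ring.
  have F1 : (f \o g0) (Some (l0 + W0 * w6, 0)) = None.
    have -> : Some (l0 + W0 * w6, 0) = f0 (Some (1, 0)) by rewrite f0y ?oner_neq0 // divr1.
    by rewrite /comp f0K.
  have key : SL (l + W) (- W).
    apply: (SL_image (group_comp Gg Gf Gg0) _ (SL_sq sys hs Ll0 hW0)).
    rewrite /sqV.
    have -> : l0 + W0 + W0 * z + W0 * z * I = l0 + W0 * (z ^+ 2 + z) by z12_ring.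
    have -> : l0 + W0 + W0 * z * I = l0 + W0 * w6 by z12_ring.
    have -> : l0 + W0 + W0 * z * (2^-1 +i* 2^-1) = l0 + W0 * (1 + z * (2^-1 +i* 2^-1)) by ring.
    have -> : l0 + W0 + W0 * z = l0 + W0 * (1 + z) by ring.
    have -> : l0 + W0 = l0 + W0 * 1 by ring.
    have hz := z12_rel R; have Ei := i_z12 R; have Ew := omega_z12 R.
    rewrite !image_setU !image_set1 F0 F1.
    rewrite (@g0E 1 1 1); [|by ring|by z12_ring].
    rewrite (@g0E (1 + z) (z ^+ 2 - z ^+ 3) (1 - (2^-1 +i* 2^-1))); [|by z12_ring|]; last first.
      apply: (mulfI n2).
      have -> : 2 * (((z ^+ 2 - z ^+ 3) * w6 - 1) * (1 - (2^-1 +i* 2^-1) - w6)) =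
        ((z ^+ 2 - z ^+ 3) * w6 - 1) * (2 - 2 * (2^-1 +i* 2^-1) - 2 * w6) by ring.
      by rewrite h2; z12_ring.
    rewrite (@g0E (z ^+ 2 + z) (z - z ^+ 2) (- I)); [|by z12_ring|by z12_ring].
    rewrite (@g0E (1 + z * (2^-1 +i* 2^-1)) ((1 - z) * (1 + z ^+ 3)) (1 - I)); [| |by z12_ring]; last first.
      apply: (mulfI n2).
      have -> : 2 * ((1 + z * (2^-1 +i* 2^-1)) * ((1 - z) * (1 + z ^+ 3))) =
        (2 + z * (2 * (2^-1 +i* 2^-1))) * ((1 - z) * (1 + z ^+ 3)) by ring.
      by rewrite h2; z12_ring.
    have -> : l + W + - W = l by ring.
    have -> : l + - W * I = l + W * - I by ring.
    have -> : l + W + - W * I = l + W * (1 - I) by ring.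
    have -> : l + W + - W * (2^-1 +i* 2^-1) = l + W * (1 - (2^-1 +i* 2^-1)) by ring.
    rewrite mulr1; perm_set.
  have nW : - W != 0 by rewrite oppr_eq0 hexdir_neq0.
  apply: (TL_SL sys nW _ key).
  apply: TL_conv (TL_rot2 (TL_hex sys hs Ll (hexdir_inv hW))) _ _; ring: O.
have W0 := hexdir_neq0 hW; have Lk := lattice_spacing (hexdir_inv hW).
have [f' Gf' [fK f'K]] := group_inv Gg Gf.
have fE y Y : (y - 1) * (1 + z' - Y) = I -> f (Some (y, 0)) = Some (l + W * Y, 0).
  move=> E; have y1 := neq1 _ _ _ i0 E; have d0 : y - 1 != 0 by rewrite subr_eq0.
  rewrite fy //; congr (Some (l + W * _, _)).
  have -> : I / (y - 1) = 1 + z' - Y by apply: (mulfI d0); rewrite E mulrC divfK.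
  ring.
have f'E y Y : (y - 1) * (1 + z' - Y) = I -> f' (Some (l + W * Y, 0)) = Some (y, 0).
  by move/fE <-; rewrite fK.
have f'N : f' (Some (l + W * (1 + z'), 0)) = None by rewrite -fN fK.
(* The rotation about the centroid of [l] and its neighbours in directions [W] and [W * (1 - w6)].
   In the coordinate [Y] of [l + W * Y] it is [Y] to [spacing * (1 - w6) + w6 ^+ 2 * Y]. *)
have [|r [Gr rN r2]] := @rotations (l + (spacing R)%:C * (W * (1 - w6)) + l * - (1 * w6 * w6)) 1%N.
  by apply: lattice_add; [exact: lattice_add|apply: lattice_dir => //; apply: hexdir_opp; exact: hexdir_mul2].
have {}r2 Y Y' : Y' = (spacing R)%:C * (1 - w6) + w6 ^+ 2 * Y -> r (Some (l + W * Y, 0)) = Some (l + W * Y', 0).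
  by move=> ->; rewrite r2 muln1; congr (Some (_, _)); ring.
have [r' Gr' [rK r'K]] := group_inv Gg Gr.
have t3 : (3 : C) * 3^-1 = 1 by rewrite divff // pnatr_eq0.
have hz := z12_rel R; have Ei := i_z12 R; have Ew := omega_z12 R; have Es := spacing_z12 R.
have iw0 : I * w6 != 0 by rewrite mulf_neq0.
have tri := TL_hex sys hs L0 (hexdir_mul h1).
have [k Wk] := hW.
(* The element [b] should carry the frame [(0, 1)] to [(l, W)], which is available when [W] is an
   even power of [w6]. For odd powers the opposite hexagon, with frame [(l + spacing * W, - W)], is
   used, together with the inverse of [r]. *)
case: (boolP (odd k)) => kodd; last first.
  have [b [Gb bN bE]] := @rotations l k./2 Ll.
  have [b' Gb' [bK b'K]] := group_inv Gg Gb.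
  have b'E Y : b' (Some (l + W * Y, 0)) = Some (Y, 0).
    by rewrite Wk -[k in w6 ^+ k]odd_double_half (negPf kodd) add0n -mul2n -bE bK.
  have GF := group_comp Gg Gf' (group_comp Gg Gr (group_comp Gg Gf (group_comp Gg Gb' Gf))).
  have hT : TL (1 + z') (I * w6).
    apply: (TL_image GF _ tri); rewrite /triV !image_setU !image_set1 /comp mul1r !add0r.
    rewrite fN b'E (fE (1 + z') (1 + z' - I * z)); last by z12_ring.
    rewrite (r2 _ (1 + z')); last by z12_ring.
    rewrite f'N.
    rewrite (fE 0 (1 + z)); last by z12_ring.
    rewrite b'E (fE (1 + z) (1 + z' - I * z')); last by z12_ring.
    rewrite (r2 _ (1 + z' - I * z)); last by z12_ring.
    rewrite (f'E (1 + z')); last by z12_ring.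
    rewrite (fE w6 1); last by z12_ring.
    rewrite b'E f1 rN.
    have -> : f' None = Some (1, 0) by rewrite -f1 fK.
    (* [w6 * w6 - 1] has squared modulus 3, so the image of this vertex leaves the ring generated by
       [z] before it returns to it; hence the thirds. *)
    rewrite (fE (w6 * w6) (1 + 2 * 3^-1 * z - 3^-1 * z ^+ 3)); last first.
      by rewrite Ei Ew; field: hz.
    rewrite b'E (fE (1 + 2 * 3^-1 * z - 3^-1 * z ^+ 3) (2 + z - 2 * z ^+ 2 - z ^+ 3)); last first.
      by rewrite Ei; field: hz.
    rewrite (r2 _ (2 + z - z ^+ 3)); last by z12_ring.
    rewrite (f'E (1 - z ^+ 3)); last by z12_ring.
    have -> : 1 + z' + I * w6 * w6 = 1 - z ^+ 3 by z12_ring.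
    have -> : 1 + z' + I * w6 = 1 by z12_ring.
    perm_set.
  apply: (TL_SL sys iw0 hT).
  apply: SL_conv (SL_rot2 (SL_sq sys hs L0 (hexdir_inv h1))) _ _; z12_ring.
have w64 : w6 ^+ 4 = - w6 by rewrite Ew; ring: hz.
have Wk' : - W = w6 ^+ (2 * (k./2 + 2)).
  rewrite Wk -{1}[k]odd_double_half kodd -mul2n mulnDr !exprD w64 expr1.
  by rewrite mulrN mulrC.
have [b [Gb bN bE]] := @rotations (l + (spacing R)%:C * W) (k./2 + 2) (lattice_add Ll (lattice_spacing hW)).
have [b' Gb' [bK b'K]] := group_inv Gg Gb.
(* In the frame of the opposite hexagon the coordinate [Y] becomes [spacing - Y], which exchanges
   the two ends of the short diagonal. *)
have b'E Y q : q = 2 + 2 * z - z ^+ 3 - Y -> b' (Some (l + W * Y, 0)) = Some (q, 0).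
  move=> ->; rewrite -[RHS]bK bE -Wk' Es; congr (b' (Some (_, _))); ring.
have r'2 Y Y' : Y' = (spacing R)%:C * (1 - w6) + w6 ^+ 2 * Y -> r' (Some (l + W * Y', 0)) = Some (l + W * Y, 0).
  by move/r2 <-; rewrite rK.
have u2 : (2 : C) * 2^-1 = 1 by rewrite divff.
have GF := group_comp Gg Gf' (group_comp Gg Gr' (group_comp Gg Gf (group_comp Gg Gb' Gf))).
have hT : TL (1 + z) (- (I * w6)).
  apply: (TL_image GF _ tri); rewrite /triV !image_setU !image_set1 /comp mul1r !add0r.
  rewrite fN (b'E _ (1 + z)); last by ring.
  rewrite (fE (1 + z) (1 + z - z ^+ 2 - z ^+ 3)); last by z12_ring.
  rewrite (r'2 (1 + z')); last by z12_ring.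
  rewrite f'N.
  rewrite (fE 0 (1 + z)); last by z12_ring.
  rewrite (b'E _ (1 + z - z ^+ 3)); last by ring.
  rewrite (fE (1 + z - z ^+ 3) (2 + z - z ^+ 2 - z ^+ 3)); last by z12_ring.
  rewrite (r'2 (1 + z - z ^+ 2 - z ^+ 3)); last by z12_ring.
  rewrite (f'E (1 + z)); last by z12_ring.
  rewrite (fE w6 1); last by z12_ring.
  rewrite (b'E _ (1 + 2 * z - z ^+ 3)); last by ring.
  rewrite (fE _ (4 * 3^-1 + z - 2 * 3^-1 * z ^+ 2 - z ^+ 3)); last first.
    by rewrite Ei; field: hz.
  rewrite (r'2 (4 * 3^-1 + z - 2 * 3^-1 * z ^+ 2 - z ^+ 3)); last first.
    by rewrite Es Ew; field: hz.
  rewrite (f'E (1 + 2 * z - z ^+ 3)); last first.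
    by rewrite Ei; field: hz.
  rewrite (fE (w6 * w6) (1 + 2 * 3^-1 * z - 3^-1 * z ^+ 3)); last first.
    by rewrite Ei Ew; field: hz.
  rewrite (b'E _ (1 + 4 * 3^-1 * z - 2 * 3^-1 * z ^+ 3)); last first.
    by field: hz.
  rewrite (fE _ (3 * 2^-1 + z - z ^+ 2 - z ^+ 3)); last first.
    by rewrite Ei; field: hz.
  rewrite (r'2 (1 + z - 2^-1 * z ^+ 2 - z ^+ 3)); last first.
    by rewrite Es Ew; field: hz.
  rewrite (f'E (1 + 2 * z)); last first.
    by rewrite Ei; field: hz.
  have -> : 1 + z + - (I * w6) * w6 = 1 + 2 * z by z12_ring.
  have -> : 1 + z + - (I * w6) = 1 + 2 * z - z ^+ 3 by z12_ring.
  perm_set.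
have niw0 : - (I * w6) != 0 by rewrite oppr_eq0.
apply: (TL_SL sys niw0 hT).
have Ls := lattice_spacing h1.
apply: SL_conv (SL_rot2 (SL_sq sys hs Ls (hexdir_inv (hexdir_opp h1)))) _ _; z12_ring.
Qed.

End Contradiction.

(** * Normalisation *)

Section Normalisation.
Variable R : realType.
Local Notation C := R[i].
Local Notation w6 := (omega R).
Local Notation I := ('i : C).
Local Notation L := (@hex_lattice R).
Implicit Types (V T : set (mpoint R)) (P : set (set (mpoint R))).
Implicit Types G : set (mpoint R -> mpoint R).

(** From [(t - s) ^ 2 <= M t s] follow [t <= (M + 2) s] and, by symmetry, [s <= (M + 2) t]; the
    horizontal distance is then at most [(M + 2) s] too. This gives a compact box away from height
    0. *)
Lemma hdist_ball_compact q (M : R) : H3 q -> exists K : set (R * R * R),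
  [/\ compact K, K `<=` @upper R & forall p, H3 p -> hdist p q <= M -> (@coord3 R @` K) p].
Proof.
case=> w [s [s0 ->]].
have [M0|M0] := ltP M 0.
  exists set0; split=> //; first exact: compact0.
  move=> p [z [t [t0 ->]]]; rewrite /hdist leNgt; case/negP.
  by apply: lt_le_trans M0 _; rewrite divr_ge0 ?addr_ge0 ?nsq_ge0 ?sqr_ge0 // mulr_ge0 ?(ltW t0) ?(ltW s0).
pose r := (M + 2) * s.
have M2 : 0 < M + 2 by lra.
have r0 : 0 < r by rewrite mulr_gt0.
pose K : set (R * R * R) := (`[complex.Re w - r, complex.Re w + r]%classic `*` `[complex.Im w - r, complex.Im w + r]%classic)
   `*` `[s / (M + 2), r]%classic.
exists K; split.
- by apply: compact_setX; [apply: compact_setX; exact: segment_compact|exact: segment_compact].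
- move=> [[x y] t] [_] /=; rewrite in_itv /= => /andP[h _].
  by apply: lt_le_trans h; rewrite divr_gt0.
- move=> p [[x y] [t [t0 ->]]]; rewrite /hdist ler_pdivrMr ?mulr_gt0 // => h.
  exists (x, y, t) => //; move: h; rewrite /K /nsq.
  have -> : complex.Re (x +i* y - w) = x - complex.Re w by case: (w).
  have -> : complex.Im (x +i* y - w) = y - complex.Im w by case: (w).
  move: (complex.Re w) (complex.Im w) => a b h.
  have hx : 0 <= (x - a) ^+ 2 := sqr_ge0 _; have hy : 0 <= (y - b) ^+ 2 := sqr_ge0 _.
  have ht : 0 <= (t - s) ^+ 2 := sqr_ge0 _.
  have t1 : t <= r.
    by rewrite -(ler_pM2l t0) /r; have := sqr_ge0 s; lra.
  have t2 : s / (M + 2) <= t.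
    by rewrite ler_pdivrMr // -(ler_pM2l s0); have := sqr_ge0 t; lra.
  have small (u : R) : u ^+ 2 <= M * (t * s) -> - r <= u /\ u <= r.
    move=> hu; apply/andP; rewrite -ler_norml -(@ler_pXn2r _ 2) ?nnegrE ?(ltW r0) // real_normK ?num_real //.
    apply: le_trans hu _; have : M * s * t <= M * s * r by rewrite ler_wpM2l // mulr_ge0 // ltW.
    by have : 0 <= s * r by [rewrite mulr_ge0 // ltW]; rewrite /r; lra.
  have [x1 x2] : - r <= x - a /\ x - a <= r by apply: small; lra.
  have [y1 y2] : - r <= y - b /\ y - b <= r by apply: small; lra.
  by split; [split|]; rewrite /= in_itv /=; apply/andP; split; lra.
Qed.

Lemma regular_tile T : regular_ideal_tetrahedron T \/ regular_ideal_octahedron T -> regular T.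
Proof.
by case=> [[g /hyp_isometry_iso[b Ig] E]|[g /hyp_isometry_iso[b Ig] E]]; exists b, g; split=> //; [left|right].
Qed.

Lemma tsys_tiling G P : transformation_group G -> (forall f, G f -> iso true f) ->
  tetra_octahedral_tiling G P -> tsys G P.
Proof.
move=> Gg Gi [[h1 h2 h3 h4] h5 h6 _ _]; split=> //.
- by move=> T /h6/regular_tile.
- move=> q M q3; have [K [cK uK hK]] := hdist_ball_compact M q3.
  apply: sub_finite_set (h3 K cK uK) => T [PT [p Tp hp]]; split=> //.
  by exists p; split=> //; apply: hK => //; exact: h1 PT _ Tp.
Qed.

Lemma orbits_finite G P : transformation_group G -> finite_set (orbits G P) ->
  exists F, [/\ finite_set F, F `<=` P & forall T, P T -> exists2 f, G f & F (f @` T)].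
Proof.
move=> Gg Of.
have H O : exists T, orbits G P O -> P T /\ O = [set f @` T | f in G].
  have [[T PT <-]|nO] := pselect (orbits G P O); first by exists T.
  (* A default for arguments that are not orbits, so that a choice function exists on all sets. *)
  by exists set0.
have [c hc] := boolp.choice H.
exists (c @` orbits G P); split; first exact: finite_image.
  by move=> _ [Q OQ <-]; have [] := hc _ OQ.
move=> T PT; set Q := [set f @` T | f in G].
have OQ : orbits G P Q by exists T.
have [PQ EQ] := hc _ OQ.
have : [set f @` (c Q) | f in G] (c Q).
  by exists id; [case: Gg|rewrite image_id].
rewrite -EQ.
by case=> f Gf fT; exists f => //; exists Q.
Qed.

Lemma mixed_platonic_cofinite G : transformation_group G -> (forall f, G f -> iso true f) ->
  mixed_platonic G -> exists P, tsys G P /\ cofinite G P.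
Proof.
move=> Gg Gi [P [hP f1 f2]]; exists P; split; first exact: tsys_tiling.
have [F1 [a1 b1 c1]] := orbits_finite Gg f1; have [F2 [a2 b2 c2]] := orbits_finite Gg f2.
exists (F1 `|` F2); split; first by rewrite finite_setU.
  by move=> T [/b1[]|/b2[]].
have [_ _ h6 _ _] := hP; move=> T PT.
by case: (h6 _ PT) => hT; [have [//|f Gf] := c1 T|have [//|f Gf] := c2 T]; exists f => //; [left|right].
Qed.

Lemma conj_parabolic b h G v : iso b h -> parabolic_fixed_point (conjugate_by h G) (h v) ->
  parabolic_fixed_point G v.
Proof.
move=> Ih [hvi [f [f' Gf' Ef] [[fp1 [v0 [[v0i fv0] v0u]]] fv]]].
have [k [Ik hK kK]] := iso_inv Ih.
have E x : f (h x) = h (f' x) by rewrite -[LHS]/((f \o h) x) Ef.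
split; first by rewrite -(hK v); exact: (iso_ideal Ik).
exists f' => //; split; last by apply: (can_inj hK); rewrite -E.
split.
  by move=> p p3 fp; apply: (fp1 (h p)); rewrite ?E ?fp //; exact: (iso_H3 Ih).
exists (k v0); split.
  by split; [exact: (iso_ideal Ik)|apply: (can_inj hK); rewrite -E kK].
move=> v' [v'i fv']; rewrite (v0u (h v')) ?hK //; split; first exact: (iso_ideal Ih).
by rewrite E fv'.
Qed.

Definition one_orbit G := forall v w, parabolic_fixed_point G v ->
  parabolic_fixed_point G w -> exists2 f, G f & f v = w.

Lemma conj_one_orbit b h G : iso b h -> one_orbit G -> one_orbit (conjugate_by h G).
Proof.
move=> Ih hG v w; have [k [Ik hK kK]] := iso_inv Ih.
rewrite -(kK v) -(kK w) => /(conj_parabolic Ih) hv /(conj_parabolic Ih) hw.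
have [f Gf fv] := hG _ _ hv hw; have [f' Gf' E] := conj_elt Ih Gf.
by exists f' => //; rewrite E fv.
Qed.

Lemma complex_normE (u : C) : `|u| = (normc u)%:C.
Proof. by case: u. Qed.

Lemma norm_nsq (u v : C) : `|u| = `|v| <-> nsq u = nsq v.
Proof.
rewrite !complex_normE; split=> [/complexI e|e]; first by rewrite -!normc_sqr e.
have ge0 (x : C) : 0 <= normc x by case: x => a b; rewrite /= sqrtr_ge0.
by congr (_%:C); apply/eqP; rewrite -(@eqrXn2 _ 2) // !normc_sqr e.
Qed.

Lemma norm1_nsq (u : C) : `|u| = 1 <-> nsq u = 1.
Proof. by rewrite -[1 in X in X <-> _](@normr1 C) norm_nsq nsq1. Qed.

(** Normalised to fix 0 and 1, an isometry preserves real parts, and its value at [i] has imaginary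
    part 1 or -1, which decides between identity and conjugation. *)
Lemma plane_isometryE (phi : C -> C) : plane_isometry phi ->
  exists e u v, nsq u = 1 /\ phi = fun z => u * (if e then z else conjc z) + v.
Proof.
move=> hphi; have {}hphi z w : nsq (phi z - phi w) = nsq (z - w) by apply/norm_nsq.
pose v := phi 0; pose u := phi 1 - v.
have u1 : nsq u = 1 by rewrite hphi subr0 nsq1.
have u0 : u != 0 by rewrite -nsq_eq0 u1 oner_eq0.
pose chi z := (phi z - v) / u.
have phiE z : phi z = u * chi z + v by rewrite /chi mulrC divfK // subrK.
have chi_iso z w : nsq (chi z - chi w) = nsq (z - w).
  have -> : chi z - chi w = (phi z - phi w) / u by rewrite /chi -mulrBl; congr (_ / _); ring.
  by rewrite nsqM nsqV u1 invr1 mulr1.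
have chi0 : chi 0 = 0 by rewrite /chi subrr mul0r.
have chi1 : chi 1 = 1 by rewrite /chi divff.
have chi_n z : nsq (chi z) = nsq z by have := chi_iso z 0; rewrite chi0 !subr0.
have chi_re z : complex.Re (chi z) = complex.Re z.
  have := chi_iso z 1; have := chi_n z; rewrite chi1.
  by move: (chi z) => c; case: c z => [a b] [x y]; rewrite /nsq /=; lra.
have im2 : complex.Im (chi I) ^+ 2 = 1.
  by have := chi_n I; have := chi_re I; rewrite /nsq /= => ->; rewrite expr0n !add0r expr1n.
have chi_im z : complex.Im (chi z) * complex.Im (chi I) = complex.Im z.
  have := chi_iso z I; have := chi_n z; move: im2; have := chi_re I; have := chi_re z.
  by move: (chi z) (chi I) => c d; case: c d z => [a b] [c d] [x y]; rewrite /nsq /= => -> ->; lra.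
have : (complex.Im (chi I) == 1) || (complex.Im (chi I) == -1).
  by rewrite -sqrf_eq1 im2.
case/orP => /eqP im.
  exists true, u, v; split=> //; apply/funext => z; rewrite phiE; congr (_ * _ + _).
  by apply: complexE2 => //; rewrite -[LHS]mulr1 -im chi_im.
exists false, u, v; split=> //; apply/funext => z; rewrite phiE; congr (_ * _ + _).
apply: complexE2; first by rewrite chi_re; case: (z).
by have := chi_im z; rewrite im mulrN1 => e; rewrite -[LHS]opprK e; case: (z).
Qed.

Lemma TQ_aff (q p a x : C) : (fun y => q * y + p) @` TQ a x = TQ (q * a + p) (q * x).
Proof.
apply/seteqP; split=> [_ [y /conv3E[u [v [w [u0 v0 w0 e ->]]]] <-]|y /conv3E[u [v [w [u0 v0 w0 e ->]]]]].
  apply/conv3E; exists u, v, w; split=> //.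
  have -> : u%:C = 1 - v%:C - w%:C by rewrite (_ : u = 1 - v - w) ?rmorphB ?rmorph1 //; lra.
  ring.
exists (u%:C * a + v%:C * (a + x) + w%:C * (a + x * w6)); first by apply/conv3E; exists u, v, w.
have -> : u%:C = 1 - v%:C - w%:C by rewrite (_ : u = 1 - v - w) ?rmorphB ?rmorph1 //; lra.
by cbv beta; ring.
Qed.

Lemma SQ_aff (q p a x : C) : (fun y => q * y + p) @` SQ a x = SQ (q * a + p) (q * x).
Proof.
apply/seteqP; split=> [_ [y /conv4E[u [v [w [r [u0 v0 w0 r0 [e ->]]]]]] <-]|y /conv4E[u [v [w [r [u0 v0 w0 r0 [e ->]]]]]]].
  apply/conv4E; exists u, v, w, r; split=> //; split=> //.
  have -> : u%:C = 1 - v%:C - w%:C - r%:C by rewrite (_ : u = 1 - v - w - r) ?rmorphB ?rmorph1 //; lra.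
  ring.
exists (u%:C * a + v%:C * (a + x) + w%:C * (a + x + x * I) + r%:C * (a + x * I)).
  by apply/conv4E; exists u, v, w, r.
have -> : u%:C = 1 - v%:C - w%:C - r%:C by rewrite (_ : u = 1 - v - w - r) ?rmorphB ?rmorph1 //; lra.
by cbv beta; ring.
Qed.

(** The rotation by 2 pi / 3 about [l / (1 - w6 ^+ 2)]. For [l] in the lattice these centres are the
    lattice points and the centroids of the middle triangles. *)
Definition hex_rot (l y : C) := w6 ^+ 2 * y + l.

Lemma rot_tiling l Q : L l -> @tiling_S R Q -> @tiling_S R (hex_rot l @` Q).
Proof.
move=> Ll /tiling_SE[l0 [W [Ll0 hW hQ]]]; apply/tiling_SE.
have hW2 := hexdir_mul2 hW; have h1 := @hexdir1 R.
exists (l0 * (1 * w6 * w6) + l), (W * w6 * w6); split=> //.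
  by apply: lattice_add => //; apply: lattice_dir => //; exact: hexdir_mul2.
case: hQ => ->; [constructor 1|constructor 2|constructor 3|constructor 4];
  rewrite /hex_rot ?TQ_aff ?SQ_aff; [congr (TQ _ _)|congr (TQ _ _)|congr (TQ _ _)|congr (SQ _ _)]; ring.
Qed.

Lemma rot3 l y : hex_rot l (hex_rot l (hex_rot l y)) = y.
Proof. by rewrite /hex_rot; have h := z12_rel R; rewrite omega_z12; ring: h. Qed.

Lemma rot_tiling_image l : L l -> tiling_image (hex_rot l) (@tiling_S R) = @tiling_S R.
Proof.
move=> Ll; apply/seteqP; split=> [_ [Q SQ <-]|Q SQ]; first exact: rot_tiling.
exists (hex_rot l @` (hex_rot l @` Q)); first by do 2 apply: rot_tiling => //.
rewrite !image_comp; apply/seteqP; split=> [_ [y Qy <-]|y Qy]; first by rewrite /= rot3.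
by exists y => //=; rewrite rot3.
Qed.

(** If [B \o B] is in [H], so is its square, which is [B]. Otherwise [B] and [B \o B] lie in the
    same other coset, and [B] is their quotient. *)
Lemma index_two_cube (X : Type) (H K : set (X -> X)) (B : X -> X) : index_two_subgroup H K ->
  K B -> K (B \o B) -> B \o (B \o B) = id -> H B.
Proof.
case=> [[H1 H2 H3] _ [g _ hg]] KB KBB B3.
case: (hg _ KB) => // hgB; case: (hg _ KBB) => hBB.
  have -> : B = (B \o B) \o (B \o B) by rewrite -[RHS]compA B3.
  exact: H2.
have [k Hk [kK _]] := H3 _ hgB.
have -> : B = k \o (g \o (B \o B)) by apply/funext => x; symmetry; exact: (kK (B x)).
exact: H2.
Qed.

Lemma tiling_image_comp (X Y Z : Type) (f : Y -> Z) (g : X -> Y) (A : set (set X)) :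
  tiling_image f (tiling_image g A) = tiling_image (f \o g) A.
Proof.
apply/seteqP; split=> [_ [_ [Q AQ <-] <-]|_ [Q AQ <-]].
  by exists Q => //; rewrite image_comp.
by exists (g @` Q); [exists Q|rewrite image_comp].
Qed.

End Normalisation.

(** * Transport of the orbifold to the standard copy of S *)

Section Main.
Variable R : realType.
Local Notation C := R[i].
Local Notation w6 := (omega R).
Local Notation L := (@hex_lattice R).
Implicit Types (V T : set (mpoint R)) (P : set (set (mpoint R))).
Implicit Types G : set (mpoint R -> mpoint R).

Lemma sym_op_comp (A : set (set C)) f g : sym_op A f -> sym_op A g -> sym_op A (f \o g).
Proof.
move=> [[u [v [u1 ->]]] hf] [[u' [v' [u1' ->]]] hg]; split.
  exists (u * u'), (u * v' + v); split; first by rewrite normrM u1 u1' mulr1.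
  by apply/funext => y /=; ring.
by rewrite -tiling_image_comp hg.
Qed.

Lemma rotation_words G : transformation_group G ->
  (forall l, L l -> exists f, [/\ G f, f None = None & forall y, f (Some (y, 0)) = Some (hex_rot l y, 0)]) ->
  forall l k, L l -> exists f, [/\ G f, f None = None & forall y, f (Some (y, 0)) = Some (l + w6 ^+ (2 * k) * y, 0)].
Proof.
move=> Gg h l k; have L0 := @lattice0 R; have [f0 [Gf0 f0N f0E]] := h _ L0.
elim: k l => [|k IH] l Ll; have [f [Gf fN fE]] := h _ Ll.
  (* Three linear parts [w6 ^+ 2] multiply to 1, which leaves the translation by [l]. *)
  exists (f \o (f0 \o f0)); split; first by do 2 apply: group_comp => //.
    by rewrite /= !f0N.
  move=> y; rewrite /= !f0E fE /hex_rot; congr (Some (_, _)); rewrite omega_z12 muln0 expr0.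
  by have hz := z12_rel R; ring: hz.
have [f' [Gf' f'N f'E]] := IH _ L0.
exists (f \o f'); split; [exact: group_comp|by rewrite /= f'N|].
by move=> y; rewrite /= f'E fE /hex_rot mulnS exprD; congr (Some (_, _)); ring.
Qed.

Lemma plane_isometry_extend (phi : C -> C) : plane_isometry phi -> exists e Phi,
  [/\ iso e Phi, Phi None = None & forall y t, Phi (Some (y, t)) = Some (phi y, t)].
Proof.
move=> /plane_isometryE[e [u [v [u1 ->]]]].
have u0 : u != 0 by rewrite -nsq_eq0 u1 oner_eq0.
have nu : normc u = 1.
  by apply/eqP; rewrite -(@eqrXn2 _ 2) ?ler01 ?(ltW (normc_gt0 u0)) // normc_sqr u1 expr1n.
case: e.
  by exists true, (aff u v); split=> // [|y t]; [exact: iso_aff|rewrite /aff nu mul1r].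
exists (true == false), (aff u v \o @reflection R); split=> // [|y t].
  by apply: iso_comp; [exact: iso_aff|exact: iso_refl].
by rewrite /comp /reflection /aff nu mul1r.
Qed.

Lemma conj_rotation (phi psi : C -> C) l : plane_isometry phi -> cancel phi psi -> cancel psi phi ->
  op_plane_isometry (phi \o hex_rot l \o psi).
Proof.
move=> /plane_isometryE[e [u [v [u1 Ephi]]]] phiK psiK.
have u0 : u != 0 by rewrite -nsq_eq0 u1 oner_eq0.
have nw : nsq (w6 ^+ 2) = 1 by rewrite nsqX nsq_omega expr1n.
exists (if e then w6 ^+ 2 else conjc (w6 ^+ 2)),
  (u * (if e then l else conjc l) + v - (if e then w6 ^+ 2 else conjc (w6 ^+ 2)) * v); split.
  by apply/norm1_nsq; case: e {Ephi}; rewrite ?nsq_conj.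
apply/funext => y; rewrite -{2}(psiK y) /comp; move: (psi y) => x.
rewrite Ephi /hex_rot; case: e {Ephi}; first by ring.
rewrite rmorphD rmorphM /=; ring.
Qed.

(** Two conjugations: [g] reaches standard position, and the inverse of the extension of [phi] then
    makes the slice equal to [tiling_S]. The rotations about both kinds of centres become elements
    of the conjugated group. *)
Lemma normalised_system (Gamma : set (mpoint R -> mpoint R)) P' (S : set (set C)) Lambda (phi : C -> C) :
  tsys Gamma P' -> cofinite Gamma P' -> one_orbit Gamma -> plane_isometry phi ->
  S = tiling_image phi (@tiling_S R) -> peripheral_pair Gamma S Lambda ->
  (Lambda = sym_op S \/ index_two_subgroup Lambda (sym_op S)) ->
  exists G P, [/\ tsys G P, cofinite G P, one_orbit G, horosphere_slice P = @tiling_S R &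
    forall l, L l -> exists f, [/\ G f, f None = None & forall y, f (Some (y, 0)) = Some (hex_rot l y, 0)]].
Proof.
move=> sys' cof' orb hphi ES [g [P [/hyp_isometry_iso[c Ig] [std _] ES' EL]]] hL.
have sys1' := tsys_conj Ig sys'; have cof1' := cofinite_conj Ig cof'.
have sys1 := tsys_tiling (ts_group sys1') (ts_iso sys1') std.
have [e [Phi [IPhi PhiN PhiE]]] := plane_isometry_extend hphi.
have [Psi [IPsi PhiK PsiK]] := iso_inv IPhi.
have PsiN : Psi None = None by rewrite -{1}PhiN PhiK.
(* An inverse of [phi], read off from the inverse of its extension at height 1, since surjectivity
   is not part of [plane_isometry]. *)
pose psi y := fpart (Psi (Some (y, 1))).
have phiK : cancel phi psi by move=> y; rewrite /psi -PhiE PhiK.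
have psiK : cancel psi phi.
  move=> y; rewrite /psi; case E : (Psi (Some (y, 1))) => [[x t]|] /=.
    by have := PsiK (Some (y, 1)); rewrite E PhiE => -[].
  by have := PsiK (Some (y, 1)); rewrite E PhiN.
have sys2 := tsys_conj IPsi sys1.
exists (conjugate_by Psi (conjugate_by g Gamma)), [set Psi @` T | T in P]; split=> //.
- exact: (cofinite_transfer sys2 (tsys_conj IPsi sys1') (cofinite_conj IPsi cof1')).
- exact: (conj_one_orbit IPsi (conj_one_orbit Ig orb)).
- have sl T : [set y | (Psi @` T) (Some (y, 1))] = psi @` [set y | T (Some (y, 1))].
    apply/seteqP; split=> [y [p Tp py]|_ [y Ty <-]].
      exists (phi y); last exact: phiK.
      by rewrite /= -PhiE -py PsiK.
    by exists (Some (y, 1)) => //; rewrite -{1}(psiK y) -PhiE PhiK.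
  apply/seteqP; split=> [Q [Q0 [_ [T PT <-] EQ]]|Q SQ].
    move: EQ Q0; rewrite sl => ->; case=> _ [y Ty _].
    have : horosphere_slice P [set y | T (Some (y, 1))] by split; [exists y|exists T].
    by rewrite -ES' ES => -[Q' SQ' <-]; rewrite (image_cancel _ phiK).
  have : S (phi @` Q) by rewrite ES; exists Q.
  rewrite ES' => -[[y _] [T PT EQ]].
  split; last by exists (Psi @` T); [exists T|rewrite sl -EQ (image_cancel _ phiK)].
  have : horosphere_slice P (phi @` Q) by rewrite -ES' ES; exists Q.
  by case=> -[_ [x Qx _]] _; exists x.
move=> l Ll; set B := phi \o hex_rot l \o psi.
have Bphi : B \o phi = phi \o hex_rot l by apply/funext => y; rewrite /B /= phiK.
have symB : sym_op S B.
  split; first exact: conj_rotation.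
  by rewrite ES tiling_image_comp Bphi -tiling_image_comp rot_tiling_image.
have B3 : B \o (B \o B) = id.
  by apply/funext => y; rewrite /B /= !phiK rot3 psiK.
have : Lambda B.
  case: hL => [->//|hL]; exact: (index_two_cube hL symB (sym_op_comp symB symB) B3).
rewrite EL => -[f [Gf fN fE]].
have [k Gk kE] := conj_elt IPsi Gf; exists k.
have kN : k None = None by rewrite -{1}PsiN kE fN PsiN.
split=> // y.
(* The peripheral group is given by its action at height 1. As [k] maps vertical lines to vertical
   lines, ideal points move in the same way. *)
have k1 : k (Some (y, 1)) = Some (hex_rot l y, 1).
  rewrite -{1}(PhiK (Some (y, 1))) PhiE kE fE -[B _]/((B \o phi) y) Bphi /comp -PhiE.
  exact: PhiK.
have [q [p [_ kz]]] := iso_fix_infty (ts_iso sys2 Gk) kN.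
have [s _] := fix_infty_vertical (ts_iso sys2 Gk) kN (kz y) ltr01.
by rewrite k1 kz => -[-> _].
Qed.

End Main.

Theorem proposition6p1 :
  forall R : realType,
  ~ exists (Gamma : set (mpoint R -> mpoint R)) (S : set (set R[i]))
      (Lambda : set (R[i] -> R[i])),
      (hyperbolic_orbifold Gamma /\ orientable Gamma /\ one_cusped Gamma /\
       mixed_platonic Gamma) /\
      (exists2 phi : R[i] -> R[i],
         plane_isometry phi & S = tiling_image phi (@tiling_S R)) /\
      peripheral_pair Gamma S Lambda /\
      (Lambda = sym_op S \/
       index_two_subgroup Lambda (sym_op S) /\ rotation_group_333 Lambda).
Proof.
move=> R [Gamma [S [Lambda [[[Gg _ _ _] [ori [[_ orb] mp]]] [[phi hphi ES] [per hL]]]]]].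
have Gi f : Gamma f -> iso true f by move=> /ori; exact: hyp_op_isometry_iso.
have [P' [sys' cof']] := mixed_platonic_cofinite Gg Gi mp.
have hL' : Lambda = sym_op S \/ index_two_subgroup Lambda (sym_op S).
  by case: hL => [|[]]; [left|right].
have [G [P [sys cof orb' hs rots]]] := normalised_system sys' cof' orb hphi ES per hL'.
have PT := TL_hex sys hs (@lattice0 R) (@hexdir1 R).
have par v : triV 0 1 v -> parabolic_fixed_point G v.
  exact: (parabolic_vertex sys cof PT (polyh_triV _ (oner_neq0 _))).
have parN : parabolic_fixed_point G None by apply: par; left; left; left.
have [|f0 Gf0 f00] := orb' (Some (0, 0)) None _ parN; first by apply: par; left; left; right.
have [|f Gf f1] := orb' (Some (1, 0)) None _ parN.
  by apply: par; left; right; rewrite add0r.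
exact: (no_pole_pair sys hs (rotation_words (ts_group sys) rots) Gf0 f00 Gf f1).
Qed.
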